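(* Let $\phi_1,\phi_2$ be distinct inner functions on $\mathbb{D}$ with $\gcd(\phi_1,\phi_2)=\phi$, and let $\psi_i=\phi_i/\phi$ for $i=1,2$. Then the following are equivalent: (i) the commutator $[P_{\phi_1},P_{\phi_2}]$ has finite rank; (ii) $\psi_1$ or $\psi_2$ is a finite Blaschke product; (iii) $H_{\overline{\psi_1}}$ or $H_{\overline{\psi_2}}$ has finite rank. Moreover, in this case, $$\operatorname{rank}[P_{\phi_1},P_{\phi_2}]=2\min\{\deg(\psi_1),\deg(\psi_2)\}.$$
   Context: $\mathbb{D}$ is the open unit disc, $\mathbb{T}$ the unit circle, $H^2(\mathbb{D})$ the Hardy space, identified with the closed subspace $H^2(\mathbb{T})$ of $L^2(\mathbb{T})$ via boundary values. An inner function is a bounded analytic function $\phi$ on $\mathbb{D}$ with $|\phi|=1$ a.e. on $\mathbb{T}$. For an inner function $\theta$, $P_\theta$ denotes the orthogonal projection of $H^2(\mathbb{D})$ onto the closed subspace $\theta H^2(\mathbb{D})$. For operators, $[P,Q]=PQ-QP$. For inner functions $\phi_1,\phi_2$, $\gcd(\phi_1,\phi_2)$ is the greatest inner function dividing both $\phi_1$ and $\phi_2$ (a common inner divisor divisible by every common inner divisor), unique up to a unimodular constant. A finite Blaschke product is a function $\zeta\prod_{i=1}^n\frac{z-a_i}{1-\overline{a_i}z}$ with $\zeta\in\mathbb{T}$, $n\ge 0$, $a_i\in\mathbb{D}$ (unimodular constants are included, $n=0$). The degree $\deg(\phi)$ of an inner function is the number of its zeros in $\mathbb{D}$ counted with multiplicity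 if $\phi$ is a finite Blaschke product, and $\deg(\phi)=\infty$ otherwise. For $\phi\in L^\infty(\mathbb{T})$, the Hankel operator is $H_\phi:H^2(\mathbb{D})\to L^2(\mathbb{T})\ominus H^2(\mathbb{D})$, $H_\phi f=P_{(H^2)^\perp}(\phi f)$, where $P_{(H^2)^\perp}$ is the orthogonal projection of $L^2(\mathbb{T})$ onto $L^2(\mathbb{T})\ominus H^2(\mathbb{D})$. *)

(* Defs.v *)
From HB Require Import structures.
From mathcomp Require Import all_boot all_order all_algebra.
From mathcomp Require Import all_classical all_reals all_analysis.
From mathcomp Require Import complex.
Set Implicit Arguments.
Unset Strict Implicit.
Unset Printing Implicit Defensive.
Import Order.TTheory GRing.Theory Num.Theory.
Import numFieldNormedType.Exports.
Local Open Scope classical_set_scope.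
Local Open Scope ring_scope.
Local Open Scope complex_scope.

(* The open unit disc is a subtype, so that functions on it have genuine
   equality. Functions on the unit circle are functions of the angle
   [t : R], of which only the values on [[0, 2 pi]] matter. *)
Notation disk R := {z : R[i] | (`|z| < 1)%R}.

Section Abstract.
Variables (R : realType) (V : lmodType R[i]).

Definition commutator (P Q : V -> V) (f : V) : V := P (Q f) - Q (P f).

(* Orthogonal projection of [f] onto [M], for the inner product [ip]; it is
   well defined (up to vectors of norm 0) when [M] is a closed subspace. *)
Definition orthproj (ip : V -> V -> R[i]) (M : set V) (f : V) : V :=
  xget 0 [set g | M g /\ forall h, M h -> ip (f - g) h = 0].

Definition free_mod (N : set V) (n : nat) (e : 'I_n -> V) : Prop :=
  forall c : 'I_n -> R[i],
    N (\sum_(i < n) c i *: e i) -> forall i, c i = 0.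

(* Dimension of the image in [V / N] of a subspace [A], possibly [+oo]: the
   supremum of the sizes of the families in [A] that are free modulo [N]. We
   use [N := [set 0]] when elements of [V] are compared by equality, and for
   [N] the set of null functions when they are compared a.e. *)
Definition dim_mod (N A : set V) : \bar R :=
  ereal_sup [set (n%:R)%:E | n in [set n : nat |
    exists2 e : 'I_n -> V, (forall i, A (e i)) & free_mod N e]].

End Abstract.

Section Hardy.
Variable R : realType.
Implicit Types (f g psi theta : disk R -> R[i]) (u v : R -> R[i]).

Local Notation mu := (@lebesgue_measure R).
Local Notation circle := (`[0, 2 * pi]%classic : set R).

(* As the domain is a disc centered at [0], a function is analytic when it is
   the sum of a single power series; it is in the Hardy space when the Taylor
   coefficients are moreover square-summable. *)
Definition is_taylor (a : nat -> R[i]) f : Prop :=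
  forall z : disk R,
    series (fun n => a n * val z ^+ n : R[i]^o) @ \oo --> (f z : R[i]^o).

Definition analytic f : Prop := exists a, is_taylor a f.

Definition hardy : set (disk R -> R[i]) :=
  [set f | exists2 a, is_taylor a f &
     cvgn (series (fun n => complex.Re `|a n| ^+ 2 : R))].

Lemma disk0_subproof : `|0 : R[i]| < 1.
Proof. by rewrite normr0 ltr01. Qed.

Definition disk0 : disk R := exist _ 0 disk0_subproof.

(* The value of [f] at [r * exp (i t)]; the default value [disk0] is only used
   when that point is not in the disc, hence not for [r] close to [1^-]. *)
Definition radial f (t r : R) : R[i]^o :=
  f (insubd disk0 (r%:C * (cos t +i* sin t))).

(* The value of [lim] is junk where there is no radial limit, which for [f] in
   the Hardy space happens only on a null set (Fatou). *)
Definition boundary f (t : R) : R[i] := lim (radial f t r @[r --> 1^'-]).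

Definition inner theta : Prop :=
  [/\ analytic theta,
      exists M : R, forall z, `|theta z| <= M%:C
    & {ae mu, forall t, circle t ->
        cvg (radial theta t r @[r --> 1^'-]) /\ `|boundary theta t| = 1}].

Definition L2 : set (R -> R[i]) :=
  [set u : R -> R[i] | [/\ measurable_fun circle (fun t => complex.Re (u t)),
               measurable_fun circle (fun t => complex.Im (u t))
             & mu.-integrable circle
                 (fun t => (complex.Re `|u t| ^+ 2)%:E)]].

Definition null_fun : set (R -> R[i]) :=
  [set u : R -> R[i] | {ae mu, forall t, circle t -> u t = 0}].

Definition Cintegral u : R[i] :=
  Rintegral mu circle (fun t => complex.Re (u t))
  +i* Rintegral mu circle (fun t => complex.Im (u t)).

Definition L2_ip u v : R[i] :=
  ((2 * pi)^-1)%:C * Cintegral (fun t => u t * conjc (v t)).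

(* [hardy] as a subspace of L^2 of the circle, through boundary values. *)
Definition hardy_ip f g : R[i] := L2_ip (boundary f) (boundary g).

Definition inner_proj theta : (disk R -> R[i]) -> (disk R -> R[i]) :=
  orthproj hardy_ip [set theta \* f | f in hardy].

Definition rank_hardy (T : (disk R -> R[i]) -> (disk R -> R[i])) : \bar R :=
  dim_mod [set 0] (T @` hardy).

(* The orthogonal complement of the Hardy space in L^2 of the circle. *)
Definition hardy_perp : set (R -> R[i]) :=
  [set u : R -> R[i] | L2 u /\ forall f, hardy f -> L2_ip u (boundary f) = 0].

Definition hankel (u : R -> R[i]) f : R -> R[i] :=
  orthproj L2_ip hardy_perp (u \* boundary f).

Definition rank_hankel (u : R -> R[i]) : \bar R :=
  dim_mod null_fun (hankel u @` hardy).

Definition inner_dvd (chi theta : disk R -> R[i]) : Prop :=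
  exists2 eta, inner eta & theta = chi \* eta.

(* [phi] is a greatest common inner divisor of [phi1] and [phi2]. *)
Definition inner_gcd (phi1 phi2 phi : disk R -> R[i]) : Prop :=
  [/\ inner phi, inner_dvd phi phi1, inner_dvd phi phi2
    & forall chi, inner chi -> inner_dvd chi phi1 -> inner_dvd chi phi2 ->
        inner_dvd chi phi].

Definition finite_blaschke theta : Prop :=
  exists (zeta : R[i]) (s : seq (disk R)), `|zeta| = 1 /\
    forall z, theta z =
      zeta * \prod_(a <- s) ((val z - val a) / (1 - conjc (val a) * val z)).

Definition zero_order f (a : disk R) (m : nat) : Prop :=
  exists g, [/\ analytic g, g a != 0
    & forall z, f z = (val z - val a) ^+ m * g z].

(* [f] has exactly [n] zeros in the disc, counted with multiplicity. *)
Definition zero_count f (n : nat) : Prop :=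
  exists2 s : seq (disk R), size s = n &
    forall a, zero_order f a (count_mem a s).

Definition degree theta : \bar R :=
  if `[< finite_blaschke theta >]
  then (xget 0%N [set n | zero_count theta n])%:R%:E else +oo%E.

End Hardy.

(* Main.v *)
(* For an inner function [psi] let [K_psi] be the orthogonal complement of [psi H^2] in
   [H^2] (the model space). Multiplication by [phi] is isometric and intertwines
   [[P_psi1, P_psi2]] with the compression of [[P_phi1, P_phi2]] to [phi H^2], off which
   the latter vanishes, so that both commutators have the same rank.

   By Beurling's theorem, a nonzero element of [K_psi1] and [K_psi2] would provide a
   nonconstant common inner divisor of [psi1] and [psi2]; hence these spaces meet
   trivially. By an argument in the style of Coburn's lemma, [K_psi1] meets [psi2 H^2]
   trivially or [K_psi2] meets [psi1 H^2] trivially. In the first case, each independent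
   family of [n] elements of [K_psi1] yields, by projecting it on [K_psi2] and on
   [psi2 H^2] and applying the commutator, [2 n] independent elements of its range, so
   that the rank is twice the dimension of [K_psi1]; moreover [K_psi1] embeds into
   [K_psi2]. The second case is symmetric.

   Multiplying an inner function by a Blaschke factor raises the dimension of its model
   space by 1. A nonzero finite-dimensional model space contains an eigenvector of the
   backward shift, that is a reproducing kernel, which exhibits a zero of the inner
   function; therefore [dim K_psi = deg psi]. Finally, the range of the Hankel operator
   of [psi^*] is [psi^* K_psi].

   The boundary values needed to set this up come from Fatou's theorem, for which the
   integrated Fourier series is differentiable almost everywhere, and Abel's theorem
   for its symmetric derivative. *)
Require Import Defs.
From HB Require Import structures.
From mathcomp Require Import all_boot all_order all_algebra.
From mathcomp Require Import all_classical all_reals all_analysis.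
From mathcomp Require Import complex measurable_realfun.
From mathcomp Require Import ring lra zify.
Set Implicit Arguments.
Unset Strict Implicit.
Unset Printing Implicit Defensive.
Import Order.TTheory GRing.Theory Num.Theory.
Import numFieldNormedType.Exports.
Local Open Scope classical_set_scope.
Local Open Scope ring_scope.
Local Open Scope complex_scope.

(** * Moduli and convergence in the complex numbers *)

(** Hardy functions are compared by equality on the disc, boundary values only almost everywhere,
    and the latter are not even known to be measurable at the outset. Fourier coefficients link both
    sides: they determine a Hardy function, and inner products are computed from them. Almost
    everywhere convergence of full Fourier series is avoided: a subsequence of the partial sums,
    dominated by an integrable function, is enough to integrate term by term. Coburn's and
    Beurling's arguments share one tool, the conjugation that sends [f] to [conj(z) psi conj(f)] on
    the circle and maps the model space of [psi] into [H^2]. It turns orthogonality relations into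
    vanishing Taylor coefficients of an analytic function. The factor 2 has two sources. Above,
    [[P1, P2] = P2 (1 - P1) - (1 - P1) P2], where each term has rank at most [dim K_psi1]. Below,
    the images of the two projections of a vector lie in the range of [P2] and in its orthogonal
    complement, so that no relation can mix them. *)

Local Notation Re := complex.Re.
Local Notation Im := complex.Im.

Section ComplexModulus.
Variable R : realType.
Implicit Types z w : R[i].

(** The norm of [R[i]] is itself [R[i]]-valued; estimates are made on its real part, where the order
    is total and the arithmetic tactics apply. *)
Definition cabs z : R := Re `|z|.

Lemma cabsE z : `|z| = (cabs z)%:C.
Proof. by rewrite /cabs normc_def. Qed.

Definition sqn z : R := Re z ^+ 2 + Im z ^+ 2.

Lemma sqn_ge0 z : 0 <= sqn z.
Proof. by rewrite addr_ge0// sqr_ge0. Qed.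

Lemma cabs_sqrt z : cabs z = Num.sqrt (sqn z).
Proof. by rewrite /cabs normc_def. Qed.

Lemma cabs_ge0 z : 0 <= cabs z.
Proof. by rewrite cabs_sqrt sqrtr_ge0. Qed.

Lemma cabs_sqr z : cabs z ^+ 2 = sqn z.
Proof. by rewrite cabs_sqrt sqr_sqrtr// sqn_ge0. Qed.

Lemma cabsM z w : cabs (z * w) = cabs z * cabs w.
Proof. by apply: complexI; rewrite rmorphM/= -!cabsE normrM. Qed.

Lemma cabs_real (x : R) : cabs x%:C = `|x|.
Proof. by rewrite cabs_sqrt /sqn/= expr0n addr0 sqrtr_sqr. Qed.

Lemma cabs0 : cabs 0 = 0. Proof. by rewrite /cabs normr0. Qed.

Lemma cabs1 : cabs 1 = 1. Proof. by rewrite /cabs normr1. Qed.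

Lemma cabsN z : cabs (- z) = cabs z. Proof. by rewrite /cabs normrN. Qed.

Lemma cabsJ z : cabs (conjc z) = cabs z. Proof. by rewrite /cabs normcJ. Qed.

Lemma cabsX z n : cabs (z ^+ n) = cabs z ^+ n.
Proof. by elim: n => [|n IH]; rewrite ?expr0 ?cabs1// !exprS cabsM IH. Qed.

Lemma cabsV z : cabs z^-1 = (cabs z)^-1.
Proof. by apply: complexI; rewrite -cabsE normfV cabsE fmorphV. Qed.

Lemma cabsD z w : cabs (z + w) <= cabs z + cabs w.
Proof. by rewrite -lecR rmorphD/= -!cabsE ler_normD. Qed.

Lemma cabsB z w : cabs (z - w) = cabs (w - z).
Proof. by rewrite /cabs distrC. Qed.

Lemma cabs_le z (M : R) : (cabs z <= M) = (`|z| <= M%:C).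
Proof. by rewrite cabsE lecR. Qed.

Lemma cabs_lt z (M : R) : (cabs z < M) = (`|z| < M%:C).
Proof. by rewrite cabsE ltcR. Qed.

Lemma cabs_eq0 z : (cabs z == 0) = (z == 0).
Proof. by rewrite -(inj_eq (@complexI R)) -cabsE normr_eq0. Qed.

Lemma norm_eq1 z : (`|z| = 1) <-> (sqn z = 1).
Proof.
rewrite cabsE -cabs_sqr; split=> [[->]|/eqP]; first by rewrite expr1n.
by rewrite sqrp_eq1 ?cabs_ge0// => /eqP ->.
Qed.

Lemma cabs_sum (I : Type) (s : seq I) (P : pred I) (f : I -> R[i]) :
  cabs (\sum_(i <- s | P i) f i) <= \sum_(i <- s | P i) cabs (f i).
Proof.
elim/big_ind2 : _ => // [|x a y b xa yb]; first by rewrite cabs0.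
by rewrite (le_trans (cabsD _ _))// lerD.
Qed.

Lemma sqn0 : sqn 0 = 0. Proof. by rewrite -cabs_sqr cabs0 expr0n. Qed.

Lemma sqnM z w : sqn (z * w) = sqn z * sqn w.
Proof. by rewrite -!cabs_sqr cabsM exprMn. Qed.

Lemma sqnJ z : sqn (conjc z) = sqn z.
Proof. by rewrite -!cabs_sqr cabsJ. Qed.

Lemma sqn_eq0 z : (sqn z == 0) = (z == 0).
Proof. by rewrite -cabs_sqr sqrf_eq0 cabs_eq0. Qed.

Lemma sqn_real (x : R) : sqn x%:C = x ^+ 2.
Proof. by rewrite /sqn/= expr0n addr0. Qed.

Lemma mulcJ z : z * conjc z = (sqn z)%:C.
Proof. by rewrite -sqr_normc cabsE -cabs_sqr rmorphXn. Qed.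

Lemma ReD z w : Re (z + w) = Re z + Re w. Proof. by case: z; case: w. Qed.
Lemma ImD z w : Im (z + w) = Im z + Im w. Proof. by case: z; case: w. Qed.
Lemma ReN z : Re (- z) = - Re z. Proof. by case: z. Qed.
Lemma ImN z : Im (- z) = - Im z. Proof. by case: z. Qed.
Lemma ReM z w : Re (z * w) = Re z * Re w - Im z * Im w.
Proof. by case: z; case: w. Qed.
Lemma ImM z w : Im (z * w) = Re z * Im w + Im z * Re w.
Proof. by case: z; case: w. Qed.
Lemma ReM_real z (x : R) : Re (z * x%:C) = Re z * x.
Proof. by case: z => a b /=; rewrite mulr0 subr0. Qed.
Lemma ImM_real z (x : R) : Im (z * x%:C) = Im z * x.
Proof. by case: z => a b /=; rewrite mulr0 add0r. Qed.
Lemma ReJ z : Re (conjc z) = Re z. Proof. by case: z. Qed.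
Lemma ImJ z : Im (conjc z) = - Im z. Proof. by case: z. Qed.
Lemma conjM z w : conjc (z * w) = conjc z * conjc w.
Proof. exact: rmorphM. Qed.
Lemma conjD z w : conjc (z + w) = conjc z + conjc w.
Proof. exact: rmorphD. Qed.
Lemma conjN z : conjc (- z) = - conjc z.
Proof. exact: rmorphN. Qed.
Lemma conj_real (x : R) : conjc x%:C = x%:C.
Proof. by rewrite /= oppr0. Qed.
Lemma complex_eqP z w : Re z = Re w -> Im z = Im w -> z = w.
Proof. by case: z; case: w => ? ? ? ? /= -> ->. Qed.

Lemma Re_sum (I : Type) (s : seq I) (P : pred I) (f : I -> R[i]) :
  Re (\sum_(i <- s | P i) f i) = \sum_(i <- s | P i) Re (f i).
Proof. by apply: (big_morph _ ReD). Qed.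

Lemma Im_sum (I : Type) (s : seq I) (P : pred I) (f : I -> R[i]) :
  Im (\sum_(i <- s | P i) f i) = \sum_(i <- s | P i) Im (f i).
Proof. by apply: (big_morph _ ImD). Qed.

Lemma Re_le_cabs z : `|Re z| <= cabs z.
Proof. by rewrite cabs_sqrt -sqrtr_sqr ler_wsqrtr// lerDl sqr_ge0. Qed.

Lemma Im_le_cabs z : `|Im z| <= cabs z.
Proof. by rewrite cabs_sqrt -sqrtr_sqr ler_wsqrtr// lerDr sqr_ge0. Qed.

Lemma cabs_le_ReIm z : cabs z <= `|Re z| + `|Im z|.
Proof.
rewrite -(@ler_pXn2r _ 2) ?nnegrE ?cabs_ge0 ?addr_ge0// cabs_sqr /sqn.
rewrite -(real_normK (num_real (Re z))) -(real_normK (num_real (Im z))).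
have := normr_ge0 (Re z); have := normr_ge0 (Im z); nra.
Qed.

(** By the parallelogram identity the two sides differ by [sqn (z - w)]. *)
Lemma sqnD_le z w : sqn (z + w) <= 2 * sqn z + 2 * sqn w.
Proof. rewrite /sqn ReD ImD.
have := sqr_ge0 (Re z - Re w); have := sqr_ge0 (Im z - Im w); lra. Qed.

End ComplexModulus.

Lemma eq_cvg_to {T : Type} {U : topologicalType} (F : set_system T)
  (f g : T -> U) (l : U) : f =1 g -> f @ F --> l -> g @ F --> l.
Proof. by move=> /funext ->. Qed.

Section ComplexTopology.
Context (R : realType) (T : Type) (F : set_system T) {FF : Filter F}.
Implicit Types (f g : T -> R[i]^o).

Lemma cvgC_cabs f (l : R[i]) :
  f @ F --> (l : R[i]^o) <-> cabs (f x - l) @[x --> F] --> (0 : R).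
Proof.
split.
  move=> /cvgrPdist_lt fl; apply/cvgrPdist_lt => e e0.
  have e0' : (0 : R[i]) < e%:C by rewrite ltcR.
  apply: filterS (fl _ e0') => x; rewrite -cabs_lt sub0r normrN.
  by rewrite ger0_norm ?cabs_ge0// cabsB.
move=> /cvgrPdist_lt fl; apply/cvgrPdist_lt => e e0.
have : 0 < Re e by move: e0; rewrite ltcE/= => /andP[].
have -> : e = (Re e)%:C by rewrite RRe_real// realE ltW.
move=> /fl; apply: filterS => x.
by rewrite -cabs_lt sub0r normrN ger0_norm ?cabs_ge0// cabsB.
Qed.

Lemma cvgC f (l : R[i]) : f @ F --> (l : R[i]^o) <->
  (Re (f x) @[x --> F] --> Re l) /\ (Im (f x) @[x --> F] --> Im l).
Proof.
rewrite cvgC_cabs; split.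
  move=> fl; split; apply/subr_cvg0/norm_cvg0P/(squeeze_cvgr _ (cvg_cst 0) fl).
    by apply: nearW => x; rewrite normr_ge0 /= -ReN -ReD Re_le_cabs.
  by apply: nearW => x; rewrite normr_ge0 /= -ImN -ImD Im_le_cabs.
move=> [fR fI].
have fR0 : `|Re (f x) - Re l| @[x --> F] --> (0 : R).
  exact/norm_cvg0P/subr_cvg0.
have fI0 : `|Im (f x) - Im l| @[x --> F] --> (0 : R).
  exact/norm_cvg0P/subr_cvg0.
have fRI : `|Re (f x) - Re l| + `|Im (f x) - Im l| @[x --> F] --> (0 : R).
  by have := cvgD fR0 fI0; rewrite addr0; apply.
apply: (squeeze_cvgr _ (cvg_cst 0) fRI).
apply: nearW => x; rewrite cabs_ge0/= (le_trans (cabs_le_ReIm _))//.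
by rewrite ReD ReN ImD ImN.
Qed.

(* Unifying sums and products in [R[i]^o] with the topological structures is
   very slow, hence this componentwise form of convergence. *)
Definition ccvg (f : T -> R[i]) (l : R[i]) : Prop :=
  (Re (f x) @[x --> F] --> Re l) /\ (Im (f x) @[x --> F] --> Im l).

Lemma ccvgP (f : T -> R[i]) (l : R[i]) :
  ccvg f l <-> (f x : R[i]^o) @[x --> F] --> (l : R[i]^o).
Proof. by rewrite (@cvgC f l). Qed.

End ComplexTopology.
Arguments ccvg {R T} F f l.

Section ComponentwiseConvergence.
Context (R : realType) (T : Type) (F : set_system T) {FF : Filter F}.
Implicit Types (f g : T -> R[i]) (a b k l : R[i]).

Lemma eq_ccvg f g l : f =1 g -> ccvg F f l -> ccvg F g l.
Proof. by move=> /funext ->. Qed.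

Lemma ccvg_cst l : ccvg F (fun=> l) l.
Proof. by split; exact: cvg_cst. Qed.

Lemma ccvgD f g a b : ccvg F f a -> ccvg F g b -> ccvg F (fun x => f x + g x) (a + b).
Proof.
move=> [ra ia] [rb ib]; split.
  by rewrite ReD; apply: eq_cvg_to (cvgD ra rb) => x; rewrite ReD.
by rewrite ImD; apply: eq_cvg_to (cvgD ia ib) => x; rewrite ImD.
Qed.

Lemma ccvgM f g a b : ccvg F f a -> ccvg F g b -> ccvg F (fun x => f x * g x) (a * b).
Proof.
move=> [ra ia] [rb ib]; split.
  rewrite ReM; apply: eq_cvg_to (cvgB (cvgM ra rb) (cvgM ia ib)) => x.
  by rewrite ReM.
rewrite ImM; apply: eq_cvg_to (cvgD (cvgM ra ib) (cvgM ia rb)) => x.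
by rewrite ImM.
Qed.

Lemma ccvgZ k f a : ccvg F f a -> ccvg F (fun x => k * f x) (k * a).
Proof. by move=> fa; apply: ccvgM => //; exact: ccvg_cst. Qed.

Lemma ccvgB f g a b : ccvg F f a -> ccvg F g b -> ccvg F (fun x => f x - g x) (a - b).
Proof.
move=> [ra ia] [rb ib]; split.
  by rewrite ReD ReN; apply: eq_cvg_to (cvgB ra rb) => x; rewrite ReD ReN.
by rewrite ImD ImN; apply: eq_cvg_to (cvgB ia ib) => x; rewrite ImD ImN.
Qed.

Lemma ccvg_sum (I : Type) (s : seq I) (P : pred I) (h : I -> T -> R[i]) (l : I -> R[i]) :
  (forall i, ccvg F (h i) (l i)) ->
  ccvg F (fun x => \sum_(i <- s | P i) h i x) (\sum_(i <- s | P i) l i).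
Proof.
move=> hl; elim: s => [|i s IH].
  rewrite big_nil; apply: eq_ccvg (ccvg_cst 0) => x; by rewrite big_nil.
rewrite big_cons; case: (boolP (P i)) => Pi.
  by apply: eq_ccvg (ccvgD (hl i) IH) => x; rewrite big_cons Pi.
by apply: eq_ccvg IH => x; rewrite big_cons (negbTE Pi).
Qed.

Lemma ccvg_real (f : T -> R) (x : R) : f @ F --> x -> ccvg F (fun t => (f t)%:C) x%:C.
Proof. by move=> fx; split => //=; exact: cvg_cst. Qed.

End ComponentwiseConvergence.
Arguments ccvgZ {R T F FF} k [f a] _.

Lemma cvg_subseq {T : topologicalType} (u : nat -> T) (g : nat -> nat) (l : T) :
  (forall k, (k <= g k)%N) -> u @ \oo --> l -> u (g k) @[k --> \oo] --> l.
Proof.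
move=> gk ul; apply: (cvg_comp g u _ ul) => A [N _ NA].
by exists N => // k Nk; apply: NA; exact: leq_trans Nk (gk k).
Qed.

Lemma nonneg_series_cvg (R : realType) (u : nat -> R) (M : R) :
  (forall n, 0 <= u n) -> (forall n, \sum_(0 <= k < n) u k <= M) ->
  cvgn (series u).
Proof.
move=> u0 uM; apply: nondecreasing_is_cvgn; last by exists M => _ [n _ <-]; exact: uM.
by apply/nondecreasing_seqP => n; rewrite /series/= big_nat_recr//= lerDl.
Qed.

Lemma nonneg_series_le (R : realType) (u : nat -> R) n :
  (forall n, 0 <= u n) -> cvgn (series u) ->
  \sum_(0 <= k < n) u k <= limn (series u).
Proof.
move=> u0 cu; apply: (nondecreasing_cvgn_le _ cu).
by apply/nondecreasing_seqP => k; rewrite /series/= big_nat_recr//= lerDl.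
Qed.

Lemma abs_series_cvg (R : realType) (u : nat -> R) (M : R) :
  (forall n, \sum_(0 <= k < n) `|u k| <= M) -> cvgn (series u).
Proof. by move=> uM; apply: normed_cvg; exact: nonneg_series_cvg uM. Qed.

(** * Integrals over segments and orthogonality of sines *)

Section RealIntegrals.
Variable R : realType.
Local Notation mu := (@lebesgue_measure R).
Implicit Types (f g F : R -> R) (a b : R).

Lemma integrable_addr (D : set R) f g : measurable D ->
  mu.-integrable D (EFin \o f) -> mu.-integrable D (EFin \o g) ->
  mu.-integrable D (EFin \o (fun x => f x + g x)).
Proof.
by move=> mD intf intg; have := @integrableD _ _ _ mu D mD _ _ intf intg; exact: eq_integrable.
Qed.

Lemma integrable_scale (D : set R) (k : R) f : measurable D ->
  mu.-integrable D (EFin \o f) -> mu.-integrable D (EFin \o (fun x => k * f x)).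
Proof.
by move=> mD intf; have := @integrableZl _ _ _ mu D mD k _ intf; exact: eq_integrable.
Qed.

Lemma Rdominated_cvg (D : set R) (u : nat -> R -> R) f g : measurable D ->
  (forall n, measurable_fun D (u n)) ->
  (forall x, D x -> u n x @[n --> \oo] --> f x) ->
  mu.-integrable D (EFin \o g) ->
  (forall n x, D x -> `|u n x| <= g x) ->
  mu.-integrable D (EFin \o f) /\
  Rintegral mu D (u n) @[n --> \oo] --> Rintegral mu D f.
Proof.
move=> mD mu_ uf ig ug.
have mf : measurable_fun D f by apply: measurable_fun_cvg uf => n; exact: mu_.
have [] := @dominated_convergence _ _ _ mu D mD (fun n => EFin \o u n)
  (EFin \o f) (EFin \o g).
- by move=> n; apply/measurable_EFinP; exact: mu_.
- exact/measurable_EFinP.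
- by apply: aeW => x Dx; apply: cvg_EFin; [exact: nearW|exact: uf].
- exact: ig.
- by apply: aeW => x n Dx /=; rewrite lee_fin ug.
move=> intf _ cvgf; split => //.
apply: fine_cvg; rewrite fineK; last exact: integrable_fin_num.
exact: cvgf.
Qed.

Lemma continuous_integrable f a b : continuous f ->
  mu.-integrable `[a, b] (EFin \o f).
Proof.
move=> cf; apply: continuous_compact_integrable; first exact: segment_compact.
exact: continuous_subspaceT.
Qed.

Lemma Rintegral_derive f F a b : a < b -> continuous f ->
  (forall x : R, is_derive x 1 F (f x)) -> Rintegral mu `[a, b] f = F b - F a.
Proof.
move=> ab cf dF; rewrite /Rintegral (@continuous_FTC2 _ f F)//.
- exact: continuous_subspaceT.
- have cF : continuous F.
    move=> x; apply/differentiable_continuous/derivable1_diffP.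
    by have [] := dF x.
  split; [by move=> x _; have [] := dF x|..].
  + exact/cvg_at_right_filter/cF.
  + exact/cvg_at_left_filter/cF.
- by move=> x _; rewrite derive1E; apply: derive_val.
Qed.

Lemma Rintegral_sum (I : Type) (s : seq I) (P : pred I) (h : I -> R -> R) a b :
  (forall i, mu.-integrable `[a, b] (EFin \o h i)) ->
  Rintegral mu `[a, b] (fun x => \sum_(i <- s | P i) h i x) =
  \sum_(i <- s | P i) Rintegral mu `[a, b] (h i).
Proof.
move=> ih; elim: s => [|i s IH].
  rewrite big_nil; under eq_Rintegral do rewrite big_nil.
  by rewrite Rintegral_cst// mul0r.
rewrite big_cons; under eq_Rintegral do rewrite big_cons.
case: ifPn => // Pi; rewrite RintegralD ?IH//.
have := @integrable_sum _ _ _ mu `[a, b] (measurable_itv _) _ s P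
  (fun i => EFin \o h i) (fun i _ => ih i).
by apply: eq_integrable => // x _; rewrite /= sumEFin.
Qed.

Lemma le_normr_Rintegral_itv f g a b : mu.-integrable `[a, b] (EFin \o f) ->
  mu.-integrable `[a, b] (EFin \o g) ->
  (forall x, a <= x <= b -> `|f x| <= g x) ->
  `|Rintegral mu `[a, b] f| <= Rintegral mu `[a, b] g.
Proof.
move=> intf intg fg; rewrite (le_trans (le_normr_Rintegral _ intf))//.
apply: le_Rintegral => //; first exact: integrable_norm.
Qed.

Lemma Rintegral_cst_itv (r a b : R) : a <= b ->
  Rintegral mu `[a, b] (fun=> r) = r * (b - a).
Proof.
move=> ab; rewrite Rintegral_cst//= lebesgue_measure_itv/= lte_fin.
by case: ltgtP ab => // -> _; rewrite subrr mulr0.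
Qed.

Lemma is_derive_sinZ (c x : R) :
  is_derive x 1 (fun x => sin (c * x)) (c * cos (c * x)).
Proof.
have -> : c * cos (c * x) = cos (c * x) * (c * 1) by rewrite mulr1 mulrC.
exact: (is_derive1_comp (is_derive_sin _)).
Qed.

Lemma is_derive_cosZ (c x : R) :
  is_derive x 1 (fun x => cos (c * x)) (- (c * sin (c * x))).
Proof.
have -> : - (c * sin (c * x)) = - sin (c * x) * (c * 1) by lra.
exact: (is_derive1_comp (is_derive_cos _)).
Qed.

Lemma continuous_sinZ c : continuous (fun x : R => sin (c * x)).
Proof.
move=> x; apply: (@continuous_comp _ _ _ ( *%R c) sin).
  exact: mulrl_continuous.
exact: continuous_sin.
Qed.

Lemma continuous_cosZ c : continuous (fun x : R => cos (c * x)).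
Proof.
move=> x; apply: (@continuous_comp _ _ _ ( *%R c) cos).
  exact: mulrl_continuous.
exact: continuous_cos.
Qed.

Lemma Rintegral_cosZ c a b : a < b -> c != 0 ->
  Rintegral mu `[a, b] (fun x => cos (c * x)) = (sin (c * b) - sin (c * a)) / c.
Proof.
move=> ab c0.
have dF (x : R) : is_derive x 1 (fun x => c^-1 * sin (c * x)) (cos (c * x)).
  have -> : cos (c * x) = c^-1 * (c * cos (c * x)) by rewrite mulKf.
  apply: is_deriveZ; exact: is_derive_sinZ.
rewrite (Rintegral_derive ab _ dF); last exact: continuous_cosZ.
by rewrite -mulrBr mulrC.
Qed.

Lemma Rintegral_sinZ c a b : a < b -> c != 0 ->
  Rintegral mu `[a, b] (fun x => sin (c * x)) = (cos (c * a) - cos (c * b)) / c.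
Proof.
move=> ab c0.
have dF (x : R) : is_derive x 1 (fun x => - c^-1 * cos (c * x)) (sin (c * x)).
  have -> : sin (c * x) = - c^-1 * (- (c * sin (c * x))).
    by rewrite mulrNN mulKf.
  apply: is_deriveZ; exact: is_derive_cosZ.
rewrite (Rintegral_derive ab _ dF); last exact: continuous_sinZ.
by rewrite -mulrBr mulrC mulrN -mulNr opprB.
Qed.

Lemma sin_natpi n : sin (n%:R * pi) = 0 :> R.
Proof.
elim: n => [|n IH]; first by rewrite mul0r sin0.
by rewrite -natr1 mulrDl mul1r sinDpi IH oppr0.
Qed.

(* product to sum, [sin x sin y = (cos (x - y) - cos (x + y)) / 2] *)
Lemma Rintegral_sin_sin (m n : nat) :
  Rintegral mu `[0, pi] (fun s => sin (m%:R * s) * sin (n%:R * s)) =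
  if (m == n) && (0 < n)%N then pi / 2 else 0.
Proof.
have cint (k : nat) : Rintegral mu `[0, pi] (fun s => cos (k%:R * s)) =
    if k == 0%N then pi else 0.
  case: eqVneq => [->|k0].
    under eq_Rintegral do rewrite mul0r cos0.
    by rewrite Rintegral_cst_itv ?pi_ge0// subr0 mul1r.
  by rewrite Rintegral_cosZ ?pi_gt0 ?pnatr_eq0// sin_natpi mulr0 sin0 subrr mul0r.
(* The symmetric roles of [m] and [n] allow the frequency [m - n] to be a natural number, so that
   [cint] covers both cosines. *)
wlog mn : m n / (n <= m)%N.
  move=> H; case: (leqP n m) => [/H //|/ltnW/H].
  rewrite eq_sym; under eq_Rintegral do rewrite mulrC.
  by move=> ->; case: eqVneq => // ->.
transitivity (2^-1 * (Rintegral mu `[0, pi] (fun s => cos ((m - n)%N%:R * s))) -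
   2^-1 * (Rintegral mu `[0, pi] (fun s => cos ((m + n)%N%:R * s)))).
  rewrite -!RintegralZl//; try exact/continuous_integrable/continuous_cosZ.
  rewrite -RintegralB//.
  - apply: eq_Rintegral => s _; rewrite natrB// natrD !mulrDl mulNr cosD cosD.
    by rewrite cosN sinN; lra.
  - by apply: continuous_integrable => x; apply: cvgM;
     [exact: cvg_cst|exact: continuous_cosZ].
  - by apply: continuous_integrable => x; apply: cvgM;
     [exact: cvg_cst|exact: continuous_cosZ].
rewrite !cint subn_eq0 addn_eq0.
case: (ltngtP n m) mn => // [nm _|-> _]; first by rewrite (gtn_eqF (leq_ltn_trans (leq0n _) nm)) subrr.
by case: m => [|m] /=; rewrite ?subrr// mulr0 subr0 mulrC.
Qed.

End RealIntegrals.

(** * Abel summation of sine series *)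

Section Cis.
Variable R : realType.
Implicit Types (s t r : R).

Definition cis t : R[i] := cos t +i* sin t.

Lemma cisD s t : cis (s + t) = cis s * cis t.
Proof. by apply: complex_eqP; rewrite /cis/= ?cosD ?sinD// mulrC addrC. Qed.

Lemma cis0 : cis 0 = 1.
Proof. by rewrite /cis cos0 sin0. Qed.

Lemma cisX t n : cis t ^+ n = cis (n%:R * t).
Proof.
elim: n => [|n IH]; first by rewrite expr0 mul0r cis0.
by rewrite exprS IH -cisD -{1}(mul1r t) -mulrDl nat1r.
Qed.

Lemma sqn_cis t : sqn (cis t) = 1.
Proof. by rewrite /sqn/= cos2Dsin2. Qed.

Lemma cabs_cis t : cabs (cis t) = 1.
Proof. by rewrite cabs_sqrt sqn_cis sqrtr1. Qed.

Lemma cis_conj t : conjc (cis t) = cis (- t).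
Proof. by rewrite /cis cosN sinN. Qed.

Lemma cis_mulJ t : cis t * conjc (cis t) = 1.
Proof. by rewrite mulcJ sqn_cis. Qed.

End Cis.

Section GeometricDerivative.
Variable R : realType.
Implicit Types r s : R.

(** Keeping [(1 - z) ^+ 2] as a factor makes the formula valid in any commutative ring; it serves
    for a bound over the reals and for a limit over the complex numbers. *)
Lemma sum_nat_exp (K : comPzRingType) (z : K) n :
  (1 - z) ^+ 2 * (\sum_(0 <= k < n.+1) k%:R * z ^+ k) =
  z - n.+1%:R * z ^+ n.+1 + n%:R * z ^+ n.+2.
Proof.
elim: n => [|n IH].
  by rewrite big_nat1 !mul0r mulr0 mul1r expr1 subrr addr0.
rewrite big_nat_recr//= mulrDr IH -!natr1 !exprS; ring.
Qed.

Lemma sum_nat_exp_le (r : R) n : 0 <= r < 1 ->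
  \sum_(0 <= k < n) k%:R * r ^+ k <= r / (1 - r) ^+ 2.
Proof.
move=> /andP[r0 r1]; have r1' : 0 < (1 - r) ^+ 2 by rewrite exprn_gt0 ?subr_gt0.
rewrite ler_pdivlMr//; case: n => [|n]; first by rewrite big_geq// mul0r.
rewrite mulrC sum_nat_exp [r ^+ n.+2]exprS -natr1.
have rn : 0 <= r ^+ n.+1 by rewrite exprn_ge0.
have n0 : (0 : R) <= n%:R by [].
have := ler_wpM2r (mulr_ge0 n0 rn) (ltW r1).
lra.
Qed.

Lemma nat_exp_cvg0 (r : R) : 0 <= r < 1 -> n%:R * r ^+ n @[n --> \oo] --> (0 : R).
Proof.
move=> r01; have : cvgn (series (fun k => k%:R * r ^+ k)).
  apply: nondecreasing_is_cvgn.
    apply: nondecreasing_series => k _ _.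
    by rewrite mulr_ge0// exprn_ge0//; case/andP: r01.
  exists (r / (1 - r) ^+ 2) => _ [n _ <-]; rewrite /series/=.
  exact: sum_nat_exp_le.
exact: cvg_series_cvg_0.
Qed.

Lemma sum_nat_exp_cvg (z : R[i]) : cabs z < 1 ->
  (\sum_(0 <= k < n) k%:R * z ^+ k : R[i]^o) @[n --> \oo] -->
  (z / (1 - z) ^+ 2 : R[i]^o).
Proof.
move=> z1; set r := cabs z in z1.
have r01 : 0 <= r < 1 by rewrite cabs_ge0.
have z1' : 1 - z != 0.
  by apply: contraTN z1; rewrite subr_eq0 /r => /eqP <-; rewrite -leNgt cabs1.
rewrite -(cvg_shiftS (fun n => \sum_(0 <= k < n) k%:R * z ^+ k : R[i]^o)).
apply/cvgC_cabs => /=.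
have e n : \sum_(0 <= k < n.+1) k%:R * z ^+ k - z / (1 - z) ^+ 2 =
    (n%:R * z ^+ n.+2 - n.+1%:R * z ^+ n.+1) / (1 - z) ^+ 2.
  apply: (mulfI (expf_neq0 2 z1')); rewrite mulrBr sum_nat_exp.
  by rewrite !mulrA ![_ ^+ 2 * _]mulrC !mulfK ?expf_neq0//; ring.
have b1 : n%:R * r ^+ n * r ^+ 2 + n.+1%:R * r ^+ n.+1 @[n --> \oo] --> (0 : R).
  rewrite -(addr0 0) -{1}(mul0r (r ^+ 2)); apply: cvgD.
    by apply: cvgM; [exact: nat_exp_cvg0|exact: cvg_cst].
  by rewrite (cvg_shiftS (fun n => n%:R * r ^+ n)); exact: nat_exp_cvg0.
have b2 : (n%:R * r ^+ n * r ^+ 2 + n.+1%:R * r ^+ n.+1) / cabs (1 - z) ^+ 2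
   @[n --> \oo] --> (0 : R).
  by rewrite -(mul0r (cabs (1 - z) ^+ 2)^-1); apply: cvgM b1 _; exact: cvg_cst.
apply: (squeeze_cvgr _ (cvg_cst 0) b2); apply: nearW => n; rewrite cabs_ge0/= e.
rewrite cabsM cabsV cabsX ler_wpM2r ?invr_ge0 ?exprn_ge0 ?cabs_ge0//.
rewrite (le_trans (cabsD _ _))// cabsN !cabsM !cabsX.
have cn k : cabs (k%:R : R[i]) = k%:R.
  by rewrite -(rmorph_nat (real_complex R)) cabs_real ger0_norm.
by rewrite !cn -mulrA -exprD addn2.
Qed.

(* [Q r s = sum_n n r^n sin (n s) = - P_r'(s) / 2] with [P_r] the Poisson
   kernel, see [sin_kernel_cvg]. *)
Definition sin_kernel (r s : R) : R := Im (r%:C * cis s / (1 - r%:C * cis s) ^+ 2).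

Lemma sin_kernelE r s : 0 <= r < 1 -> sin_kernel r s =
  r * (1 - r ^+ 2) * sin s / (sqn (1 - r%:C * cis s)) ^+ 2.
Proof.
move=> /andP[r0 r1]; rewrite /sin_kernel; set z := r%:C * cis s.
have z1' : 1 - z != 0.
  apply: contraTN r1; rewrite subr_eq0 => /eqP /(congr1 (@cabs R)).
  by rewrite cabs1 /z cabsM cabs_cis mulr1 cabs_real ger0_norm// => <-; rewrite ltxx.
have sn0 : sqn (1 - z) != 0 by rewrite sqn_eq0.
have -> : z / (1 - z) ^+ 2 = z * conjc (1 - z) ^+ 2 * ((sqn (1 - z))^-1 ^+ 2)%:C.
  move: (1 - z) z1' => w w0; rewrite exprVn fmorphV rmorphXn/= -mulcJ.
  by field; rewrite conjc_eq0 w0.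
rewrite ImM/= mulr0 add0r exprVn; congr (_ / _).
have := cos2Dsin2 s; move: (cos s) (sin s) => c d cd.
(* With [1] written as [c ^+ 2 + d ^+ 2], what remains is a polynomial identity in [r], [c], [d]. *)
have -> : r * (1 - r ^+ 2) * d = r * (1 - r ^+ 2 * (c ^+ 2 + d ^+ 2)) * d.
  by rewrite cd mulr1.
ring.
Qed.

Lemma sin_kernel_cvg r s : 0 <= r < 1 ->
  (\sum_(0 <= k < n) k%:R * r ^+ k * sin (k%:R * s)) @[n --> \oo] -->
  sin_kernel r s.
Proof.
move=> /andP[r0 r1].
have : cabs (r%:C * cis s) < 1.
  by rewrite cabsM cabs_cis mulr1 cabs_real ger0_norm.
move=> /sum_nat_exp_cvg /cvgC[_]; apply: cvg_trans; apply: near_eq_cvg.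
apply: nearW => n; rewrite Im_sum; apply: eq_bigr => k _.
rewrite exprMn cisX -rmorphXn/= mulrA -(rmorph_nat (real_complex R)) -rmorphM/=.
by rewrite /= mul0r addr0.
Qed.

Lemma sqn_1Bcis r s : sqn (1 - r%:C * cis s) = 1 - 2 * r * cos s + r ^+ 2.
Proof.
rewrite /sqn !ReD !ImD !ReN !ImN ReM ImM/=.
transitivity (1 - 2 * r * cos s + r ^+ 2 * (cos s ^+ 2 + sin s ^+ 2)); first ring.
by rewrite cos2Dsin2 mulr1.
Qed.

Lemma sin_kernel_ge0 r s : 0 <= r < 1 -> 0 <= s <= pi -> 0 <= sin_kernel r s.
Proof.
move=> r01 s0; rewrite sin_kernelE//; case/andP: r01 => r0 r1.
rewrite divr_ge0 ?exprn_ge0 ?sqn_ge0// mulr_ge0 ?sin_ge0_pi//.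
by rewrite mulr_ge0// subr_ge0 expr_le1// ltW.
Qed.

(** Cosine decreases on [[0, pi]], so the denominator of the kernel is least at [eta]. The bound
    does not depend on [s] and tends to 0 as [r] tends to 1. *)
Lemma sin_kernel_le r s eta : 0 <= r < 1 -> 0 < eta -> eta <= s <= pi ->
  sin_kernel r s <= (1 - r ^+ 2) / (1 - 2 * r * cos eta + r ^+ 2) ^+ 2.
Proof.
move=> r01 e0 /andP[es sp]; rewrite sin_kernelE//; case/andP: r01 => r0 r1.
have r2 : 0 <= 1 - r ^+ 2 by rewrite subr_ge0 expr_le1// ltW.
have ces : cos s <= cos eta.
  by rewrite leNgt ltr_cos ?in_itv/= ?(ltW e0) ?(le_trans es sp) ?sp
     ?(le_trans (ltW e0) es)// -leNgt.
have c1 : cos eta < 1.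
  rewrite -cos0 ltr_cos// in_itv/= ?lexx ?pi_ge0// (ltW e0)/=.
  exact: le_trans es sp.
have d0 : 0 < 1 - 2 * r * cos eta + r ^+ 2.
  have : 0 <= r * (1 - cos eta) by rewrite mulr_ge0// subr_ge0 ltW.
  have : 0 < (1 - r) ^+ 2 by rewrite exprn_gt0// subr_gt0.
  nra.
have d1 : 1 - 2 * r * cos eta + r ^+ 2 <= sqn (1 - r%:C * cis s).
  by rewrite sqn_1Bcis; have := ler_wpM2l r0 ces; lra.
have s0 := lt_le_trans e0 es.
have sin0 : 0 <= sin s by rewrite sin_ge0_pi// (ltW s0).
apply: ler_pM => //.
- by rewrite !mulr_ge0.
- by rewrite invr_ge0 exprn_ge0// sqn_ge0.
- have : r * sin s <= 1 by rewrite mulr_ile1// ?sin_le1// ltW.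
  nra.
- rewrite lef_pV2 ?posrE ?exprn_gt0 ?(lt_le_trans d0 d1)//.
  by rewrite ler_pXn2r ?nnegrE ?sqn_ge0// ltW.
Qed.

End GeometricDerivative.

Section AbelSineSeries.
Variable R : realType.
Local Notation mu := (@lebesgue_measure R).

Lemma continuous_sum_fun (I : Type) (s : seq I) (P : pred I) (h : I -> R -> R) :
  (forall i, continuous (h i)) -> continuous (fun x => \sum_(i <- s | P i) h i x).
Proof.
move=> ch x; elim: s => [|i s IH].
  by under eq_fun do rewrite big_nil; exact: cvg_cst.
under eq_fun do rewrite big_cons.
by case: ifP => // _; apply: cvgD => //; exact: ch.
Qed.

Lemma continuousM_fun (f g : R -> R) :
  continuous f -> continuous g -> continuous (fun x => f x * g x).
Proof. by move=> cf cg x; apply: cvgM; [exact: cf|exact: cg]. Qed.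

Lemma continuous_cst_fun (c : R) : continuous (fun _ : R => c).
Proof. by move=> x; exact: cvg_cst. Qed.

Section Representation.
Variables (al : nat -> R) (A : R) (D V : R -> R).
Hypothesis al0 : al 0%N = 0.
Hypothesis al_le : forall N, \sum_(0 <= n < N) `|al n| / n%:R <= A.
Hypothesis D_cvg : forall s,
  (\sum_(0 <= n < N) al n / n%:R * sin (n%:R * s)) @[N --> \oo] --> D s.
Hypothesis V_cvg : forall r, 0 <= r < 1 ->
  (\sum_(0 <= n < N) al n * r ^+ n) @[N --> \oo] --> V r.

Lemma sine_partial_le N s : `|\sum_(0 <= n < N) al n / n%:R * sin (n%:R * s)| <= A.
Proof.
apply: le_trans (al_le N); apply: le_trans (ler_norm_sum _ _ _) _.
apply: ler_sum => k _; rewrite !normrM normfV [`|k%:R|]ger0_norm//.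
by rewrite ler_piMr ?sin_max// divr_ge0.
Qed.

Lemma sine_sum_le s : `|D s| <= A.
Proof.
have H : `|\sum_(0 <= n < N) al n / n%:R * sin (n%:R * s)| @[N --> \oo] --> `|D s|.
  by apply: cvg_norm; exact: D_cvg.
apply: (cvgr_to_le H).
by apply: nearW => N; exact: sine_partial_le.
Qed.

(** Multiply the partial sums of the two sine series: by orthogonality only the diagonal survives in
    the integral, where the factors [n] and [1 / n] cancel. Dominated convergence applies since the
    partial sums are bounded by [A] and by [r / (1 - r) ^+ 2]. *)
Lemma sin_kernel_repr r : 0 <= r < 1 ->
  mu.-integrable `[0, pi] (EFin \o (fun s => D s * sin_kernel r s)) /\
  Rintegral mu `[0, pi] (fun s => D s * sin_kernel r s) = pi / 2 * V r.
Proof.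
move=> r01.
pose a k : R := al k / k%:R; pose b k : R := k%:R * r ^+ k.
pose S c N s : R := \sum_(0 <= k < N) c k * sin (k%:R * s).
have cS c N : continuous (S c N).
  apply: continuous_sum_fun => k; apply: continuousM_fun.
    exact: continuous_cst_fun.
  exact: continuous_sinZ.
have cSS N : continuous (fun s => S a N s * S b N s) by exact: continuousM_fun.
have intSS N : Rintegral mu `[0, pi] (fun s => S a N s * S b N s) =
    pi / 2 * \sum_(0 <= n < N) al n * r ^+ n.
  transitivity (Rintegral mu `[0, pi] (fun s => \sum_(0 <= j < N)
     \sum_(0 <= k < N) (a j * b k) * (sin (j%:R * s) * sin (k%:R * s)))).
    apply: eq_Rintegral => s _; rewrite /S big_distrlr/=.
    by apply: eq_bigr => j _; apply: eq_bigr => k _; rewrite mulrACA.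
  have css j k : continuous (fun s : R => sin (j%:R * s) * sin (k%:R * s)).
    by apply: continuousM_fun; exact: continuous_sinZ.
  have ccss j k c : continuous (fun s : R => c * (sin (j%:R * s) * sin (k%:R * s))).
    by apply: continuousM_fun => //; exact: continuous_cst_fun.
  rewrite Rintegral_sum; last first.
    by move=> j; apply: continuous_integrable; exact: continuous_sum_fun.
  rewrite mulr_sumr; apply: eq_big_nat => j jN.
  rewrite Rintegral_sum; last by move=> k; exact: continuous_integrable.
  under eq_bigr do rewrite RintegralZl ?continuous_integrable//
    Rintegral_sin_sin.
  rewrite (bigD1_seq j)/= ?mem_index_iota ?iota_uniq// eqxx/= big1 => [|k]; last first.
    by rewrite eq_sym => /negbTE ->; rewrite mulr0.
  rewrite addr0 /a /b; case: j {jN} => [|j]/=.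
    by rewrite al0 !mul0r mulr0.
  by rewrite mulrC -mulrA mulKf ?pnatr_eq0.
have [] := @Rdominated_cvg R `[0, pi] (fun N s => S a N s * S b N s)
  (fun s => D s * sin_kernel r s) (fun=> A * (r / (1 - r) ^+ 2)) (measurable_itv _).
- by move=> N; apply: measurable_funTS; exact: continuous_measurable_fun.
- by move=> s _; apply: cvgM; [exact: D_cvg|exact: sin_kernel_cvg].
- by apply: continuous_integrable; exact: continuous_cst_fun.
- move=> N s _; rewrite normrM ler_pM//; first exact: sine_partial_le.
  apply: le_trans (sum_nat_exp_le N r01).
  apply: le_trans (ler_norm_sum _ _ _) _; apply: ler_sum => k _.
  have kr : 0 <= k%:R * r ^+ k by rewrite mulr_ge0// exprn_ge0//; case/andP: r01.
  by rewrite normrM (ger0_norm kr) ler_piMr ?sin_max.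
move=> intDQ cvgDQ; split=> //.
apply: (cvg_unique _ (eq_cvg_to intSS cvgDQ)) => //.
by apply: cvgM; [exact: cvg_cst|exact: V_cvg].
Qed.

End Representation.

(** The representation for the single harmonic [al 1 = 1], for which [D] is the sine and [V r = r].
    It is the comparison integral for functions [D] that are small with respect to [sin] near 0. *)
Lemma Rintegral_sin_kernel r : 0 <= r < 1 ->
  mu.-integrable `[0, pi] (EFin \o (fun s => sin s * sin_kernel r s)) /\
  Rintegral mu `[0, pi] (fun s => sin s * sin_kernel r s) = pi / 2 * r.
Proof.
move=> r01; pose al n : R := (n == 1%N)%:R.
have sum1 (c : nat -> R) N : \sum_(0 <= n < N.+2) al n * c n = c 1%N.
  rewrite big_nat_recl// big_nat_recl// /al/= mul0r mul1r big1 ?addr0 ?add0r// => i _.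
  by rewrite mul0r.
have cvg1 (c : nat -> R) : \sum_(0 <= n < N) al n * c n @[N --> \oo] --> c 1%N.
  rewrite -(cvg_shiftn 2); under eq_fun do rewrite addn2 sum1.
  exact: cvg_cst.
have V_cvg (r' : R) : 0 <= r' < 1 ->
    \sum_(0 <= n < N) al n * r' ^+ n @[N --> \oo] --> r'.
  by move=> _; have := cvg1 (fun n => r' ^+ n); rewrite expr1.
apply: (@sin_kernel_repr al 1 (fun s => sin s) (fun r => r)) => //.
- move=> N; rewrite (eq_bigr (fun n => al n * n%:R^-1)); last first.
    by move=> n _; rewrite ger0_norm// ler0n.
  case: N => [|[|N]]; rewrite ?sum1 ?invr1//; first by rewrite big_geq// ler01.
  by rewrite big_nat1 /al/= mul0r ler01.
- move=> s; have := cvg1 (fun n => n%:R^-1 * sin (n%:R * s)).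
  rewrite invr1 !mul1r; apply: eq_cvg_to => N.
  by apply: eq_bigr => n _; rewrite mulrA.
Qed.

(* [V r] is the integral of [D] against a nonnegative kernel that concentrates at [0]
   as [r] tends to 1, so that it inherits the behaviour of [D] at [0]. *)
Lemma abel_sine0 (al : nat -> R) (A : R) (D V : R -> R) :
  al 0%N = 0 ->
  (forall N, \sum_(0 <= n < N) `|al n| / n%:R <= A) ->
  (forall s,
    (\sum_(0 <= n < N) al n / n%:R * sin (n%:R * s)) @[N --> \oo] --> D s) ->
  (forall r, 0 <= r < 1 ->
    (\sum_(0 <= n < N) al n * r ^+ n) @[N --> \oo] --> V r) ->
  D s / sin s @[s --> 0^'+] --> (0 : R) -> V r @[r --> 1^'-] --> (0 : R).
Proof.
move=> al0 al_le D_cvg V_cvg D0; apply/cvgr0Pnorm_le => e e0.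
have e2 : 0 < e / 2 by rewrite divr_gt0.
have A0 : 0 <= A by have := al_le 0%N; rewrite big_geq.
have [eta /andP[eta0 etapi] Deta] :
    exists2 eta, 0 < eta < pi & forall s, 0 < s < eta -> `|D s| <= e / 2 * sin s.
  move/cvgr0Pnorm_le: D0 => /(_ _ e2) [d /= d0 Hd].
  exists (Num.min d pi / 2) => [|s /andP[s0 sd]].
    have : 0 < Num.min d pi by rewrite lt_min d0 pi_gt0.
    have : Num.min d pi <= pi by rewrite ge_min lexx orbT.
    by have := pi_gt0 R; lra.
  have : s < Num.min d pi.
    have : 0 < Num.min d pi by rewrite lt_min d0 pi_gt0.
    by move: sd; lra.
  rewrite lt_min => /andP[sd' spi].
  have sins : 0 < sin s by rewrite sin_gt0_pi// s0.
  have := Hd s; rewrite /= sub0r normrN gtr0_norm// => /(_ sd' s0).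
  by rewrite normrM normfV (gtr0_norm sins) ler_pdivrMr.
pose B r : R := (1 - r ^+ 2) / (1 - 2 * r * cos eta + r ^+ 2) ^+ 2.
have B0 r : 0 <= r < 1 -> 0 <= B r.
  move=> /andP[r0 r1]; rewrite divr_ge0 ?sqr_ge0// subr_ge0 expr_le1//.
  exact: ltW.
(* The bound of the integrand below [eta] and the one above it are added over all of [[0, pi]],
   which spares a splitting of the integral; the factor 2 is [pi / (pi / 2)]. *)
have V_le r : 0 <= r < 1 -> `|V r| <= e / 2 + 2 * A * B r.
  move=> r01; have [intD repr] := sin_kernel_repr al0 al_le D_cvg V_cvg r01.
  have [intS reprS] := Rintegral_sin_kernel r01.
  have := @le_normr_Rintegral_itv R (fun s => D s * sin_kernel r s)
    (fun s => e / 2 * (sin s * sin_kernel r s) + A * B r) 0 pi intD.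
  have intS' : mu.-integrable `[0, pi]
      (EFin \o (fun s => e / 2 * (sin s * sin_kernel r s))).
    exact: integrable_scale.
  have intc : mu.-integrable `[0, pi] (EFin \o (fun=> A * B r)).
    by apply: continuous_integrable; exact: continuous_cst_fun.
  have intR : mu.-integrable `[0, pi]
      (EFin \o (fun s => e / 2 * (sin s * sin_kernel r s) + A * B r)).
    exact: integrable_addr.
  rewrite repr RintegralD//.
  have -> : Rintegral mu `[0, pi] (fun s => e / 2 * (sin s * sin_kernel r s)) =
      e / 2 * (pi / 2 * r) by rewrite RintegralZl// reprS.
  move=> /(_ intR).
  rewrite Rintegral_cst_itv ?pi_ge0// => H.
  have {H} : `|pi / 2 * V r| <= e / 2 * (pi / 2 * r) + A * B r * (pi - 0).
    apply: H => s /andP[s0 spi]; rewrite normrM.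
    have Q0 : 0 <= sin_kernel r s by rewrite sin_kernel_ge0// s0.
    rewrite (ger0_norm Q0).
    have sins : 0 <= sin s by rewrite sin_ge0_pi// s0.
    have AB : 0 <= A * B r by apply: mulr_ge0 => //; exact: B0.
    have esQ : 0 <= e / 2 * (sin s * sin_kernel r s).
      by rewrite mulr_ge0 ?(ltW e2)// mulr_ge0.
    have [->|s1] := eqVneq s 0.
      rewrite /sin_kernel sin0 mul0r mulr0 add0r.
      have -> : Im (r%:C * cis 0 / (1 - r%:C * cis 0) ^+ 2) = 0 :> R.
        rewrite -[LHS]/(sin_kernel r 0) sin_kernelE// sin0; ring.
      by rewrite mulr0.
    have {s1}s0 : 0 < s by rewrite lt_neqAle eq_sym s1.
    case: (ltP s eta) => [seta|etas].
      rewrite -[leLHS]addr0 lerD//.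
      by rewrite mulrA ler_wpM2r// Deta// s0.
    rewrite -[leLHS]add0r lerD//.
    rewrite ler_pM//; first exact: sine_sum_le D_cvg _.
    by rewrite sin_kernel_le// etas.
  have pi0 := pi_gt0 R.
  rewrite normrM gtr0_norm ?divr_gt0// subr0.
  have r1 : e / 2 * (pi / 2 * r) <= e / 2 * (pi / 2).
    rewrite ler_wpM2l ?(ltW e2)// ler_piMr ?divr_ge0 ?ltW//.
    by case/andP: r01.
  move=> /le_trans /(_ (lerD r1 (lexx _))) H.
  by rewrite -(ler_pM2l pi0); lra.
have cB : B r @[r --> 1^'-] --> (0 : R).
  have -> : 0 = B 1 by rewrite /B expr1n subrr mul0r.
  apply: cvg_at_left_filter.
  have d0 : (1 - 2 * 1 * cos eta + 1 ^+ 2) ^+ 2 != 0 :> R.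
    rewrite expf_neq0// expr1n mulr1.
    have : cos eta < 1.
      by rewrite -cos0 ltr_cos// in_itv/= ?lexx ?pi_ge0// !ltW.
    by move=> c1; rewrite gt_eqF//; lra.
  apply: cvgM.
    by apply: cvgB; [exact: cvg_cst|exact: exprn_continuous].
  apply: cvgV => //.
  suff H : 1 - 2 * r * cos eta + r ^+ 2 @[r --> (1 : R)] -->
      1 - 2 * 1 * cos eta + 1 ^+ 2 by rewrite expr2; exact: (cvgM H H).
  apply: cvgD; last exact: exprn_continuous.
  apply: cvgB; first exact: cvg_cst.
  by apply: cvgM; [apply: cvgM; [exact: cvg_cst|exact: cvg_id]|exact: cvg_cst].
have cB' : 2 * A * B r @[r --> 1^'-] --> (0 : R).
  by rewrite -(mulr0 (2 * A)); apply: cvgM => //; exact: cvg_cst.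
move/cvgr0Pnorm_le: cB' => /(_ _ e2) HB.
near=> r.
have r01 : 0 <= r < 1 by apply/andP; split; near: r; [exact: nbhs_left_ge|exact: nbhs_left_lt].
apply: le_trans (V_le _ r01) _.
rewrite [leRHS]splitr lerD2l (le_trans (ler_norm _))//.
by near: r.
Unshelve. all: by end_near. Qed.

(** Subtracting [L] times the first harmonic changes [D s] by [L * sin s] and [V r] by [L * r],
    which reduces the claim to the limit 0. *)
Lemma abel_sine (al : nat -> R) (A L : R) (D V : R -> R) :
  al 0%N = 0 ->
  (forall N, \sum_(0 <= n < N) `|al n| / n%:R <= A) ->
  (forall s,
    (\sum_(0 <= n < N) al n / n%:R * sin (n%:R * s)) @[N --> \oo] --> D s) ->
  (forall r, 0 <= r < 1 ->
    (\sum_(0 <= n < N) al n * r ^+ n) @[N --> \oo] --> V r) ->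
  D s / sin s @[s --> 0^'+] --> L -> V r @[r --> 1^'-] --> L.
Proof.
move=> al0 al_le D_cvg V_cvg DL.
pose be n : R := al n - L * (n == 1%N)%:R.
have sum1 (c : nat -> R) N : \sum_(0 <= n < N.+2) (n == 1%N)%:R * c n = c 1%N.
  rewrite big_nat_recl// big_nat_recl//= mul0r mul1r big1 ?addr0 ?add0r// => i _.
  by rewrite mul0r.
have cvg1 (c : nat -> R) : \sum_(0 <= n < N) (n == 1%N)%:R * c n @[N --> \oo] --> c 1%N.
  rewrite -(cvg_shiftn 2); under eq_fun do rewrite addn2 sum1.
  exact: cvg_cst.
have V' : V r - L * r @[r --> 1^'-] --> (0 : R).
  apply: (@abel_sine0 be (A + `|L|) (fun s => D s - L * sin s)).
  - by rewrite /be al0 mulr0 subrr.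
  - move=> N; apply: (@le_trans _ _ (\sum_(0 <= n < N) (`|al n| / n%:R +
      `|L| * ((n == 1%N)%:R * n%:R^-1)))).
      apply: ler_sum => n _; rewrite mulrA -mulrDl ler_wpM2r ?invr_ge0//.
      by rewrite (le_trans (ler_normB _ _))// normrM lerD2l ler_wpM2l// ger0_norm.
    rewrite big_split/= lerD// -mulr_sumr ler_piMr//.
    case: N => [|[|N]]; rewrite ?sum1 ?invr1//; first by rewrite big_geq// ler01.
    by rewrite big_nat1 /= mul0r ler01.
  - move=> s; have H : (\sum_(0 <= n < N) al n / n%:R * sin (n%:R * s) -
        L * \sum_(0 <= n < N) (n == 1%N)%:R * (n%:R^-1 * sin (n%:R * s)))
        @[N --> \oo] --> D s - L * sin s.
      apply: cvgB; first exact: D_cvg; apply: cvgM; first exact: cvg_cst.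
      by have := cvg1 (fun n => n%:R^-1 * sin (n%:R * s)); rewrite invr1 !mul1r.
    apply: eq_cvg_to H => N; rewrite mulr_sumr -sumrB; apply: eq_bigr => n _; rewrite /be; ring.
  - move=> r r01; have H : (\sum_(0 <= n < N) al n * r ^+ n -
        L * \sum_(0 <= n < N) (n == 1%N)%:R * r ^+ n)
        @[N --> \oo] --> V r - L * r.
      apply: cvgB; first exact: V_cvg; apply: cvgM; first exact: cvg_cst.
      by have := cvg1 (fun n => r ^+ n); rewrite expr1.
    apply: eq_cvg_to H => N; rewrite mulr_sumr -sumrB; apply: eq_bigr => n _; rewrite /be; ring.
  - have H : D s / sin s - L @[s --> 0^'+] --> (0 : R) by apply/subr_cvg0.
    apply: cvg_trans H; apply: near_eq_cvg; near=> s.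
    have s0 : 0 < sin s.
      rewrite sin_gt0_pi//; apply/andP; split; near: s; first exact: nbhs_right_gt.
      exact: (nbhs_right_lt (pi_gt0 R)).
    by rewrite /= mulrBl mulfK// gt_eqF.
have id1 : L * r @[r --> 1^'-] --> L.
  rewrite -[X in _ --> X]mulr1; apply: cvg_at_left_filter.
  by apply: cvgM; [exact: cvg_cst|exact: cvg_id].
have H : V r - L * r + L * r @[r --> 1^'-] --> L.
  by rewrite -[X in _ --> X]add0r; exact: cvgD.
by apply: eq_cvg_to H => r; rewrite subrK.
Unshelve. all: by end_near. Qed.

End AbelSineSeries.

(** * Square-integrable functions on the circle *)

Section NullSetIntegral.
Local Open Scope ereal_scope.
Context d (T : measurableType d) (R : realType).
Variable mu : {measure set T -> \bar R}.
Import HBNNSimple.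

Lemma ge0_integral_off_null (f g : T -> \bar R) (N : set T) :
  measurable N -> mu N = 0 -> (forall x, 0 <= f x) -> (forall x, 0 <= g x) ->
  (forall x, ~ N x -> f x = g x) -> \int[mu]_x f x <= \int[mu]_x g x.
Proof.
move=> mN N0 f0 g0 fg; rewrite !ge0_integralTE//; apply: ge_ereal_sup.
move=> _ [h hf <-]; have mNC : measurable (~` N) by exact: measurableC.
apply: ereal_sup_ubound; exists (proj_nnsfun h mNC) => /=.
  move=> x; rewrite /= mindicE; case: (boolP (x \in ~` N)) => /= xN.
    by rewrite mulr1 -fg//; move: xN; rewrite in_setC => /negP; rewrite inE.
  by rewrite mulr0.
rewrite -!integralT_nnsfun; apply: ge0_ae_eq_integral => //.
- by apply/measurable_EFinP; exact: measurable_funP.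
- by apply/measurable_EFinP; exact: measurable_funP.
- by move=> x _; rewrite lee_fin fun_ge0.
- by move=> x _; rewrite lee_fin fun_ge0.
- exists N; split => // x /= xh; apply: contrapT => xN; apply: xh => _.
  rewrite mindicE; have -> : x \in ~` N by rewrite inE.
  by rewrite mulr1.
Qed.

(* No measurability is required: the integral of a nonnegative function is a
   supremum over simple functions, which can be set to [0] on a null set. *)
Lemma integral_off_null (D : set T) (f g : T -> \bar R) :
  {ae mu, forall x, D x -> f x = g x} ->
  \int[mu]_(x in D) f x = \int[mu]_(x in D) g x.
Proof.
move=> [N [mN N0 sN]].
have fgN x : ~ N x -> (f \_ D) x = (g \_ D) x.
  move=> xN; rewrite !patchE; case: ifPn => // /set_mem Dx.
  by apply: contrapT => fg; apply: xN; apply: sN => /= /(_ Dx).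
have E (u v : T -> \bar R) : (forall x, ~ N x -> u x = v x) ->
    (forall x, 0 <= u x) -> (forall x, 0 <= v x) ->
    \int[mu]_x u x = \int[mu]_x v x.
  move=> uv u0 v0; apply/eqP; rewrite eq_le.
  rewrite (ge0_integral_off_null mN N0 u0 v0 uv).
  by rewrite (ge0_integral_off_null mN N0 v0 u0)// => x /uv.
rewrite integral_mkcond [RHS]integral_mkcond integralE [RHS]integralE.
congr (_ - _); apply: E => // x xN.
- by rewrite !funeposE fgN.
- by rewrite !funenegE fgN.
Qed.

End NullSetIntegral.

(* Locked copies: the inner product and the norm are products by definition, so
   that ring lemmas would otherwise be matched inside them. *)
HB.lock Definition ip (R : realType) (u v : R -> R[i]) : R[i] := L2_ip u v.

HB.lock Definition norm2 (R : realType) (u : R -> R[i]) : R :=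
  (2 * pi)^-1 * Rintegral (@lebesgue_measure R) `[0, 2 * pi] (fun t => sqn (u t)).

Section CircleIntegral.
Variable R : realType.
Local Notation mu := (@lebesgue_measure R).
Local Notation circle := (`[0, 2 * pi]%classic : set R).
Implicit Types (u v w : R -> R[i]) (c : R[i]).

Lemma measurable_circle : measurable (circle : set R).
Proof. exact: measurable_itv. Qed.

Definition ae_circle (P : R -> Prop) := {ae mu, forall t, circle t -> P t}.

Lemma ae_circleT (P : R -> Prop) : (forall t, P t) -> ae_circle P.
Proof. by move=> H; apply: aeW. Qed.

Lemma ae_circleS (P Q : R -> Prop) :
  (forall t, P t -> Q t) -> ae_circle P -> ae_circle Q.
Proof.
move=> PQ; apply: (@filterS _ _ (ae_filter_ringOfSetsType mu)) => t Pt ct; exact/PQ/Pt.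
Qed.

Lemma ae_circleS2 (P Q S : R -> Prop) : (forall t, P t -> Q t -> S t) ->
  ae_circle P -> ae_circle Q -> ae_circle S.
Proof.
move=> PQ.
by apply: (@filterS2 _ _ (ae_filter_ringOfSetsType mu)) => t Pt Qt ct; apply: PQ; [exact: Pt|exact: Qt].
Qed.

Lemma ae_circleS3 (P Q S U : R -> Prop) : (forall t, P t -> Q t -> S t -> U t) ->
  ae_circle P -> ae_circle Q -> ae_circle S -> ae_circle U.
Proof.
move=> H; apply: (@filterS3 _ _ (ae_filter_ringOfSetsType mu)) => t Pt Qt St ct.
by apply: H; [exact: Pt|exact: Qt|exact: St].
Qed.

Definition aeq u v := ae_circle (fun t => u t = v t).

Lemma aeq_refl u : aeq u u. Proof. exact: ae_circleT. Qed.

Lemma aeq_sym u v : aeq u v -> aeq v u.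
Proof. exact: ae_circleS. Qed.

Lemma aeq_trans u v w : aeq u v -> aeq v w -> aeq u w.
Proof. by apply: ae_circleS2 => t -> ->. Qed.

Lemma Cintegral_aeq u v : aeq u v -> Cintegral u = Cintegral v.
Proof.
move=> uv; rewrite /Cintegral /Rintegral.
by congr (fine _ +i* fine _); apply: integral_off_null;
  move: uv; apply: (@filterS _ _ (ae_filter_ringOfSetsType mu)) => t tuv /tuv ->.
Qed.

Definition intC u : Prop :=
  mu.-integrable circle (EFin \o (fun t => Re (u t))) /\
  mu.-integrable circle (EFin \o (fun t => Im (u t))).

Lemma CintegralD u v : intC u -> intC v ->
  Cintegral (fun t => u t + v t) = Cintegral u + Cintegral v.
Proof.
have mc := measurable_circle; move=> [ru iu] [rv iv].
rewrite /Cintegral; apply: complex_eqP; rewrite /= -RintegralD//.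
  by apply: eq_Rintegral => t _; rewrite ReD.
by apply: eq_Rintegral => t _; rewrite ImD.
Qed.

Lemma CintegralZ c u : intC u ->
  Cintegral (fun t => c * u t) = c * Cintegral u.
Proof.
have mc := measurable_circle; move=> [ru iu].
rewrite /Cintegral; apply: complex_eqP.
  rewrite ReM /= -!RintegralZl// -RintegralB//; try exact: integrable_scale.
  by apply: eq_Rintegral => t _; rewrite ReM.
rewrite ImM /= -!RintegralZl// -RintegralD//; try exact: integrable_scale.
by apply: eq_Rintegral => t _; rewrite ImM.
Qed.

Lemma CintegralJ u : intC u ->
  Cintegral (fun t => conjc (u t)) = conjc (Cintegral u).
Proof.
have mc := measurable_circle; move=> [ru iu]; apply: complex_eqP => /=.
  by apply: eq_Rintegral => t _; rewrite ReJ.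
rewrite -mulN1r -RintegralZl//.
by apply: eq_Rintegral => t _; rewrite ImJ mulN1r.
Qed.

Lemma Cintegral_real (f : R -> R) :
  Cintegral (fun t => (f t)%:C) = (Rintegral mu circle f)%:C.
Proof.
apply: complex_eqP => //=.
by rewrite Rintegral_cst ?mul0r//; exact: measurable_circle.
Qed.

Definition measC u : Prop :=
  measurable_fun circle (fun t => Re (u t)) /\
  measurable_fun circle (fun t => Im (u t)).

Lemma measC_sqn u : measC u -> measurable_fun circle (fun t => sqn (u t)).
Proof.
by move=> [ru iu]; apply: measurable_funD; apply: measurable_funX.
Qed.

Lemma measCD u v : measC u -> measC v -> measC (fun t => u t + v t).
Proof.
move=> [ru iu] [rv iv]; split.
  have := measurable_funD ru rv.
  by apply: eq_measurable_fun => t _; rewrite /= ReD.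
have := measurable_funD iu iv.
by apply: eq_measurable_fun => t _; rewrite /= ImD.
Qed.

Lemma measCM u v : measC u -> measC v -> measC (fun t => u t * v t).
Proof.
move=> [ru iu] [rv iv]; split.
  have := measurable_funB (measurable_funM ru rv) (measurable_funM iu iv).
  by apply: eq_measurable_fun => t _; rewrite /= ReM.
have := measurable_funD (measurable_funM ru iv) (measurable_funM iu rv).
by apply: eq_measurable_fun => t _; rewrite /= ImM.
Qed.

Lemma measCJ u : measC u -> measC (fun t => conjc (u t)).
Proof.
move=> [ru iu]; split.
  by move: ru; apply: eq_measurable_fun => t _; rewrite ReJ.
have : measurable_fun circle (fun t => - Im (u t)) by exact: measurable_funN.
by apply: eq_measurable_fun => t _; rewrite ImJ.
Qed.

Lemma measC_cst c : measC (fun=> c).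
Proof. by split; exact: measurable_cst. Qed.

Lemma measC_cvg (u : nat -> R -> R[i]) v : (forall n, measC (u n)) ->
  (forall t, circle t -> (u n t : R[i]^o) @[n --> \oo] --> (v t : R[i]^o)) ->
  measC v.
Proof.
move=> mu_ uv; split.
  apply: (@measurable_fun_cvg _ _ _ _ (fun n t => Re (u n t))).
    by move=> n; case: (mu_ n).
  by move=> t ct; have /cvgC[] := uv t ct.
apply: (@measurable_fun_cvg _ _ _ _ (fun n t => Im (u n t))).
  by move=> n; case: (mu_ n).
by move=> t ct; have /cvgC[] := uv t ct.
Qed.

Lemma L2P u : L2 u <->
  measC u /\ mu.-integrable circle (EFin \o (fun t => sqn (u t))).
Proof.
have e : (fun t => (Re `|u t| ^+ 2)%:E) = EFin \o (fun t => sqn (u t)).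
  by apply/funext => t /=; rewrite -cabs_sqr.
by rewrite /L2 /= e; split=> [[]|[[]]].
Qed.

Lemma le_integrable_circle (f g : R -> R) : measurable_fun circle f ->
  (forall t, `|f t| <= g t) -> mu.-integrable circle (EFin \o g) ->
  mu.-integrable circle (EFin \o f).
Proof.
move=> mf fg ig.
have := @le_integrable _ _ _ mu circle measurable_circle (EFin \o f) (EFin \o g).
apply => //; first exact/measurable_EFinP.
by move=> t _ /=; rewrite lee_fin (le_trans (fg t))// ler_norm.
Qed.

Lemma L2_intC_mul u v : L2 u -> L2 v -> intC (fun t => u t * conjc (v t)).
Proof.
move=> /L2P[mu_ iu] /L2P[mv iv].
have [mr mi] := measCM mu_ (measCJ mv).
have ib := integrable_addr measurable_circle iu iv.
have b t : cabs (u t * conjc (v t)) <= sqn (u t) + sqn (v t).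
  rewrite cabsM cabsJ -!cabs_sqr.
  have := sqr_ge0 (cabs (u t) - cabs (v t)).
  have := sqr_ge0 (cabs (u t)); have := sqr_ge0 (cabs (v t)); nra.
split; (apply: le_integrable_circle; [done| |exact: ib]) => t.
  exact: le_trans (Re_le_cabs _) (b t).
exact: le_trans (Im_le_cabs _) (b t).
Qed.

Lemma L2D u v : L2 u -> L2 v -> L2 (fun t => u t + v t).
Proof.
move=> /L2P[mu_ iu] /L2P[mv iv]; apply/L2P; split; first exact: measCD.
apply: (@le_integrable_circle _ (fun t => 2 * sqn (u t) + 2 * sqn (v t))).
- by apply: measC_sqn; exact: measCD.
- by move=> t; rewrite ger0_norm ?sqn_ge0// sqnD_le.
- apply: integrable_addr; first exact: measurable_circle.
  + by apply: integrable_scale => //; exact: measurable_circle.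
  + by apply: integrable_scale => //; exact: measurable_circle.
Qed.

Lemma L2_mul_bounded u w (M : R) : L2 u -> measC w -> (forall t, sqn (w t) <= M) ->
  L2 (fun t => w t * u t).
Proof.
move=> /L2P[mu_ iu] mw wM; apply/L2P; split; first exact: measCM.
apply: (@le_integrable_circle _ (fun t => M * sqn (u t))).
- by apply: measC_sqn; exact: measCM.
- by move=> t; rewrite ger0_norm ?sqn_ge0// sqnM ler_wpM2r// sqn_ge0.
- by apply: integrable_scale => //; exact: measurable_circle.
Qed.

Lemma L2Z c u : L2 u -> L2 (fun t => c * u t).
Proof. by move=> u2; apply: (@L2_mul_bounded _ (fun=> c) (sqn c)); [|exact: measC_cst|]. Qed.

Lemma L2J u : L2 u -> L2 (fun t => conjc (u t)).
Proof.
move=> /L2P[mu_ iu]; apply/L2P; split; first exact: measCJ.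
by move: iu; apply: eq_integrable; [exact: measurable_circle|move=> t _; rewrite /= sqnJ].
Qed.

Lemma L2_bounded u (M : R) : measC u -> (forall t, sqn (u t) <= M) -> L2 u.
Proof.
move=> mu_ uM; apply/L2P; split=> //.
apply: (@le_integrable_circle _ (fun=> M)); first exact: measC_sqn.
  by move=> t; rewrite ger0_norm ?sqn_ge0.
by apply: continuous_integrable; exact: continuous_cst_fun.
Qed.

(* Membership in [L2] up to a null set: boundary values of Hardy functions are
   only defined, hence only measurable, almost everywhere. *)
Definition sqint u : Prop := exists2 v, L2 v & aeq u v.

Lemma L2_sqint u : L2 u -> sqint u.
Proof. by move=> u2; exists u => //; exact: aeq_refl. Qed.

Lemma sqint_aeq u v : aeq u v -> sqint v -> sqint u.
Proof. by move=> uv [w w2 vw]; exists w => //; exact: aeq_trans vw. Qed.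

Lemma sqintD u v : sqint u -> sqint v -> sqint (fun t => u t + v t).
Proof.
move=> [u' u2 uu] [v' v2 vv]; exists (fun t => u' t + v' t); first exact: L2D.
by move: uu vv; apply: ae_circleS2 => t -> ->.
Qed.

Lemma sqintZ c u : sqint u -> sqint (fun t => c * u t).
Proof.
move=> [u' u2 uu]; exists (fun t => c * u' t); first exact: L2Z.
by move: uu; apply: ae_circleS => t ->.
Qed.

Lemma sqintN u : sqint u -> sqint (fun t => - u t).
Proof.
by move=> /(sqintZ (-1)); apply: sqint_aeq; apply: ae_circleT => t; rewrite mulN1r.
Qed.

Lemma sqintB u v : sqint u -> sqint v -> sqint (fun t => u t - v t).
Proof. by move=> u2 /sqintN; exact: sqintD. Qed.

Lemma sqintJ u : sqint u -> sqint (fun t => conjc (u t)).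
Proof.
move=> [u' u2 uu]; exists (fun t => conjc (u' t)); first exact: L2J.
by move: uu; apply: ae_circleS => t ->.
Qed.

Lemma sqint0 : sqint (fun=> 0).
Proof. by apply: L2_sqint; apply: (L2_bounded (measC_cst _)) => t. Qed.

(** The witness is measurable and bounded everywhere, so that multiplication by it preserves [L2];
    [w] itself, typically a boundary function, is controlled almost everywhere only. *)
Definition unimod w : Prop :=
  exists2 v, measC v /\ (forall t, sqn (v t) <= 1) &
    ae_circle (fun t => w t = v t /\ sqn (w t) = 1).

Lemma sqint_unimodM w u : unimod w -> sqint u -> sqint (fun t => w t * u t).
Proof.
move=> [w' [mw w1] ww] [u' u2 uu]; exists (fun t => w' t * u' t).
  exact: (L2_mul_bounded u2 mw w1).
by move: ww uu; apply: ae_circleS2 => t [-> _] ->.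
Qed.

Lemma unimodJ w : unimod w -> unimod (fun t => conjc (w t)).
Proof.
move=> [w' [mw w1] ww]; exists (fun t => conjc (w' t)).
  by split; [exact: measCJ|move=> t; rewrite sqnJ].
by move: ww; apply: ae_circleS => t; rewrite sqnJ => -[-> ->].
Qed.

Lemma unimodM w v : unimod w -> unimod v -> unimod (fun t => w t * v t).
Proof.
move=> [w' [mw w1] ww] [v' [mv v1] vv]; exists (fun t => w' t * v' t).
  by split; [exact: measCM|move=> t; rewrite sqnM mulr_ile1 ?sqn_ge0].
move: ww vv; apply: ae_circleS2 => t [e1 e2] [e3 e4].
by rewrite sqnM e2 e4 mulr1 e1 e3.
Qed.

Lemma ip_aeq u u' v v' : aeq u u' -> aeq v v' -> ip u v = ip u' v'.
Proof.
move=> uu vv; rewrite !ip.unlock /L2_ip; congr (_ * _); apply: Cintegral_aeq.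
by move: uu vv; apply: ae_circleS2 => t -> ->.
Qed.

Lemma ipDl u v w : sqint u -> sqint v -> sqint w ->
  ip (fun t => u t + v t) w = ip u w + ip v w.
Proof.
move=> [u' u2 uu] [v' v2 vv] [w' w2 ww].
have uv : aeq (fun t => u t + v t) (fun t => u' t + v' t).
  by move: uu vv; apply: ae_circleS2 => t -> ->.
rewrite (ip_aeq uv ww) (ip_aeq uu ww) (ip_aeq vv ww) !ip.unlock /L2_ip -mulrDr.
rewrite -CintegralD; try exact: L2_intC_mul.
by congr (_ * Cintegral _); apply/funext => t; rewrite mulrDl.
Qed.

Lemma ipZl c u w : sqint u -> sqint w ->
  ip (fun t => c * u t) w = c * ip u w.
Proof.
move=> [u' u2 uu] [w' w2 ww].
have cu : aeq (fun t => c * u t) (fun t => c * u' t).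
  by move: uu; apply: ae_circleS => t ->.
rewrite (ip_aeq cu ww) (ip_aeq uu ww) !ip.unlock /L2_ip mulrCA.
rewrite -(CintegralZ c); last exact: L2_intC_mul.
by congr (_ * Cintegral _); apply/funext => t; rewrite mulrA.
Qed.

Lemma ipC u v : sqint u -> sqint v -> ip v u = conjc (ip u v).
Proof.
move=> [u' u2 uu] [v' v2 vv]; rewrite (ip_aeq uu vv) (ip_aeq vv uu) !ip.unlock /L2_ip.
rewrite conjM conj_real -CintegralJ; last exact: L2_intC_mul.
by congr (_ * Cintegral _); apply/funext => t; rewrite conjM conjcK mulrC.
Qed.

Lemma ip_norm2 u : ip u u = (norm2 u)%:C.
Proof.
rewrite !ip.unlock /L2_ip norm2.unlock rmorphM/= -Cintegral_real; congr (_ * Cintegral _).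
by apply/funext => t; rewrite mulcJ.
Qed.

Lemma twopi_gt0 : 0 < 2 * pi :> R.
Proof. by rewrite mulr_gt0// pi_gt0. Qed.

Lemma norm2_ge0 u : 0 <= norm2 u.
Proof.
rewrite norm2.unlock mulr_ge0 ?invr_ge0 ?(ltW twopi_gt0)// Rintegral_ge0// => t _.
exact: sqn_ge0.
Qed.

Lemma norm2_eq0 u : sqint u -> norm2 u = 0 -> aeq u (fun=> 0).
Proof.
move=> [v v2 uv]; have -> : norm2 u = norm2 v.
  by apply: complexI; rewrite -!ip_norm2; exact: ip_aeq.
move=> /eqP; rewrite norm2.unlock mulf_eq0 invr_eq0 (gt_eqF twopi_gt0)/= => /eqP v0.
apply: (aeq_trans uv); have /L2P[mv iv] := v2.
have := @ae_eq_integral_abs _ _ _ mu circle measurable_circle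
  (EFin \o (fun t => sqn (v t))).
have ms : measurable_fun circle (EFin \o (fun t => sqn (v t))).
  by apply/measurable_EFinP; exact: measC_sqn.
move=> /(_ ms)[+ _].
have -> : (\int[mu]_(t in circle) `|(EFin \o (fun t => sqn (v t))) t| = 0)%E.
  have -> : (\int[mu]_(t in circle) `|(EFin \o (fun t => sqn (v t))) t| =
      \int[mu]_(t in circle) (EFin \o (fun t => sqn (v t))) t)%E.
    by apply: eq_integral => t _; rewrite /= ger0_norm// sqn_ge0.
  rewrite -[LHS]fineK ?[fine _]v0//.
  by apply: integrable_fin_num => //; exact: measurable_circle.
move=> /(_ erefl); apply: (@filterS _ _ (ae_filter_ringOfSetsType mu)) => t H ct; have := H ct.
by move=> /eqP; rewrite /= eqe sqn_eq0 => /eqP.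
Qed.

Lemma ip_unimod w u v : unimod w ->
  ip (fun t => w t * u t) (fun t => w t * v t) = ip u v.
Proof.
move=> [w' _ ww]; rewrite !ip.unlock /L2_ip; congr (_ * _); apply: Cintegral_aeq.
move: ww; apply: ae_circleS => t [_ w1].
by rewrite conjM mulrACA mulcJ w1 mul1r.
Qed.

End CircleIntegral.

(** * Trigonometric polynomials *)

Section TrigPolynomials.
Variable R : realType.
Local Notation mu := (@lebesgue_measure R).
Local Notation circle := (`[0, 2 * pi]%classic : set R).
Implicit Types (a c : nat -> R[i]).

Definition ecirc (n : nat) (t : R) : R[i] := cis (n%:R * t).

Lemma sqn_ecirc n t : sqn (ecirc n t) = 1. Proof. exact: sqn_cis. Qed.

Lemma ecirc_unimod n : unimod (ecirc n).
Proof.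
exists (ecirc n).
  split; last by move=> t; rewrite sqn_ecirc.
  split; apply: measurable_funTS; apply: continuous_measurable_fun.
    exact: continuous_cosZ.
  exact: continuous_sinZ.
by apply: ae_circleT => t; rewrite sqn_ecirc.
Qed.

Lemma measC_ecirc n : measC (ecirc n).
Proof.
split; apply: measurable_funTS; apply: continuous_measurable_fun.
  exact: continuous_cosZ.
exact: continuous_sinZ.
Qed.

Lemma ecircM m n t : ecirc m t * ecirc n t = ecirc (m + n) t.
Proof. by rewrite /ecirc -cisD natrD mulrDl. Qed.

Lemma ecirc_mulJ n t : ecirc n t * conjc (ecirc n t) = 1.
Proof. exact: cis_mulJ. Qed.

Lemma ecirc0 t : ecirc 0 t = 1. Proof. by rewrite /ecirc mul0r cis0. Qed.

Lemma L2_ecirc n : L2 (ecirc n).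
Proof. by apply: (L2_bounded (measC_ecirc n)) => t; rewrite sqn_ecirc. Qed.

Lemma sqint_ecirc n : sqint (ecirc n).
Proof. exact: L2_sqint (L2_ecirc n). Qed.

Lemma cis_nat2pi n : cis (n%:R * (2 * pi)) = 1 :> R[i].
Proof.
rewrite -cisX; have -> : cis (2 * pi) = 1 :> R[i].
  by rewrite /cis mulr_natl cos2pi sin2pi.
by rewrite expr1n.
Qed.

Lemma ip_ecirc m n : ip (ecirc m) (ecirc n) = (m == n)%:R.
Proof.
have pi2 := twopi_gt0 R.
have [->|mn] := eqVneq m n.
  rewrite ip_norm2 norm2.unlock; under eq_Rintegral do rewrite sqn_ecirc.
  by rewrite Rintegral_cst_itv ?ltW// subr0 mul1r mulVf// gt_eqF.
set c : R := m%:R - n%:R.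
have c0 : c != 0 by rewrite subr_eq0 eqr_nat.
have e2 : cis (c * (2 * pi)) = 1 :> R[i].
  by rewrite mulrBl cisD -cis_conj !cis_nat2pi conjc1 mulr1.
move/eqP: e2; rewrite eq_complex/= => /andP[/eqP cos1 /eqP sin1].
rewrite !ip.unlock /L2_ip; have -> : (fun t => ecirc m t * conjc (ecirc n t)) = (fun t => cis (c * t)).
  by apply/funext => t; rewrite cis_conj -cisD mulrBl.
have -> : Cintegral (fun t => cis (c * t)) = 0 :> R[i].
  rewrite /Cintegral /cis/= Rintegral_cosZ// Rintegral_sinZ//.
  by rewrite cos1 sin1 mulr0 sin0 cos0 !subrr !mul0r.
by rewrite mulr0.
Qed.

Definition trigp c (m n : nat) (t : R) : R[i] := \sum_(m <= k < n) c k * ecirc k t.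

Lemma sqint_sum (I : Type) (s : seq I) (P : pred I) (u : I -> R -> R[i]) :
  (forall i, sqint (u i)) -> sqint (fun t => \sum_(i <- s | P i) u i t).
Proof.
move=> hu; elim: s => [|i s IH].
  by under eq_fun do rewrite big_nil; exact: sqint0.
under eq_fun do rewrite big_cons.
by case: (P i) => //; exact: sqintD.
Qed.

Lemma ip_suml (I : Type) (s : seq I) (P : pred I) (u : I -> R -> R[i]) v :
  (forall i, sqint (u i)) -> sqint v ->
  ip (fun t => \sum_(i <- s | P i) u i t) v = \sum_(i <- s | P i) ip (u i) v.
Proof.
move=> hu hv; elim: s => [|i s IH].
  rewrite big_nil; under [X in ip X]eq_fun do rewrite big_nil.
  have -> : (fun _ : R => 0 : R[i]) = (fun t => 0 * 0) by apply/funext => t; rewrite mul0r.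
  by rewrite ipZl ?mul0r//; exact: sqint0.
rewrite big_cons; under [X in ip X]eq_fun do rewrite big_cons.
case: ifP => // _; rewrite ipDl ?IH//; exact: sqint_sum.
Qed.

Lemma sqint_trigp c m n : sqint (trigp c m n).
Proof. by apply: sqint_sum => k; apply: sqintZ; exact: sqint_ecirc. Qed.

Lemma ip_trigp_l c m n v : sqint v ->
  ip (trigp c m n) v = \sum_(m <= k < n) c k * ip (ecirc k) v.
Proof.
move=> hv; rewrite ip_suml//; last by move=> k; apply: sqintZ; exact: sqint_ecirc.
by apply: eq_bigr => k _; rewrite ipZl//; exact: sqint_ecirc.
Qed.

Lemma ip_trigp_ecirc c m n k : (m <= k < n)%N -> ip (trigp c m n) (ecirc k) = c k.
Proof.
move=> mkn; rewrite ip_trigp_l; last exact: sqint_ecirc.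
rewrite (bigD1_seq k) ?mem_index_iota ?iota_uniq//= ip_ecirc eqxx mulr1 big1 ?addr0//.
by move=> j jk; rewrite ip_ecirc (negbTE jk) mulr0.
Qed.

Lemma norm2_trigp c m n : norm2 (trigp c m n) = \sum_(m <= k < n) sqn (c k).
Proof.
apply: complexI; rewrite -ip_norm2 ip_trigp_l; last exact: sqint_trigp.
rewrite rmorph_sum; apply: eq_big_nat => k mkn.
by rewrite ipC ?ip_trigp_ecirc ?mulcJ//; [exact: sqint_trigp|exact: sqint_ecirc].
Qed.

Lemma Re_trigp c m n t :
  Re (trigp c m n t) = \sum_(m <= k < n) (Re (c k) * cos (k%:R * t) - Im (c k) * sin (k%:R * t)).
Proof. by rewrite Re_sum; apply: eq_bigr => k _; rewrite ReM. Qed.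

Lemma continuous_Re_trigp c m n : continuous (fun t => Re (trigp c m n t)).
Proof.
under eq_fun do rewrite Re_trigp; apply: continuous_sum_fun => k x.
apply: cvgB; apply: cvgM; try exact: cvg_cst; [exact: continuous_cosZ|exact: continuous_sinZ].
Qed.

Lemma integral_sqn_trigp c m n :
  Rintegral mu circle (fun t => sqn (trigp c m n t)) =
  2 * pi * \sum_(m <= k < n) sqn (c k).
Proof.
rewrite -norm2_trigp norm2.unlock mulrA mulfV ?mul1r// gt_eqF//; exact: twopi_gt0.
Qed.

Lemma L2_trigp c m n : L2 (trigp c m n).
Proof.
rewrite /trigp; elim: (index_iota m n) => [|k s IH].
  under eq_fun do rewrite big_nil.
  by apply: (L2_bounded (measC_cst _)) => t.
by under eq_fun do rewrite big_cons; apply: L2D => //; apply/L2Z/L2_ecirc.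
Qed.

End TrigPolynomials.

(** * A weak form of the Riesz-Fischer theorem *)

Section RieszFischer.
Variable R : realType.
Local Notation mu := (@lebesgue_measure R).
Local Notation circle := (`[0, 2 * pi]%classic : set R).
Variable a : nat -> R[i].
Hypothesis a_l2 : cvgn (series (fun n => sqn (a n))).

Lemma l2_tail (e : R) : 0 < e ->
  exists N, forall n m, (N <= n)%N -> \sum_(n <= k < m) sqn (a k) <= e.
Proof.
move=> e0; set l := limn (series (fun n => sqn (a n))).
have /cvgrPdist_le/(_ _ e0)[N _ HN] := a_l2; exists N => n m Nn.
have [mn|nm] := leqP m n; first by rewrite big_geq// ltW.
have nd : nondecreasing_seq (series (fun n => sqn (a n))).
  by apply: nondecreasing_series => k _ _; exact: sqn_ge0.
have sm := nondecreasing_cvgn_le nd a_l2 m.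
have := HN _ Nn => /(le_trans (ler_norm _)); move: sm; rewrite /series/=.
rewrite (big_cat_nat (n := n))//=; last exact: ltnW.
by rewrite -/l; lra.
Qed.

(** Only what the differentiation theorem will use. The indices [Nk] are chosen so that the L1 norms
    of the successive blocks decay geometrically; the sum of the moduli of the blocks is then
    integrable, which gives both convergence almost everywhere and domination. The constant term is
    left out because the integrated series divides by the frequency. *)
Lemma riesz_fischer : exists (u : R -> R) (Nk : nat -> nat),
  [/\ locally_integrable setT u, mu.-integrable circle (EFin \o u),
      (forall k, (k < Nk k)%N) &
      forall t, 0 <= t <= 2 * pi ->
        Rintegral mu `[0, t] (fun s => Re (trigp a 1 (Nk k) s)) @[k --> \oo] -->
        Rintegral mu `[0, t] u].
Proof.
have /choice[g Hg] : forall k : nat, exists N, forall n m, (N <= n)%N ->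
    \sum_(n <= j < m) sqn (a j) <= (2 ^+ k)^-1 ^+ 2.
  by move=> k; apply: l2_tail; rewrite exprn_gt0// invr_gt0 exprn_gt0.
(* Summing the successors makes [Nk] strictly increasing and keeps it beyond each [g k]. *)
pose Nk k := (\sum_(j < k.+1) (g j).+1)%N.
have NkS k : (Nk k < Nk k.+1)%N by rewrite /Nk [X in (_ < X)%N]big_ord_recr/= -addn1 leq_add2l.
have Nk_g k : (g k <= Nk k)%N by rewrite /Nk big_ord_recr/= addnS ltnW// ltnS leq_addl.
have Nk_k k : (k < Nk k)%N.
  by elim: k => [|k IH]; [rewrite /Nk big_ord1|exact: leq_ltn_trans (NkS k)].
pose d k t := Re (trigp a (Nk k) (Nk k.+1) t).
pose s k t := Re (trigp a 1 (Nk k) t).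
have sS k t : s k t = s 0%N t + \sum_(0 <= j < k) d j t.
  elim: k => [|k IH]; first by rewrite big_geq// addr0.
  rewrite big_nat_recr//= addrA -IH /s /d -ReD /trigp -big_cat_nat//=.
    exact: leq_ltn_trans (Nk_k k).
  exact: ltnW.
have cs k : continuous (s k) by exact: continuous_Re_trigp.
have cd k : continuous (d k) by exact: continuous_Re_trigp.
have mc := @measurable_circle R.
have ms k (D : set R) : measurable_fun D (s k).
  by apply: measurable_funTS; exact: continuous_measurable_fun.
have md k (D : set R) : measurable_fun D (d k).
  by apply: measurable_funTS; exact: continuous_measurable_fun.
have mdn k : measurable_fun circle (fun t => `|d k t|%:E).
  apply/measurable_EFinP; apply: measurable_funTS.
  by apply: continuous_measurable_fun => t; apply: cvg_norm; exact: cd.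
have id_ k : (\int[mu]_(t in circle) `|d k t|%:E <= (4 * pi / (2 ^ k.+1)%:R)%:E)%E.
  have [mt it] := (L2P _).1 (L2_trigp a (Nk k) (Nk k.+1)).
  (* The inequality [x <= (2^k x^2 + 2^-k) / 2] trades the L1 norm for the L2 norm, of square at
     most [4^-k]: each half of [h] integrates to at most [pi * 2^-k]. *)
  pose h t := (2 ^+ k / 2) * sqn (trigp a (Nk k) (Nk k.+1) t) + (2 ^+ k)^-1 / 2.
  have ih : mu.-integrable circle (EFin \o h).
    apply: integrable_addr => //; first exact: integrable_scale.
    by apply: continuous_integrable; exact: continuous_cst_fun.
  have k2 : 0 < 2 ^+ k :> R by rewrite exprn_gt0.
  have dh t : `|d k t| <= h t.
    have -> : h t = (2 ^+ k * (Num.sqrt (sqn (trigp a (Nk k) (Nk k.+1) t))) ^+ 2 + (2 ^+ k)^-1) / 2.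
      by rewrite sqr_sqrtr ?sqn_ge0// /h; lra.
    rewrite -cabs_sqrt; apply: le_trans (Re_le_cabs _) _.
    set x := cabs _; rewrite -(@ler_pM2r _ (2 ^+ k))//.
    have -> : (2 ^+ k * x ^+ 2 + (2 ^+ k)^-1) / 2 * 2 ^+ k = ((2 ^+ k * x) ^+ 2 + 1) / 2.
      by field; rewrite gt_eqF.
    by have := sqr_ge0 (2 ^+ k * x - 1); nra.
  apply: (@le_trans _ _ (\int[mu]_(t in circle) (h t)%:E)%E).
    apply: ge0_le_integral => //.
    - exact: mdn.
    - by case/integrableP: ih.
    - by move=> t _; rewrite lee_fin.
  rewrite -[leLHS]fineK; last exact: integrable_fin_num.
  rewrite lee_fin -[fine _]/(Rintegral mu circle h) RintegralD//; last 2 first.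
  - exact: integrable_scale.
  - by apply: continuous_integrable; exact: continuous_cst_fun.
  rewrite RintegralZl// integral_sqn_trigp Rintegral_cst_itv ?(ltW (twopi_gt0 R))//.
  have := Hg k _ (Nk k.+1) (Nk_g k); set S := \sum_(_ <= _ < _) _ => HS.
  rewrite natrX exprS invfM subr0.
  have pi0 := pi_gt0 R.
  have : 2 ^+ k * S <= (2 ^+ k)^-1.
    rewrite -(@ler_pM2l _ ((2 ^+ k)^-1)) ?invr_gt0// mulKf ?gt_eqF//.
  by move=> /(ler_wpM2l (ltW pi0)); lra.
pose G t := (\big[+%E/0%E]_(0 <= k <oo) `|d k t|%:E)%E.
have mG : measurable_fun circle G.
  by apply: ge0_emeasurable_sum => // k x _ _; rewrite lee_fin.
have G0 t : (0 <= G t)%E by apply: nneseries_ge0 => k _ _; rewrite lee_fin.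
have iG : mu.-integrable circle G.
  apply/integrableP; split=> //.
  under eq_integral do rewrite gee0_abs//.
  rewrite integral_nneseries//.
  apply: (@le_lt_trans _ _ (\big[+%E/0%E]_(0 <= k <oo) (4 * pi / (2 ^ k.+1)%:R)%:E)%E).
    by apply: lee_nneseries => k _; [move=> _; apply: integral_ge0 => t _; rewrite lee_fin|exact: id_].
  apply: (@le_lt_trans _ _ (4 * pi)%:E); last exact: ltry.
  by apply: epsilon_trick0; rewrite mulr_ge0// pi_ge0.
have Gfin : {ae mu, forall t, circle t -> G t \is a fin_num} by exact: integrable_ae iG.
(* An upper limit is measurable wherever the sums may fail to converge, and it is the limit where
   [G] is finite. *)
pose u0 t := fine (limn_esup (fun n => (s n t)%:E)).
have mu0 : measurable_fun circle u0.
  apply: (measurableT_comp (fine_measurable _)) => //.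
  by apply: measurable_fun_limn_esup => n; apply/measurable_EFinP.
have s_u0 t : G t \is a fin_num -> s n t @[n --> \oo] --> u0 t.
  move=> Gt; have : cvgn (series (fun k => d k t)).
    apply: (@abs_series_cvg _ _ (fine (G t))) => n.
    rewrite -lee_fin fineK// -sumEFin.
    by apply: nneseries_lim_ge => k _ _; rewrite lee_fin.
  set l := limn _ => dl.
  have sl : s n t @[n --> \oo] --> s 0%N t + l.
    have H : s 0%N t + series (fun k => d k t) n @[n --> \oo] --> s 0%N t + l.
      by apply: cvgD => //; exact: cvg_cst.
    by apply: eq_cvg_to H => n; rewrite [RHS]sS.
  have sl' : (s n t)%:E @[n --> \oo] --> (s 0%N t + l)%:E.
    by apply: cvg_EFin => //; exact: nearW.
  suff -> : u0 t = s 0%N t + l by [].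
  rewrite /u0 is_cvg_limn_esupE; last by apply/cvg_ex; eexists; exact: sl'.
  by rewrite (cvg_lim _ sl').
have s_le n t : (`|(s n t)%:E| <= `|s 0%N t|%:E + G t)%E.
  rewrite /= sS (@le_trans _ _ (`|s 0%N t|%:E + (\sum_(0 <= j < n) `|d j t|)%:E)%E)//.
    by rewrite -EFinD lee_fin (le_trans (ler_normD _ _))// lerD2l ler_norm_sum.
  rewrite leeD2l// -sumEFin.
  by apply: nneseries_lim_ge => k _ _; rewrite lee_fin.
have is0 : mu.-integrable circle (fun t => `|s 0%N t|%:E + G t)%E.
  apply: integrableD => //; apply: continuous_integrable => t.
  by apply: cvg_norm; exact: cs.
have DCT (D : set R) : measurable D -> D `<=` circle ->
    mu.-integrable D (EFin \o u0) /\
    Rintegral mu D (s k) @[k --> \oo] --> Rintegral mu D u0.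
  move=> mD Dc.
  have [] := @dominated_convergence _ _ _ mu D mD (fun n => EFin \o s n)
    (EFin \o u0) (fun t => `|s 0%N t|%:E + G t)%E.
  - by move=> n; apply/measurable_EFinP; exact: ms.
  - by apply/measurable_EFinP; exact: measurable_funS mu0.
  - move: Gfin; apply: (@filterS _ _ (ae_filter_ringOfSetsType mu)) => t Gt Dt.
    by apply: cvg_EFin; [exact: nearW|apply/s_u0/Gt/Dc].
  - exact: integrableS is0.
  - by apply: aeW => t n _; exact: s_le.
  move=> intf _ cvgf; split => //.
  apply: fine_cvg; rewrite fineK; last exact: integrable_fin_num.
  exact: cvgf.
have [iu0 _] := DCT circle mc (fun _ => id).
(* Extension by 0 off the circle makes the function locally integrable on the whole line. *)
exists (u0 \_ circle), Nk; split=> //.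
- exact: integrable_locally.
- by move: iu0; apply: eq_integrable => // t tc /=; rewrite patchE tc.
- move=> t /andP[t0 t2].
  have tc : `[0, t] `<=` circle.
    by move=> x /=; rewrite !in_itv/= => /andP[-> /le_trans]; apply.
  have -> : Rintegral mu `[0, t] (u0 \_ circle) = Rintegral mu `[0, t] u0.
    by apply: eq_Rintegral => x /set_mem/tc xc; rewrite /= /patch mem_set.
  by have [] := DCT `[0, t]%classic (measurable_itv _) tc.
Qed.

End RieszFischer.

(** * Boundary values of power series *)

Section FatouRadialLimits.
Variable R : realType.
Local Notation mu := (@lebesgue_measure R).

Lemma sin_div_cvg : s / sin s @[s --> 0^'+] --> (1 : R).
Proof.
have H : h^-1 * sin h @[h --> 0^'] --> (1 : R).
  have := @is_derive_sin R 0; rewrite cos0 => -[d0 <-].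
  have : h^-1 *: ((sin \o shift 0) (h *: 1) - sin 0) @[h --> 0^'] --> 'D_1 sin (0 : R).
    exact: d0.
  by apply: eq_cvg_to => h /=; rewrite sin0 subr0 addr0 /GRing.scale/= mulr1.
have H1 : (h^-1 * sin h)^-1 @[h --> 0^'+] --> (1^-1 : R).
  by apply: cvgV; [exact: oner_neq0|exact: cvg_dnbhs_at_right].
by rewrite invr1 in H1; apply: eq_cvg_to H1 => s; rewrite invfM invrK.
Qed.

(** The quotient is taken by [sin s], equivalent to [s] at 0, to have the form that [abel_sine]
    expects. *)
Lemma symmetric_derivative (F : R -> R) (x : R) : derivable F x 1 ->
  (F (x + s) - F (x - s)) / 2 / sin s @[s --> 0^'+] --> 'D_1 F x.
Proof.
move=> dF; set L := 'D_1 F x.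
have H : h^-1 * (F (h + x) - F x) @[h --> 0^'] --> L.
  have : h^-1 *: ((F \o shift x) (h *: 1) - F x) @[h --> 0^'] --> 'D_1 F x by exact: dF.
  by apply: eq_cvg_to => h /=; rewrite /GRing.scale/= mulr1.
have Hr : s^-1 * (F (s + x) - F x) @[s --> 0^'+] --> L by exact: cvg_dnbhs_at_right.
have Hl : (- s)^-1 * (F (- s + x) - F x) @[s --> 0^'+] --> L.
  apply/cvgrPdist_lt => e e0; move/cvgrPdist_lt: H => /(_ _ e0) [d /= d0 Hd].
  exists d => //= s sd s0; apply: Hd.
    by move: sd; rewrite /ball_/= !sub0r normrN !normrN.
  by rewrite oppr_eq0 gt_eqF.
have H2 : (s^-1 * (F (s + x) - F x) + (- s)^-1 * (F (- s + x) - F x)) / 2 * (s / sin s)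
    @[s --> 0^'+] --> (L + L) / 2 * 1.
  apply: cvgM; last exact: sin_div_cvg.
  by apply: cvgM; [exact: cvgD|exact: cvg_cst].
have -> : L = (L + L) / 2 * 1 by lra.
apply: cvg_trans H2; apply: near_eq_cvg; near=> s.
have s0 : 0 < s by near: s; exact: nbhs_right_gt.
have sin0 : sin s != 0.
  rewrite gt_eqF// sin_gt0_pi// s0/=; near: s; exact: (nbhs_right_lt (pi_gt0 R)).
rewrite [x + s]addrC [x - s]addrC invrN.
by field; rewrite sin0 gt_eqF.
Unshelve. all: by end_near. Qed.

Variable a : nat -> R[i].
Hypothesis a_l2 : cvgn (series (fun n => sqn (a n))).

(** Termwise, [cabs (a n) / n] is at most [sqn (a n) + 1 / n^2], and the sum of the inverse squares
    is compared with a telescoping sum. The term of index 0 is 0 because the inverse of 0 is 0. *)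
Lemma l2_div_nat_bounded : exists A : R, forall N,
  \sum_(0 <= n < N) cabs (a n) / n%:R <= A.
Proof.
have H2 : forall N, \sum_(0 <= n < N) (n%:R : R) ^- 2 <= 2.
  have H : forall N, \sum_(0 <= n < N.+2) (n%:R : R) ^- 2 <= 2 - N.+1%:R^-1.
    elim=> [|N IH].
      by rewrite big_nat_recr//= big_nat1 expr0n invr0 add0r expr1n invr1; lra.
    rewrite big_nat_recr//=; apply: le_trans (lerD IH (lexx _)) _.
    have n1 : (0 : R) < N.+1%:R by [].
    have e : N.+2%:R = N.+1%:R + 1 :> R by rewrite -natr1.
    have n2 : (0 : R) < N.+2%:R by [].
    rewrite -subr_ge0.
    have -> : 2 - N.+2%:R^-1 - (2 - N.+1%:R^-1 + N.+2%:R ^- 2) =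
      N.+1%:R^-1 - N.+2%:R^-1 - N.+2%:R ^- 2 :> R by ring.
    have -> : N.+1%:R^-1 - N.+2%:R^-1 - N.+2%:R ^- 2 = (N.+1%:R * N.+2%:R ^+ 2)^-1 :> R.
      have : N.+1%:R + 1 != 0 :> R by rewrite -e gt_eqF.
      by move: n1; rewrite e; move: (N.+1%:R : R) => x x0 x1; field; rewrite x1 gt_eqF.
    by rewrite invr_ge0 mulr_ge0// exprn_ge0.
  case=> [|[|N]]; first by rewrite big_geq.
    by rewrite big_nat1 expr0n invr0.
  by apply: le_trans (H N) _; rewrite gerBl.
exists (limn (series (fun n => sqn (a n))) + 2) => N.
apply: (@le_trans _ _ (\sum_(0 <= n < N) (sqn (a n) + n%:R ^- 2))).
  apply: ler_sum => n _; rewrite -cabs_sqr -exprVn.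
  have := sqr_ge0 (cabs (a n) - n%:R^-1); have := sqr_ge0 (cabs (a n)).
  by have := sqr_ge0 (n%:R^-1 : R); nra.
rewrite big_split/= lerD// (nonneg_series_le (u := fun n => sqn (a n)))// => k.
exact: sqn_ge0.
Qed.

(* The series integrated term by term is the integral of an integrable function, hence
   differentiable a.e.; a symmetric derivative at [t] yields the Abel limit at [t]. *)
Lemma fatou_Re (V : R -> R -> R) :
  (forall t r, 0 <= r < 1 ->
    \sum_(0 <= n < N) Re (a n * ecirc n t) * r ^+ n @[N --> \oo] --> V t r) ->
  ae_circle (fun t => cvg (V t r @[r --> 1^'-])).
Proof.
move=> VE; have [A HA] := l2_div_nat_bounded.
have [u [Nk [locu intu Nkk Hu]]] := riesz_fischer a_l2.
(* For [n > 0] this is an antiderivative of [Re (a n * ecirc n t)]; it is 0 for [n = 0]. *)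
pose b n t := Im (a n * ecirc n t) / n%:R.
have b_le n t : `|b n t| <= cabs (a n) / n%:R.
  rewrite /b normrM normfV [`|n%:R|]ger0_norm// ler_wpM2r ?invr_ge0//.
  by rewrite (le_trans (Im_le_cabs _))// cabsM -[X in _ * X]/(cabs (cis _)) cabs_cis mulr1.
have b_cvg t : cvgn (series (fun n => b n t)).
  apply: (@abs_series_cvg _ _ A) => n; apply: le_trans (HA n).
  by apply: ler_sum => k _; exact: b_le.
pose Phi t := limn (series (fun n => b n t)).
have Phi_cvg t : \sum_(0 <= n < N) b n t @[N --> \oo] --> Phi t by exact: b_cvg.
have b0 t : b 0%N t = 0 by rewrite /b invr0 mulr0.
have sum1 N t : (0 < N)%N -> \sum_(0 <= n < N) b n t = \sum_(1 <= n < N) b n t.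
  by move=> N0; rewrite big_ltn// b0 add0r.
have FTC t (N : nat) : 0 < t -> Rintegral mu `[0, t] (fun s => Re (trigp a 1 N s)) =
    \sum_(1 <= n < N) b n t - \sum_(1 <= n < N) b n 0.
  move=> t0; under eq_Rintegral do rewrite Re_trigp.
  have cc (c : R) (n : nat) : continuous (fun s : R => c * cos (n%:R * s)).
    by apply: continuousM_fun; [exact: continuous_cst_fun|exact: continuous_cosZ].
  have cs (c : R) (n : nat) : continuous (fun s : R => c * sin (n%:R * s)).
    by apply: continuousM_fun; [exact: continuous_cst_fun|exact: continuous_sinZ].
  rewrite Rintegral_sum; last first.
    by move=> n; apply: continuous_integrable => x; apply: cvgB; [exact: cc|exact: cs].
  rewrite -sumrB; apply: eq_big_nat => n /andP[n0 _].
  have n0' : n%:R != 0 :> R by rewrite pnatr_eq0 -lt0n.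
  rewrite RintegralB//; try exact: continuous_integrable.
  rewrite !RintegralZl//; last 2 first.
  - by apply: continuous_integrable; exact: continuous_sinZ.
  - by apply: continuous_integrable; exact: continuous_cosZ.
  rewrite Rintegral_cosZ// Rintegral_sinZ// /b !ImM /ecirc /cis/=; ring.
have Phi_u t : 0 < t <= 2 * pi -> Phi t - Phi 0 = Rintegral mu `[0, t] u.
  move=> /andP[t0 t2].
  have H1 : (\sum_(0 <= n < N) b n t - \sum_(0 <= n < N) b n 0) @[N --> \oo] --> Phi t - Phi 0.
    by apply: cvgB; exact: Phi_cvg.
  have H2 := cvg_subseq (fun k => ltnW (Nkk k)) H1.
  have H3 : Rintegral mu `[0, t] (fun s => Re (trigp a 1 (Nk k) s)) @[k --> \oo] -->
      Rintegral mu `[0, t] u by apply: Hu; rewrite (ltW t0).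
  apply: (cvg_unique _ _ H3) => //; apply: eq_cvg_to H2 => k.
  by rewrite FTC// !sum1// (leq_ltn_trans _ (Nkk k)).
have dPhi : ae_circle (fun x => derivable Phi x 1).
  (* The endpoints are discarded so that the integral formula for [Phi] holds in a neighbourhood of
     [x]. *)
  pose N0 : set R := [set 0] `|` [set (2 * pi)].
  have N0ae : {ae mu, forall x, ~ N0 x}.
    exists N0; split.
    - by apply: measurableU; exact: measurable_set1.
    - by apply: null_set_setU => //; exact: lebesgue_measure_set1.
    - by move=> x /= /contrapT.
  have := lebesgue_differentiation locu.
  move: N0ae; apply: (@filterS2 _ _ (ae_filter_ringOfSetsType mu)) => x xN lx.
  rewrite /= in_itv/= => /andP[x0 x2].
  have {}x0 : 0 < x.
    by rewrite lt_neqAle x0 andbT eq_sym; apply/eqP => x0'; apply: xN; left.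
  have {}x2 : x < 2 * pi.
    by rewrite lt_neqAle x2 andbT; apply/eqP => x0'; apply: xN; right.
  have [] := @FTC1_lebesgue_pt R u (BLeft 0) x (2 * pi) x2 intu _ lx.
    by rewrite /= lte_fin.
  set F := (X in derivable X) => dF _.
  have : derivable (fun y => F y + Phi 0) x 1.
    by apply: (derivableD dF); exact: derivable_cst.
  apply: near_eq_derivable; near=> y; rewrite /F -Phi_u ?subrK//; apply/andP; split.
    by near: y; exact: lt_nbhsr.
  by apply/ltW; near: y; exact: lt_nbhsl.
move: dPhi; apply: ae_circleS => t dt.
(* As a function of [s], the odd part of [Phi] at [t] is the sine series with coefficients
   [al n / n]. The constant term, absent from it, is added back to the limit at the end. *)
pose al n := if n == 0%N then 0 else Re (a n * ecirc n t).
have al0 : al 0%N = 0 by [].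
have al_le N : \sum_(0 <= n < N) `|al n| / n%:R <= A.
  apply: le_trans (HA N); apply: ler_sum => n _; rewrite ler_wpM2r ?invr_ge0//.
  rewrite /al; case: eqP => _; first by rewrite normr0 cabs_ge0.
  by rewrite (le_trans (Re_le_cabs _))// cabsM -[X in _ * X]/(cabs (cis _)) cabs_cis mulr1.
have al_cvg s : \sum_(0 <= n < N) al n / n%:R * sin (n%:R * s) @[N --> \oo] -->
    (Phi (t + s) - Phi (t - s)) / 2.
  have H : (\sum_(0 <= n < N) b n (t + s) - \sum_(0 <= n < N) b n (t - s)) / 2
      @[N --> \oo] --> (Phi (t + s) - Phi (t - s)) / 2.
    by apply: cvgM; [apply: cvgB; exact: Phi_cvg|exact: cvg_cst].
  apply: eq_cvg_to H => N; rewrite -sumrB mulr_suml; apply: eq_bigr => n _.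
  rewrite /al /b; case: eqP => [->|_]; first by rewrite invr0 !mulr0 subrr !mul0r.
  rewrite !ImM ReM /ecirc /cis/= !mulrDr mulrN !cosD !sinD sinN cosN.
  by lra.
have V_cvg r : 0 <= r < 1 -> \sum_(0 <= n < N) al n * r ^+ n @[N --> \oo] -->
    V t r - Re (a 0%N).
  move=> r01; rewrite -(cvg_shiftS (fun N => \sum_(0 <= n < N) al n * r ^+ n)).
  have := VE t r r01.
  rewrite -(cvg_shiftS (fun N => \sum_(0 <= n < N) Re (a n * ecirc n t) * r ^+ n)) => H.
  have H' : (\sum_(0 <= n < N.+1) Re (a n * ecirc n t) * r ^+ n) - Re (a 0%N)
     @[N --> \oo] --> V t r - Re (a 0%N) by apply: cvgB => //; exact: cvg_cst.
  apply: eq_cvg_to H' => N /=; rewrite big_nat_recl// [RHS]big_nat_recl//= al0 mul0r add0r.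
  by rewrite ecirc0 !mulr1 addrC addKr.
have := abel_sine al0 al_le al_cvg V_cvg (symmetric_derivative dt).
move=> H; apply/cvg_ex; exists ('D_1 Phi t + Re (a 0%N)).
have H' : (V t r - Re (a 0%N)) + Re (a 0%N) @[r --> 1^'-] --> 'D_1 Phi t + Re (a 0%N).
  by apply: cvgD => //; exact: cvg_cst.
by apply: eq_cvg_to H' => r; rewrite subrK.
Unshelve. all: by end_near. Qed.

End FatouRadialLimits.

(** * Inner product geometry and Fourier expansions *)

Section L2Geometry.
Variable R : realType.
Local Notation mu := (@lebesgue_measure R).
Local Notation circle := (`[0, 2 * pi]%classic : set R).
Implicit Types (u v w : R -> R[i]) (c d : nat -> R[i]).

Lemma norm2_aeq u v : aeq u v -> norm2 u = norm2 v.
Proof. by move=> uv; apply: complexI; rewrite -!ip_norm2; exact: ip_aeq. Qed.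

Lemma ip_eq0l u v : aeq u (fun=> 0) -> ip u v = 0.
Proof.
move=> u0; rewrite (ip_aeq u0 (aeq_refl v)) !ip.unlock /L2_ip.
have -> : (fun t : R => 0 * conjc (v t)) = (fun t => (0 : R)%:C).
  by apply/funext => t; rewrite mul0r.
rewrite Cintegral_real Rintegral_cst; last exact: measurable_circle.
by rewrite mul0r mulr0.
Qed.

Lemma ipDr u v w : sqint u -> sqint v -> sqint w ->
  ip w (fun t => u t + v t) = ip w u + ip w v.
Proof.
move=> hu hv hw; rewrite ipC ?ipDl ?conjD//; last exact: sqintD.
by rewrite -!ipC.
Qed.

Lemma ipZr (k : R[i]) u w : sqint u -> sqint w ->
  ip w (fun t => k * u t) = conjc k * ip w u.
Proof.
move=> hu hw; rewrite ipC ?ipZl ?conjM//; last exact: sqintZ.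
by rewrite -ipC.
Qed.

Lemma ipNl u w : sqint u -> sqint w -> ip (fun t => - u t) w = - ip u w.
Proof.
move=> hu hw; have -> : (fun t => - u t) = (fun t => (-1) * u t).
  by apply/funext => t; rewrite mulN1r.
by rewrite ipZl// mulN1r.
Qed.

Lemma ipBl u v w : sqint u -> sqint v -> sqint w ->
  ip (fun t => u t - v t) w = ip u w - ip v w.
Proof. by move=> hu hv hw; rewrite ipDl ?ipNl//; exact: sqintN. Qed.

Lemma ipBr u v w : sqint u -> sqint v -> sqint w ->
  ip w (fun t => u t - v t) = ip w u - ip w v.
Proof.
move=> hu hv hw; rewrite ipC ?ipBl ?conjD ?conjN//; last exact: sqintB.
by rewrite -!ipC.
Qed.

Lemma norm2D u v : sqint u -> sqint v ->
  norm2 (fun t => u t + v t) = norm2 u + 2 * Re (ip u v) + norm2 v.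
Proof.
move=> hu hv; apply: complexI; rewrite -ip_norm2.
have huv := sqintD hu hv.
rewrite ipDl// !ipDr// (ipC hu hv) !ip_norm2.
apply: complex_eqP.
  by rewrite !ReD ReJ /=; lra.
by rewrite !ImD ImJ /=; lra.
Qed.

Lemma norm2Z (k : R[i]) u : sqint u -> norm2 (fun t => k * u t) = sqn k * norm2 u.
Proof.
move=> hu; apply: complexI; rewrite -ip_norm2 ipZl ?ipZr//; last exact: sqintZ.
by rewrite mulrA mulcJ ip_norm2; apply/esym/rmorphM.
Qed.

Lemma norm2N u : sqint u -> norm2 (fun t => - u t) = norm2 u.
Proof.
move=> hu; have -> : (fun t => - u t) = (fun t => (-1) * u t).
  by apply/funext => t; rewrite mulN1r.
rewrite norm2Z// -[RHS]mul1r; congr (_ * _).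
by rewrite /sqn/= oppr0 expr0n addr0 sqrrN expr1n.
Qed.

Lemma norm2D_le u v : sqint u -> sqint v ->
  norm2 (fun t => u t + v t) <= 2 * norm2 u + 2 * norm2 v.
Proof.
move=> hu hv; have := norm2_ge0 (fun t => u t + - v t).
rewrite (norm2D hu (sqintN hv)) (norm2D hu hv) norm2N//.
rewrite (_ : ip u (fun t => - v t) = - ip u v) ?ReN; first lra.
rewrite (_ : (fun t => - v t) = (fun t => (-1) * v t)); last first.
  by apply/funext => t; rewrite mulN1r.
by rewrite ipZr// conjN conjc1 mulN1r.
Qed.

Lemma norm2B_le u v : sqint u -> sqint v ->
  norm2 (fun t => u t - v t) <= 2 * norm2 u + 2 * norm2 v.
Proof. by move=> hu hv; rewrite -(norm2N hv); apply: norm2D_le => //; exact: sqintN. Qed.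

Lemma ip_cauchy u v : sqint u -> sqint v ->
  sqn (ip u v) <= norm2 u * norm2 v.
Proof.
move=> hu hv; have [v0|v0] := eqVneq (norm2 v) 0.
  rewrite ipC// ip_eq0l; last exact: norm2_eq0.
  by rewrite conjc0 sqn0 v0 mulr0.
have {}v0 : 0 < norm2 v by rewrite lt_neqAle eq_sym v0 norm2_ge0.
(* The value of [k] that minimizes the squared norm of [u + k v]. *)
set p := ip u v; pose k : R[i] := - p * ((norm2 v)^-1)%:C.
have hkv := sqintZ k hv.
have := norm2_ge0 (fun t => u t + k * v t).
rewrite norm2D// norm2Z// ipZr// -/p /k; move: p @k hkv => p _ _.
rewrite conjM conjN conj_real mulrAC.
rewrite !sqnM sqn_real -[- p]mulN1r sqnM.
have -> : sqn (-1) = 1 :> R.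
  by rewrite /sqn/= oppr0 expr0n addr0 sqrrN expr1n.
rewrite mulNr [conjc p * p]mulrC mulcJ mulNr -rmorphM ReN /=.
have -> : 1 * sqn p * (norm2 v)^-1 ^+ 2 * norm2 v = sqn p / norm2 v.
  by field; rewrite gt_eqF.
move=> H; rewrite -ler_pdivrMr//; lra.
Qed.

(** Fatou's lemma, once the sequence and its limit are set to 0 on a null set outside which the
    convergence holds; this is what makes the limit measurable. *)
Lemma L2_fatou_limit (U : nat -> R -> R[i]) v (M : R) :
  (forall n, L2 (U n)) -> (forall n, norm2 (U n) <= M) ->
  ae_circle (fun t => (U n t : R[i]^o) @[n --> \oo] --> (v t : R[i]^o)) ->
  sqint v /\ norm2 v <= M.
Proof.
move=> hU UM [N [mN N0 sN]].
have mc := @measurable_circle R.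
pose ind t : R[i] := (\1_(~` N) t)%:C.
have ind0 t : N t -> ind t = 0 by move=> Nt; rewrite /ind indicE in_setC mem_set.
have ind1 t : ~ N t -> ind t = 1 by move=> Nt; rewrite /ind indicE mem_set.
have mind : measC ind.
  split; last exact: measurable_cst.
  by apply: measurable_indic; exact: measurableC.
pose v' t := ind t * v t.
have vv' : aeq v v'.
  exists N; split=> // t /= H; apply: contrapT => Nt; apply: H => _.
  by rewrite /v' ind1// mul1r.
pose U' n t := ind t * U n t.
have sind t : sqn (ind t) <= 1.
  by have [/ind0|/ind1] := pselect (N t) => ->; rewrite ?sqn0// /sqn/= expr1n expr0n addr0.
have U'2 n : L2 (U' n) by exact: L2_mul_bounded (hU n) mind sind.
have Uae n : aeq (U n) (U' n).
  exists N; split=> // t /= H; apply: contrapT => Nt; apply: H => _.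
  by rewrite /U' ind1// mul1r.
have U'v' t : circle t -> (U' n t : R[i]^o) @[n --> \oo] --> (v' t : R[i]^o).
  move=> ct; have [Nt|Nt] := pselect (N t).
    by rewrite /U' /v' ind0// mul0r; under eq_fun do rewrite mul0r; exact: cvg_cst.
  rewrite /U' /v' ind1// mul1r; under eq_fun do rewrite mul1r.
  by apply: contrapT => H; apply: Nt; apply: sN => /= /(_ ct).
have mv' : measC v' by apply: measC_cvg U'v' => n; have /L2P[] := U'2 n.
have sU'v' t : circle t -> sqn (U' n t) @[n --> \oo] --> sqn (v' t).
  move=> /U'v' /cvgC[r i]; apply: cvgD; rewrite expr2.
    exact: (cvgM r r).
  exact: (cvgM i i).
have pi2 := twopi_gt0 R.
have M0 : 0 <= M by apply: le_trans (UM 0%N); exact: norm2_ge0.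
have fat : (\int[mu]_(t in circle) (sqn (v' t))%:E <= (2 * pi * M)%:E)%E.
  have := @fatou _ _ _ mu circle mc (fun n t => (sqn (U' n t))%:E).
  have mU n : measurable_fun circle (fun t => (sqn (U' n t))%:E).
    by have /L2P[mUn _] := U'2 n; apply/measurable_EFinP; exact: measC_sqn.
  move=> /(_ mU) H; have {}H := H (fun n t _ => sqn_ge0 (U' n t)).
  have e : (\int[mu]_(t in circle) limn_einf (fun n => (sqn (U' n t))%:E) =
      \int[mu]_(t in circle) (sqn (v' t))%:E)%E.
    apply: eq_integral => t /set_mem ct.
    by apply: (cvg_limn_einf_sup _).1; apply: cvg_EFin; [exact: nearW|exact: sU'v'].
  rewrite e in H; apply: le_trans H _; rewrite limn_einf_lim.
  apply: lime_le; first exact: is_cvg_einfs.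
  apply: nearW => n; apply: (@le_trans _ _ (\int[mu]_(t in circle) (sqn (U' n t))%:E)%E).
    by apply: ereal_inf_lbound; exists n => //=.
  rewrite -[leLHS]fineK; last first.
    by apply: integrable_fin_num => //; have /L2P[] := U'2 n.
  rewrite lee_fin -[fine _]/(Rintegral mu circle (fun t => sqn (U' n t))).
  by have := UM n; rewrite (norm2_aeq (Uae n)) norm2.unlock ler_pdivrMl.
have L2v' : L2 v'.
  apply/L2P; split=> //; apply/integrableP; split.
    by apply/measurable_EFinP; exact: measC_sqn.
  under eq_integral do rewrite /= ger0_norm ?sqn_ge0//.
  exact: le_lt_trans fat (ltry _).
split; first by exists v'.
rewrite (norm2_aeq vv') norm2.unlock ler_pdivrMl// -lee_fin /Rintegral fineK//.
by apply: integrable_fin_num => //; have /L2P[] := L2v'.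
Qed.

(** Membership in [H^2] of the circle with coefficients [c], expressed by convergence in norm of the
    partial sums. *)
Definition expands v c : Prop := sqint v /\
  forall e, 0 < e -> exists N0, forall N, (N0 <= N)%N ->
    norm2 (fun t => v t - trigp c 0 N t) <= e.

Lemma expands_ip v c n : expands v c -> ip v (ecirc n) = c n.
Proof.
move=> [hv H]; apply/eqP; rewrite -subr_eq0 -sqn_eq0 eq_le sqn_ge0 andbT.
apply/ler_addgt0Pr => e e0; rewrite add0r; have [N0 /(_ (maxn N0 n.+1))] := H e e0.
rewrite leq_maxl => /(_ isT) HN.
rewrite -(@ip_trigp_ecirc _ c 0 (maxn N0 n.+1) n) ?leq_maxr//.
rewrite -ipBl//; try exact: sqint_ecirc; try exact: sqint_trigp.
apply: le_trans (ip_cauchy _ _) _; first by apply: sqintB => //; exact: sqint_trigp.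
  exact: sqint_ecirc.
have -> : norm2 (ecirc n) = 1 :> R.
  by apply: complexI; rewrite -ip_norm2 ip_ecirc eqxx.
by rewrite mulr1.
Qed.

(** Pythagoras' identity. Dropping the remainder yields Bessel's inequality, letting it tend to 0
    yields Parseval's identity. *)
Lemma bessel_eq v c N : sqint v -> (forall n, (n < N)%N -> ip v (ecirc n) = c n) ->
  norm2 v = \sum_(0 <= k < N) sqn (c k) + norm2 (fun t => v t - trigp c 0 N t).
Proof.
move=> hv H; have ht := sqint_trigp c 0 N.
have := norm2D hv (sqintN ht); rewrite norm2N// norm2_trigp.
have -> : ip v (fun t => - trigp c 0 N t) = - (\sum_(0 <= k < N) sqn (c k))%:C.
  rewrite (_ : (fun t => - trigp c 0 N t) = (fun t => (-1) * trigp c 0 N t)); last first.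
    by apply/funext => t; rewrite mulN1r.
  rewrite ipZr// conjN conjc1 mulN1r; congr (- _).
  rewrite ipC// ip_trigp_l//.
  rewrite -[RHS]conj_real; congr conjc; rewrite rmorph_sum; apply: eq_big_nat => k kN.
  by rewrite ipC ?H//; [rewrite mulcJ|exact: sqint_ecirc].
by rewrite ReN /= => ->; lra.
Qed.

Lemma bessel v N : sqint v ->
  \sum_(0 <= k < N) sqn (ip v (ecirc k)) <= norm2 v.
Proof.
by move=> hv; rewrite [leRHS](@bessel_eq v _ N hv (fun n _ => erefl)) lerDl norm2_ge0.
Qed.

Lemma expands_norm2 v c : expands v c ->
  \sum_(0 <= k < N) sqn (c k) @[N --> \oo] --> norm2 v.
Proof.
move=> ex; have [hv H] := ex; apply/cvgrPdist_le => e e0.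
have [N0 HN] := H e e0; exists N0 => // N /= NN.
rewrite (@bessel_eq v c N hv) => [|n _]; last exact: expands_ip.
by rewrite addrC addKr ger0_norm ?norm2_ge0// HN.
Qed.

End L2Geometry.

Section SqintLimits.
Variable R : realType.
Local Notation mu := (@lebesgue_measure R).
Local Notation circle := (`[0, 2 * pi]%classic : set R).
Implicit Types (v : R -> R[i]) (c : nat -> R[i]).

Lemma sqint_fatou_limit (U : nat -> R -> R[i]) v (M : R) :
  (forall n, sqint (U n)) -> (forall n, norm2 (U n) <= M) ->
  ae_circle (fun t => (U n t : R[i]^o) @[n --> \oo] --> (v t : R[i]^o)) ->
  sqint v /\ norm2 v <= M.
Proof.
move=> hU UM Uv.
have /choice[W HW] : forall n, exists w, L2 w /\ aeq (U n) w.
  by move=> n; have [w] := hU n; exists w.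
apply: (@L2_fatou_limit _ W) => [n|n|].
- by case: (HW n).
- by case: (HW n) => _ /norm2_aeq <-.
have : {ae mu, forall t, forall n, circle t -> U n t = W n t}.
  by apply: ae_foralln => n; case: (HW n).
move: Uv; apply: (@filterS2 _ _ (ae_filter_ringOfSetsType mu)) => t Ut UW ct.
apply: eq_cvg_to (Ut ct) => n; exact: UW.
Qed.

(** The difference is the limit almost everywhere of the blocks [trigp c N (m + N)], so that Fatou's
    lemma turns pointwise convergence into a bound in norm. *)
Lemma trigp_limit_tail v c (N : nat) (M : R) :
  ae_circle (fun t => (trigp c 0 m t : R[i]^o) @[m --> \oo] --> (v t : R[i]^o)) ->
  (forall m, \sum_(N <= k < m) sqn (c k) <= M) ->
  sqint (fun t => v t - trigp c 0 N t) /\ norm2 (fun t => v t - trigp c 0 N t) <= M.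
Proof.
move=> cv cM; apply: (@sqint_fatou_limit (fun m => trigp c N (m + N))).
- by move=> m; exact: sqint_trigp.
- by move=> m; rewrite norm2_trigp.
move: cv; apply: ae_circleS => t.
rewrite -(cvg_shiftn N) => H.
apply/ccvgP; move/ccvgP in H.
apply: eq_ccvg (ccvgB H (ccvg_cst (trigp c 0 N t))) => m /=; rewrite /trigp (big_cat_nat (n := N))//= ?leq_addl//.
by rewrite addrAC subrr add0r.
Qed.

Lemma trigp_limit_expands v c : cvgn (series (fun n => sqn (c n))) ->
  ae_circle (fun t => (trigp c 0 m t : R[i]^o) @[m --> \oo] --> (v t : R[i]^o)) ->
  expands v c.
Proof.
move=> c2 cv; split.
  apply: (proj1 (@sqint_fatou_limit (trigp c 0) v (limn (series (fun n => sqn (c n)))) _ _ cv)).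
    by move=> n; exact: sqint_trigp.
  by move=> n; rewrite norm2_trigp; apply: nonneg_series_le => // k; exact: sqn_ge0.
move=> e e0; have [N0 HN] := l2_tail c2 e0; exists N0 => N NN.
by apply: (proj2 (trigp_limit_tail cv _)) => m; exact: HN.
Qed.

End SqintLimits.

Section ComplexSeries.
Variable R : realType.
Implicit Types (u : nat -> R[i]) (l : R[i]).

Lemma Re_series u n : Re (series u n) = series (fun k => Re (u k)) n.
Proof. exact: Re_sum. Qed.

Lemma Im_series u n : Im (series u n) = series (fun k => Im (u k)) n.
Proof. exact: Im_sum. Qed.

Lemma cabs_series_cvg u (M : R) : (forall n, \sum_(0 <= k < n) cabs (u k) <= M) ->
  exists l, (series u n : R[i]^o) @[n --> \oo] --> (l : R[i]^o).
Proof.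
move=> uM.
have cr : cvgn (series (fun k => Re (u k))).
  apply: (@abs_series_cvg _ _ M) => n; apply: le_trans (uM n).
  by apply: ler_sum => k _; exact: Re_le_cabs.
have ci : cvgn (series (fun k => Im (u k))).
  apply: (@abs_series_cvg _ _ M) => n; apply: le_trans (uM n).
  by apply: ler_sum => k _; exact: Im_le_cabs.
exists (limn (series (fun k => Re (u k))) +i* limn (series (fun k => Im (u k)))).
apply/cvgC; split => /=.
  by apply: eq_cvg_to cr => n; rewrite -Re_series.
by apply: eq_cvg_to ci => n; rewrite -Im_series.
Qed.

Lemma series_terms_bounded u l :
  (series u n : R[i]^o) @[n --> \oo] --> (l : R[i]^o) ->
  exists M : R, forall n, cabs (u n) <= M.
Proof.
move=> /cvgC[cr ci].
have H (w : nat -> R) (x : R) : series w n @[n --> \oo] --> x ->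
    exists M : R, forall n, `|w n| <= M.
  move=> wx; have /cvg_series_cvg_0/cvgP/cvg_seq_bounded : cvgn (series w).
    by apply/cvg_ex; exists x.
  move=> [M [Mr HM]]; exists (M + 1) => n; apply: HM => //; by rewrite ltrDl.
have [M1 H1] := H _ _ (eq_cvg_to (Re_series u) cr).
have [M2 H2] := H _ _ (eq_cvg_to (Im_series u) ci).
exists (M1 + M2) => n; apply: le_trans (cabs_le_ReIm _) _.
by apply: lerD; [exact: H1|exact: H2].
Qed.

Lemma cvgC_unique u (l l' : R[i]) : (u n : R[i]^o) @[n --> \oo] --> (l : R[i]^o) ->
  (u n : R[i]^o) @[n --> \oo] --> (l' : R[i]^o) -> l = l'.
Proof. by move=> H1 H2; apply: (cvg_unique _ H1 H2); exact: norm_hausdorff. Qed.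

End ComplexSeries.

(** * Power series on the disc and their boundary functions *)

Section TaylorSeries.
Variable R : realType.
Implicit Types (a b : nat -> R[i]) (f g : disk R -> R[i]) (z : disk R).

Lemma cabs_disk z : cabs (val z) < 1.
Proof. by rewrite cabs_lt; exact: (valP z). Qed.

Lemma val_radial (t r : R) : 0 <= r < 1 ->
  val (insubd (disk0 R) (r%:C * (cos t +i* sin t))) = r%:C * cis t.
Proof.
move=> /andP[r0 r1]; apply: insubdK; rewrite -topredE/= -[_ * _]/(r%:C * cis t).
by rewrite -cabs_lt cabsM cabs_cis mulr1 cabs_real ger0_norm.
Qed.

Definition abs_summable a := forall r : R, 0 <= r < 1 ->
  exists M, forall N, \sum_(0 <= n < N) cabs (a n) * r ^+ n <= M.

Lemma sum_geometric_le (q : R) N : 0 <= q < 1 -> \sum_(0 <= n < N) q ^+ n <= (1 - q)^-1.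
Proof.
move=> /andP[q0 q1]; have q1' : 0 < 1 - q by rewrite subr_gt0.
rewrite -[leRHS]mul1r ler_pdivlMr// mulrC.
have -> : (1 - q) * \sum_(0 <= n < N) q ^+ n = 1 - q ^+ N.
  elim: N => [|N IH]; first by rewrite big_geq// mulr0 expr0 subrr.
  by rewrite big_nat_recr//= mulrDr IH exprS; ring.
by rewrite gerBl exprn_ge0.
Qed.

Lemma bounded_abs_summable a (K : R) : (forall n, cabs (a n) <= K) -> abs_summable a.
Proof.
move=> aK r r01; have K0 : 0 <= K by apply: le_trans (aK 0%N); exact: cabs_ge0.
exists (K * (1 - r)^-1) => N; apply: le_trans (ler_wpM2l K0 (sum_geometric_le N r01)).
rewrite mulr_sumr; apply: ler_sum => n _; rewrite ler_wpM2r// exprn_ge0//.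
by case/andP: r01.
Qed.

Lemma l2_bounded a : cvgn (series (fun n => sqn (a n))) ->
  exists K, forall n, cabs (a n) <= K.
Proof.
move=> a2; exists (Num.sqrt (limn (series (fun n => sqn (a n))))) => n.
rewrite cabs_sqrt ler_wsqrtr//; apply: le_trans (nonneg_series_le n.+1 _ a2).
  by rewrite big_nat_recr//= lerDr sumr_ge0// => k _; exact: sqn_ge0.
by move=> k; exact: sqn_ge0.
Qed.

Lemma l2_abs_summable a : cvgn (series (fun n => sqn (a n))) -> abs_summable a.
Proof. by move=> /l2_bounded[K]; exact: bounded_abs_summable. Qed.

(** Abel's lemma: convergence at the midpoint [s] of [r] and 1 bounds the terms [a n * s ^+ n], and
    those at [r] are then compared with a geometric series of ratio [r / s]. *)
Lemma taylor_abs_summable a f : is_taylor a f -> abs_summable a.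
Proof.
move=> af r r01; have /andP[r0 r1] := r01; pose s := (1 + r) / 2.
have s0 : 0 < s by rewrite /s; lra.
have s1 : s < 1 by rewrite /s; lra.
have rs : r < s by rewrite /s; lra.
have hs : 0 <= s < 1 by rewrite (ltW s0).
have /series_terms_bounded[K HK] := af (insubd (disk0 R) (s%:C * (cos 0 +i* sin 0))).
have rs01 : 0 <= r / s < 1 by rewrite divr_ge0 ?(ltW s0)//= ltr_pdivrMr// mul1r.
have := @bounded_abs_summable (fun n => a n * (s ^+ n)%:C) K _ (r / s) rs01.
have aK n : cabs (a n * (s ^+ n)%:C) <= K.
  have := HK n; rewrite val_radial// cis0 mulr1 !cabsM cabsX !cabs_real ger0_norm ?(ltW s0)//.
  by rewrite ger0_norm// exprn_ge0// ltW.
move=> /(_ aK)[M HM]; exists M => N; apply: le_trans (HM N).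
apply: ler_sum => n _; rewrite cabsM cabs_real ger0_norm ?exprn_ge0 ?(ltW s0)//.
by rewrite -mulrA -exprMn [s * _]mulrC divfK// gt_eqF.
Qed.

Lemma abs_summable_cvg a z : abs_summable a ->
  exists l, (series (fun n => a n * val z ^+ n) N : R[i]^o) @[N --> \oo] --> (l : R[i]^o).
Proof.
move=> sa; have z01 : 0 <= cabs (val z) < 1 by rewrite cabs_ge0 cabs_disk.
have [M HM] := sa _ z01; apply: (@cabs_series_cvg _ _ M) => N.
by apply: le_trans (HM N); apply: ler_sum => n _; rewrite cabsM cabsX.
Qed.

(* The junk value of [lim] is irrelevant: only used for summable series. *)
Definition power_sum a : disk R -> R[i] :=
  fun z => lim ((series (fun n => a n * val z ^+ n : R[i]^o)) @ \oo).

Lemma power_sum_taylor a : abs_summable a -> is_taylor a (power_sum a).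
Proof.
move=> sa z; have [l al] := abs_summable_cvg z sa.
have al' : series (fun n => a n * val z ^+ n : R[i]^o) @ \oo --> (l : R[i]^o) by exact: al.
suff -> : power_sum a z = l by [].
by apply: (cvg_lim _ al'); exact: norm_hausdorff.
Qed.

Lemma taylor_radial a f (r : R) : is_taylor a f -> 0 <= r < 1 -> forall t,
  (trigp (fun n => a n * (r ^+ n)%:C) 0 N t : R[i]^o) @[N --> \oo] -->
  (radial f t r : R[i]^o).
Proof.
move=> af r01 t; have := af (insubd (disk0 R) (r%:C * (cos t +i* sin t))).
apply: eq_cvg_to => N; apply: eq_bigr => n _.
by rewrite val_radial// exprMn cisX mulrA rmorphXn.
Qed.

Lemma radial_l2 a (r : R) : abs_summable a -> 0 <= r < 1 ->
  cvgn (series (fun n => sqn (a n * (r ^+ n)%:C))).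
Proof.
move=> sa r01; have [M HM] := sa _ r01; have /andP[r0 _] := r01.
have b n : cabs (a n * (r ^+ n)%:C) = cabs (a n) * r ^+ n.
  by rewrite cabsM cabs_real ger0_norm// exprn_ge0.
apply: (@nonneg_series_cvg _ _ (M * M)) => [n|N]; first exact: sqn_ge0.
have bM n : cabs (a n * (r ^+ n)%:C) <= M.
  rewrite b; apply: le_trans (HM n.+1); rewrite big_nat_recr//= lerDr.
  by rewrite sumr_ge0// => k _; rewrite mulr_ge0 ?cabs_ge0// exprn_ge0.
have M0 : 0 <= M by apply: le_trans (bM 0%N); exact: cabs_ge0.
apply: le_trans (ler_wpM2l M0 (HM N)); rewrite mulr_sumr; apply: ler_sum => n _.
by rewrite -cabs_sqr expr2 -b ler_wpM2r// cabs_ge0.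
Qed.

Lemma radial_expands a f (r : R) : is_taylor a f -> 0 <= r < 1 ->
  expands (fun t => radial f t r) (fun n => a n * (r ^+ n)%:C).
Proof.
move=> af r01; apply: trigp_limit_expands.
  by apply: radial_l2 => //; exact: taylor_abs_summable af.
by apply: ae_circleT => t; exact: taylor_radial.
Qed.

(** Taylor coefficients are read off as Fourier coefficients on the circle of radius 1/2. *)
Lemma taylor_unique a b f : is_taylor a f -> is_taylor b f -> a =1 b.
Proof.
move=> af bf n; pose r : R := 2^-1.
have r01 : 0 <= r < 1 by rewrite /r; apply/andP; split; lra.
have := expands_ip n (radial_expands af r01).
rewrite (expands_ip n (radial_expands bf r01)) => /mulIf -> //.
by rewrite -cabs_eq0 cabs_real normr_eq0 expf_neq0// /r; lra.
Qed.

Lemma taylor_eq a b f g : is_taylor a f -> is_taylor b g -> a =1 b -> f = g.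
Proof.
move=> af bg /funext ab; apply/funext => z.
by apply: cvgC_unique (af z) _; rewrite ab; exact: bg.
Qed.

Lemma taylorD a b f g : is_taylor a f -> is_taylor b g ->
  is_taylor (fun n => a n + b n) (f \+ g).
Proof.
move=> af bg z; have /ccvgP Ha := af z; have /ccvgP Hb := bg z; apply/ccvgP.
apply: eq_ccvg (ccvgD Ha Hb) => N.
by rewrite /series/= -big_split/=; apply: eq_bigr => n _; rewrite mulrDl.
Qed.

Lemma taylorZ (k : R[i]) a f : is_taylor a f ->
  is_taylor (fun n => k * a n) (fun z => k * f z).
Proof.
move=> af z; have /ccvgP Ha := af z; apply/ccvgP.
apply: eq_ccvg (ccvgZ k Ha) => N.
by rewrite /series/= mulr_sumr; apply: eq_bigr => n _; rewrite mulrA.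
Qed.

Lemma fatou_radial a f : is_taylor a f -> cvgn (series (fun n => sqn (a n))) ->
  ae_circle (fun t => cvg (radial f t r @[r --> 1^'-])).
Proof.
move=> af a2.
have HR : ae_circle (fun t => cvg (Re (radial f t r) @[r --> 1^'-])).
  apply: (fatou_Re a2) => t r r01; have /cvgC[+ _] := @taylor_radial a f r af r01 t.
  apply: eq_cvg_to => N; rewrite Re_sum; apply: eq_bigr => n _.
  by rewrite mulrAC ReM_real.
have HI : ae_circle (fun t => cvg (Im (radial f t r) @[r --> 1^'-])).
  (* The imaginary part of [f] is the real part of [-i f]. *)
  apply: (@fatou_Re _ (fun n => - 'i * a n)) => [|t r r01].
    have -> : (fun n => sqn (- 'i * a n)) = (fun n => sqn (a n)) => //.
    apply/funext => n; rewrite sqnM; have -> : sqn (- 'i) = 1 :> R; last by rewrite mul1r.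
    by rewrite /sqn/= oppr0 expr0n add0r sqrrN expr1n.
  have /cvgC[_ +] := @taylor_radial a f r af r01 t.
  apply: eq_cvg_to => N; rewrite Im_sum; apply: eq_bigr => n _.
  rewrite mulrAC ImM_real.
  by congr (_ * _); rewrite !ReM !ImM /=; ring.
move: HR HI; apply: ae_circleS2 => t cr ci.
by apply/cvg_ex; exists (lim (Re (radial f t r) @[r --> 1^'-]) +i*
  lim (Im (radial f t r) @[r --> 1^'-])); apply/cvgC.
Qed.

Lemma boundary_cvg f t : cvg (radial f t r @[r --> 1^'-]) ->
  radial f t r @[r --> 1^'-] --> (boundary f t : R[i]^o).
Proof. by []. Qed.

Lemma boundary_lim f t (l : R[i]) : radial f t r @[r --> 1^'-] --> (l : R[i]^o) ->
  boundary f t = l.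
Proof. by move=> H; apply: (cvg_lim _ H); exact: norm_hausdorff. Qed.

(** Radii tending to 1 along a sequence, as the limit theorems for integrals require. *)
Definition rseq (k : nat) : R := 1 - k.+1%:R^-1.

Lemma rseq01 k : 0 <= rseq k < 1.
Proof.
have k0 : (0 : R) < k.+1%:R by [].
rewrite /rseq ltrBlDr ltrDl invr_gt0 k0 andbT subr_ge0 invf_le1//.
by rewrite ler1n.
Qed.

Lemma rseq_cvg1 : rseq k @[k --> \oo] --> (1 : R).
Proof.
have H : 1 - k.+1%:R^-1 @[k --> \oo] --> (1 - 0 : R).
  by apply: cvgB; [exact: cvg_cst|exact: cvg_harmonic].
by rewrite subr0 in H.
Qed.

Lemma rseq_cvg {T : topologicalType} (f : R -> T) (l : T) :
  f r @[r --> 1^'-] --> l -> f (rseq k) @[k --> \oo] --> l.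
Proof.
move=> fl; apply: (cvg_comp rseq f _ fl) => A [e /= e0 He].
have /cvgrPdist_lt/(_ _ e0) := rseq_cvg1; apply: filterS => k Hk.
by apply: He => //; case/andP: (rseq01 k).
Qed.

(** On a circle of radius below 1 the remainder of the expansion is bounded by the tail of the
    squares of [a], since the powers of the radius are at most 1. The bound does not depend on the
    radius and passes to the boundary by Fatou's lemma. *)
Lemma boundary_expands a f : is_taylor a f -> cvgn (series (fun n => sqn (a n))) ->
  expands (boundary f) a.
Proof.
move=> af a2.
have key N M : (forall m, \sum_(N <= k < m) sqn (a k) <= M) ->
    sqint (fun t => boundary f t - trigp a 0 N t) /\
    norm2 (fun t => boundary f t - trigp a 0 N t) <= M.
  move=> HM; pose c k n := a n * (rseq k ^+ n)%:C.
  have H k := @trigp_limit_tail _ (fun t => radial f t (rseq k)) (c k) N M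
    (ae_circleT (fun t => @taylor_radial a f _ af (rseq01 k) t)).
  have HcM k m : \sum_(N <= j < m) sqn (c k j) <= M.
    apply: le_trans (HM m); apply: ler_sum => n _; rewrite sqnM sqn_real.
    have /andP[r0 r1] := rseq01 k.
    have rn0 : 0 <= rseq k ^+ n by exact: exprn_ge0.
    have rn1 : rseq k ^+ n <= 1 by rewrite exprn_ile1// ltW.
    by rewrite ler_piMr ?sqn_ge0// expr2 mulr_ile1.
  apply: (@sqint_fatou_limit _ (fun k t => radial f t (rseq k) - trigp (c k) 0 N t)).
  - by move=> k; apply: (proj1 (H k _)).
  - by move=> k; apply: (proj2 (H k _)).
  move: (fatou_radial af a2); apply: ae_circleS => t ct.
  apply/ccvgP; apply: ccvgB; first by apply/ccvgP; apply: rseq_cvg; exact: ct.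
  apply: ccvg_sum => n; have H1 : (rseq k ^+ n) @[k --> \oo] --> (1 ^+ n : R).
    apply: (@continuous_cvg _ _ _ _ _ rseq (fun x => x ^+ n)).
      exact: exprn_continuous.
    exact: rseq_cvg1.
  rewrite expr1n in H1.
  have H2 : ccvg \oo (fun k => a n * (rseq k ^+ n)%:C) (a n * 1%:C).
    by apply: ccvgZ; exact: ccvg_real.
  rewrite mulr1 in H2; apply: ccvgM H2 _; exact: ccvg_cst.
split.
  have := (key 0%N _ (fun m => nonneg_series_le m (fun n => sqn_ge0 (a n)) a2)).1.
  apply: sqint_aeq; apply: ae_circleT => t.
  by rewrite /trigp big_geq// subr0.
move=> e e0; have [N0 HN] := l2_tail a2 e0; exists N0 => N NN.
by apply: (key N e _).2 => m; exact: HN.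
Qed.

End TaylorSeries.

(** * The Hardy space *)

Section CauchyProduct.
Variable R : realType.

Definition convol {S : pzSemiRingType} (a b : nat -> S) (n : nat) : S :=
  \sum_(0 <= k < n.+1) a k * b (n - k)%N.

Lemma sum_convol {S : pzSemiRingType} (a b : nat -> S) (N : nat) :
  \sum_(0 <= n < N) convol a b n =
  \sum_(0 <= k < N) a k * \sum_(0 <= j < N - k) b j.
Proof.
elim: N => [|N IH]; first by rewrite !big_geq.
rewrite big_nat_recr//= IH /convol [RHS]big_nat_recr//= [X in _ + X = _]big_nat_recr//=.
rewrite addrA -big_split/= subSnn subnn big_nat1; congr (_ + _).
by apply: eq_big_nat => k /andP[_ kN]; rewrite subSn 1?ltnW// big_nat_recr//= mulrDr.
Qed.

(** The partial sum of the convolution runs over a triangle of indices, the product of partial sums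
    over a square. Their difference is dominated by the same difference for the moduli, and the
    square of side [N] fits in the triangle of side [N + N]; hence the bound [D (N + N) - D N],
    which tends to 0. *)
Lemma cauchy_product (u v : nat -> R[i]) (U V : R[i]) (A B : R) :
  (forall N, \sum_(0 <= n < N) cabs (u n) <= A) ->
  (forall N, \sum_(0 <= n < N) cabs (v n) <= B) ->
  ccvg \oo (fun N => \sum_(0 <= n < N) u n) U ->
  ccvg \oo (fun N => \sum_(0 <= n < N) v n) V ->
  ccvg \oo (fun N => \sum_(0 <= n < N) convol u v n) (U * V).
Proof.
move=> HA HB hU hV.
pose p n := cabs (u n); pose q n := cabs (v n).
have p0 n : 0 <= p n by exact: cabs_ge0.
have q0 n : 0 <= q n by exact: cabs_ge0.
pose D N := \sum_(0 <= n < N) convol p q n.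
have sp0 m n : 0 <= \sum_(m <= k < n) p k by apply: sumr_ge0.
have sq0 m n : 0 <= \sum_(m <= k < n) q k by apply: sumr_ge0.
have monq m n : (m <= n)%N -> \sum_(0 <= k < m) q k <= \sum_(0 <= k < n) q k.
  by move=> mn; rewrite [leRHS](big_cat_nat (n := m))//= lerDl.
have DAB N : D N <= (\sum_(0 <= n < N) p n) * (\sum_(0 <= n < N) q n).
  rewrite /D sum_convol mulr_suml; apply: ler_sum => k _.
  by apply: ler_wpM2l => //; apply: monq; exact: leq_subr.
have ABD N : (\sum_(0 <= n < N) p n) * (\sum_(0 <= n < N) q n) <= D (N + N)%N.
  rewrite /D sum_convol mulr_suml [leRHS](big_cat_nat (n := N))//= ?leq_addr//.
  rewrite -[leLHS]addr0; apply: lerD; last first.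
    by apply: sumr_ge0 => k _; exact: mulr_ge0.
  apply: ler_sum_nat => k /andP[_ kN]; apply: ler_wpM2l => //; apply: monq.
  by rewrite -addnBA ?leq_addr// ltnW.
have D0 n : 0 <= convol p q n by apply: sumr_ge0 => k _; exact: mulr_ge0.
have Dcvg : cvgn (series (convol p q)).
  apply: (@nonneg_series_cvg _ _ (A * B)) => // N; apply: le_trans (DAB N) _.
  exact: ler_pM.
have bound N : cabs (\sum_(0 <= n < N) convol u v n -
    (\sum_(0 <= n < N) u n) * (\sum_(0 <= n < N) v n)) <= D (N + N)%N - D N.
  apply: le_trans (lerB (ABD N) (lexx _)).
  rewrite cabsB /D !sum_convol !mulr_suml -!sumrB; apply: le_trans (cabs_sum _ _ _) _.
  apply: ler_sum_nat => k /andP[_ kN]; rewrite -mulrBr cabsM -mulrBr.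
  apply: (ler_wpM2l (p0 k)).
  rewrite (big_cat_nat (n := (N - k)%N))//= ?leq_subr// addrAC subrr add0r.
  rewrite [X in _ <= X - _](big_cat_nat (n := (N - k)%N))//= ?leq_subr//.
  by rewrite addrAC subrr add0r; exact: cabs_sum.
have HD : (D (N + N)%N - D N) @[N --> \oo] --> (0 : R).
  rewrite -(subrr (limn (series (convol p q)))); apply: cvgB; last exact: Dcvg.
  apply: cvg_comp (Dcvg); apply/cvgnyPge => M; near=> N.
  by rewrite (leq_trans _ (leq_addr _ _))//; near: N; exact: nbhs_infty_ge.
have H0 : ccvg \oo (fun N => \sum_(0 <= n < N) convol u v n -
    (\sum_(0 <= n < N) u n) * (\sum_(0 <= n < N) v n)) 0.
  apply/ccvgP/cvgC_cabs; apply/(squeeze_cvgr _ (cvg_cst 0) HD).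
  by apply: nearW => N; rewrite subr0 cabs_ge0 bound.
rewrite -[U * V]add0r.
have H1 : ccvg \oo (fun N => (\sum_(0 <= n < N) u n) * (\sum_(0 <= n < N) v n)) (U * V).
  exact: ccvgM.
by apply: eq_ccvg (ccvgD H0 H1) => N; rewrite subrK.
Unshelve. all: by end_near. Qed.

Implicit Types (a b : nat -> R[i]) (f g : disk R -> R[i]) (z : disk R).

Lemma convolX a b (w : R[i]) n :
  convol (fun k => a k * w ^+ k) (fun k => b k * w ^+ k) n = convol a b n * w ^+ n.
Proof.
rewrite /convol mulr_suml; apply: eq_big_nat => k /andP[_ kn].
by rewrite mulrACA -exprD subnKC.
Qed.

Lemma taylorM a b f g : is_taylor a f -> is_taylor b g ->
  is_taylor (convol a b) (f \* g).
Proof.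
move=> af bg z; have z01 : 0 <= cabs (val z) < 1 by rewrite cabs_ge0 cabs_disk.
have [A HA] := taylor_abs_summable af z01; have [B HB] := taylor_abs_summable bg z01.
have /ccvgP af' := af z; have /ccvgP bg' := bg z; apply/ccvgP.
have E c (N : nat) : \sum_(0 <= n < N) cabs (c n * val z ^+ n) =
    \sum_(0 <= n < N) cabs (c n) * cabs (val z) ^+ n.
  by apply: eq_bigr => n _; rewrite cabsM cabsX.
have H : ccvg \oo (fun N => \sum_(0 <= n < N)
    convol (fun k => a k * val z ^+ k) (fun k => b k * val z ^+ k) n) (f z * g z).
  by apply: (@cauchy_product _ _ _ _ A B) => // N; rewrite E.
by apply: eq_ccvg H => N; apply: eq_bigr => n _; rewrite convolX.
Qed.

Lemma taylorX n : is_taylor (fun k => (k == n)%:R) (fun z => val z ^+ n).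
Proof.
move=> z; apply/ccvgP; rewrite -[val z ^+ n]addr0.
apply/ccvgP; apply/cvgC_cabs; apply: cvg_near_cst; near=> N.
rewrite addr0 /series/= (bigD1_seq n)/= ?iota_uniq//; last first.
  by rewrite mem_index_iota /=; near: N; exact: nbhs_infty_gt.
rewrite eqxx mul1r big1 ?addr0 ?subrr ?cabs0// => k /negPf ->; exact: mul0r.
Unshelve. all: by end_near. Qed.

(* The first nonzero coefficients multiply to the first nonzero coefficient of the product. *)
Lemma convol_eq0 a b : (forall n, convol a b n = 0) ->
  (forall n, a n = 0) \/ (forall n, b n = 0).
Proof.
move=> ab0; have [a0|/existsNP[i0 ai0]] := pselect (forall n, a n = 0); first by left.
have [b0|/existsNP[j0 bj0]] := pselect (forall n, b n = 0); first by right.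
exfalso.
have exa : exists n, a n != 0 by exists i0; apply/eqP.
have exb : exists n, b n != 0 by exists j0; apply/eqP.
case: (ex_minnP exa) => i ai mini; case: (ex_minnP exb) => j bj minj.
have := ab0 (i + j)%N; rewrite /convol (bigD1_seq i) ?mem_index_iota ?iota_uniq ?ltnS ?leq_addr//.
rewrite addKn big1_seq => [/=|k /andP[ki]].
  by rewrite addr0 => /eqP; rewrite mulf_eq0 (negPf ai) (negPf bj).
rewrite mem_index_iota ltnS => /andP[_ kij].
have [lt_ki|le_ik] := ltnP k i.
  have /eqP -> : a k == 0 by apply: contraLR lt_ki => ak; rewrite -leqNgt mini.
  by rewrite mul0r.
have lt_ik : (i < k)%N by rewrite ltn_neqAle eq_sym ki.
have /eqP -> : b (i + j - k)%N == 0; last by rewrite mulr0.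
have lt : (i + j - k < j)%N by lia.
by apply: contraLR lt => bk; rewrite -leqNgt minj.
Qed.

End CauchyProduct.

Section HardyFunctions.
Variable R : realType.
Local Notation mu := (@lebesgue_measure R).
Local Notation circle := (`[0, 2 * pi]%classic : set R).
Implicit Types (u v w : R -> R[i]) (a b c : nat -> R[i]) (f g h : disk R -> R[i]).

Lemma norm2_le u v (K : R) : sqint u -> sqint v -> 0 <= K ->
  ae_circle (fun t => sqn (u t) <= K * sqn (v t)) -> norm2 u <= K * norm2 v.
Proof.
move=> [u' u2 uu] [v' v2 vv] K0 uv; rewrite (norm2_aeq uu) (norm2_aeq vv).
rewrite norm2.unlock mulrCA ler_wpM2l ?invr_ge0 ?(ltW (twopi_gt0 R))//.
have /L2P[mu' iu] := u2; have /L2P[mv' iv] := v2.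
rewrite -lee_fin EFinM /Rintegral !fineK; last 2 first.
- by apply: integrable_fin_num => //; exact: measurable_circle.
- by apply: integrable_fin_num => //; exact: measurable_circle.
rewrite -(@integralZl _ _ _ mu circle (@measurable_circle R) _ iv).
apply: ae_ge0_le_integral; first exact: measurable_circle.
- by move=> t _; rewrite lee_fin sqn_ge0.
- by apply/measurable_EFinP; exact: measC_sqn.
- by move=> t _; rewrite lee_fin mulr_ge0 ?sqn_ge0.
- apply/measurable_EFinP; apply: measurable_funM; first exact: measurable_cst.
  exact: measC_sqn.
apply: (ae_circleS3 _ uu vv uv) => t ut vt.
by rewrite ut vt lee_fin.
Qed.

Lemma expands_aeq v w c : expands v c -> expands w c -> aeq v w.
Proof.
move=> [hv Hv] [hw Hw]; have hvw := sqintB hv hw.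
suff : aeq (fun t => v t - w t) (fun=> 0).
  by apply: ae_circleS => t /eqP; rewrite subr_eq0 => /eqP.
apply: norm2_eq0 => //; apply/eqP; rewrite eq_le norm2_ge0 andbT.
apply/ler_addgt0Pr => e e0; rewrite add0r.
have e4 : 0 < e / 4 by rewrite divr_gt0.
have [N1 /(_ (maxn N1 _) (leq_maxl _ _))HN1] := Hv _ e4.
have [N2 /(_ (maxn N1 N2) (leq_maxr _ _))] := Hw _ e4.
have := HN1 N2; set N := maxn N1 N2 => H1 H2; have ht := sqint_trigp c 0 N.
have := norm2B_le (sqintB hv ht) (sqintB hw ht).
have -> : (fun t => v t - trigp c 0 N t - (w t - trigp c 0 N t)) = (fun t => v t - w t).
  by apply/funext => t; rewrite opprB addrA subrK.
by move=> /le_trans; apply; lra.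
Qed.

Definition sqsum a := cvgn (series (fun n => sqn (a n))).

Lemma sqsumP a : sqsum a <-> exists M, forall N, \sum_(0 <= n < N) sqn (a n) <= M.
Proof.
split=> [sa|[M HM]]; last by apply: (@nonneg_series_cvg _ _ M) => // n; exact: sqn_ge0.
exists (limn (series (fun n => sqn (a n)))) => N.
by apply: nonneg_series_le => // n; exact: sqn_ge0.
Qed.

Lemma hardyE f : hardy f <-> exists2 a, is_taylor a f & sqsum a.
Proof.
have E a : (fun n => Re `|a n| ^+ 2) = (fun n => sqn (a n)).
  by apply/funext => n; rewrite -cabs_sqr.
by split=> -[a af]; rewrite ?E => a2; exists a => //; rewrite E.
Qed.

Definition coef f (n : nat) : R[i] := ip (boundary f) (ecirc n).

Lemma taylor_coef a f : is_taylor a f -> sqsum a -> coef f =1 a.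
Proof. by move=> af a2 n; apply: expands_ip; exact: boundary_expands. Qed.

Lemma hardy_taylor f : hardy f -> is_taylor (coef f) f.
Proof. by move=> /hardyE[a af a2]; have /funext -> := taylor_coef af a2. Qed.

Lemma hardy_sqsum f : hardy f -> sqsum (coef f).
Proof. by move=> /hardyE[a af a2]; have /funext -> := taylor_coef af a2. Qed.

Lemma hardy_expands f : hardy f -> expands (boundary f) (coef f).
Proof.
by move=> hf; apply: boundary_expands; [exact: hardy_taylor|exact: hardy_sqsum].
Qed.

Lemma hardy_sqint f : hardy f -> sqint (boundary f).
Proof. by move=> /hardy_expands[]. Qed.

Lemma hardy_radial f : hardy f ->
  ae_circle (fun t => radial f t r @[r --> 1^'-] --> (boundary f t : R[i]^o)).
Proof.
by move=> /hardyE[a af a2]; move: (fatou_radial af a2); apply: ae_circleS => t.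
Qed.

Lemma coef_eq f g : hardy f -> hardy g -> coef f =1 coef g -> f = g.
Proof. by move=> hf hg; apply: taylor_eq; exact: hardy_taylor. Qed.

Lemma hardyD f g : hardy f -> hardy g -> hardy (f + g).
Proof.
move=> /hardyE[a af a2] /hardyE[b bg b2]; apply/hardyE; exists (fun n => a n + b n).
  exact: taylorD.
have /sqsumP[A HA] := a2; have /sqsumP[B HB] := b2.
apply/sqsumP; exists (2 * A + 2 * B) => N.
apply: (@le_trans _ _ (\sum_(0 <= n < N) (2 * sqn (a n) + 2 * sqn (b n)))).
  by apply: ler_sum => n _; exact: sqnD_le.
by rewrite big_split/= -!mulr_sumr lerD// ler_wpM2l.
Qed.

Lemma hardyZ (k : R[i]) f : hardy f -> hardy (k *: f).
Proof.
move=> /hardyE[a af a2]; apply/hardyE; exists (fun n => k * a n); first exact: taylorZ.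
have /sqsumP[A HA] := a2; apply/sqsumP; exists (sqn k * A) => N.
under eq_bigr do rewrite sqnM.
by rewrite -mulr_sumr ler_wpM2l ?sqn_ge0.
Qed.

Lemma boundaryD f g : hardy f -> hardy g ->
  aeq (boundary (f + g)) (fun t => boundary f t + boundary g t).
Proof.
move=> /hardy_radial hf /hardy_radial hg; move: hf hg; apply: ae_circleS2 => t.
move=> /ccvgP hf /ccvgP hg; apply: boundary_lim; apply/ccvgP.
have H : ccvg (1^'-) (fun r => radial f t r + radial g t r) (boundary f t + boundary g t).
  exact: ccvgD.
exact: H.
Qed.

Lemma boundaryZ (k : R[i]) f : hardy f ->
  aeq (boundary (k *: f)) (fun t => k * boundary f t).
Proof.
move=> /hardy_radial; apply: ae_circleS => t /ccvgP hf; apply: boundary_lim; apply/ccvgP.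
exact: (ccvgZ k hf).
Qed.

Lemma boundaryM f g : hardy f -> hardy g ->
  aeq (boundary (f * g)) (fun t => boundary f t * boundary g t).
Proof.
move=> /hardy_radial hf /hardy_radial hg; move: hf hg; apply: ae_circleS2 => t.
move=> /ccvgP hf /ccvgP hg; apply: boundary_lim; apply/ccvgP.
have H : ccvg (1^'-) (fun r => radial f t r * radial g t r) (boundary f t * boundary g t).
  exact: ccvgM.
exact: H.
Qed.

Lemma hardy_radial_norm f (r : R) : hardy f -> 0 <= r < 1 ->
  norm2 (fun t => radial f t r) <= norm2 (boundary f).
Proof.
move=> hf r01; have ft := hardy_taylor hf.
have Er := expands_norm2 (radial_expands ft r01).
apply: (cvgr_to_le Er); apply: nearW => N.
apply: le_trans (bessel N (hardy_sqint hf)); apply: ler_sum => n _.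
have /andP[r0 r1] := r01; have rn0 : 0 <= r ^+ n by exact: exprn_ge0.
rewrite sqnM sqn_real ler_piMr ?sqn_ge0// expr2 mulr_ile1//; exact: exprn_ile1 (ltW r1).
Qed.


(** Bessel's inequality at radius [r] bounds each finite sum of [sqn (a n) * r ^+ (2 * n)]; then [r]
    tends to 1 with the number of terms fixed. *)
Lemma radial_norm_sqsum a f (M : R) : is_taylor a f ->
  (forall r : R, 0 <= r < 1 -> norm2 (fun t => radial f t r) <= M) -> sqsum a.
Proof.
move=> af HM; apply/sqsumP; exists M => N.
have H : (\sum_(0 <= n < N) sqn (a n * (rseq R k ^+ n)%:C)) @[k --> \oo] -->
    (\sum_(0 <= n < N) sqn (a n * (1 ^+ n)%:C) : R).
  apply: (@cvg_big _ _ +%R) => [|n _]; first exact: add_continuous.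
  have Hn : rseq R k ^+ (n * 2) @[k --> \oo] --> (1 ^+ (n * 2) : R).
    apply: (@continuous_cvg _ _ _ _ _ (rseq R) (fun x => x ^+ (n * 2))).
      exact: exprn_continuous.
    exact: rseq_cvg1.
  have Hk : sqn (a n) * rseq R k ^+ (n * 2) @[k --> \oo] --> sqn (a n) * 1 ^+ (n * 2).
    by apply: cvgM => //; exact: cvg_cst.
  rewrite sqnM sqn_real -exprM; apply: eq_cvg_to Hk => k.
  by rewrite sqnM sqn_real exprM.
have -> : \sum_(0 <= n < N) sqn (a n) = \sum_(0 <= n < N) sqn (a n * (1 ^+ n)%:C).
  by apply: eq_bigr => n _; rewrite expr1n mulr1.
apply: (cvgr_to_le H); apply: nearW => k.
apply: le_trans (HM _ (rseq01 R k)); have E := radial_expands af (rseq01 R k).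
have := bessel N (proj1 E); under eq_bigr do rewrite (expands_ip _ E); exact.
Qed.

Definition bounded f := exists M : R, forall z, `|f z| <= M%:C.

Lemma taylor_bounded_hardy a f : is_taylor a f -> bounded f -> hardy f.
Proof.
move=> af [M HM]; apply/hardyE; exists a => //.
have M0 : 0 <= M by have := le_trans (normr_ge0 _) (HM (disk0 R)); rewrite lecR.
apply: (@radial_norm_sqsum _ _ (M ^+ 2 * norm2 (fun=> 1)) af) => r r01.
have fM t : cabs (radial f t r) <= M by rewrite cabs_le; exact: HM.
apply: norm2_le; [|by rewrite (_ : (fun=> 1) = ecirc 0); [exact: sqint_ecirc|apply/funext => t; rewrite ecirc0]|exact: sqr_ge0|].
  by case: (radial_expands af r01).
apply: ae_circleT => t; rewrite -!cabs_sqr cabs1 expr1n mulr1.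
by rewrite ler_pXn2r ?nnegrE ?cabs_ge0.
Qed.

(** The estimate is made on circles of radius below 1, where products are pointwise, so that nothing
    about the boundary values of [f * g] has to be known beforehand. *)
Lemma hardyM_bounded f g : hardy f -> bounded f -> hardy g -> hardy (f * g).
Proof.
move=> hf [M HM] hg; apply/hardyE; exists (convol (coef f) (coef g)).
  by apply: taylorM; exact: hardy_taylor.
have M0 : 0 <= M by have := le_trans (normr_ge0 _) (HM (disk0 R)); rewrite lecR.
have tfg := taylorM (hardy_taylor hf) (hardy_taylor hg).
apply: (@radial_norm_sqsum _ _ (M ^+ 2 * norm2 (boundary g)) tfg) => r r01.
apply: (@le_trans _ _ (M ^+ 2 * norm2 (fun t => radial g t r))); last first.
  by rewrite ler_wpM2l ?sqr_ge0// hardy_radial_norm.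
apply: norm2_le; [|by case: (radial_expands (hardy_taylor hg) r01)|exact: sqr_ge0|].
  by case: (radial_expands tfg r01).
have fM t : cabs (radial f t r) <= M by rewrite cabs_le; exact: HM.
apply: ae_circleT => t; rewrite sqnM ler_wpM2r ?sqn_ge0// -cabs_sqr.
by rewrite ler_pXn2r ?nnegrE ?cabs_ge0//; exact: (fM t).
Qed.

End HardyFunctions.

Section HardyHilbert.
Variable R : realType.
Implicit Types (u v w : R -> R[i]) (a b c : nat -> R[i]) (f g h : disk R -> R[i]).

Lemma ip_expands v w c : sqint v -> expands w c ->
  ccvg \oo (fun N => \sum_(0 <= k < N) ip v (ecirc k) * conjc (c k)) (ip v w).
Proof.
move=> hv [hw Hw]; apply/ccvgP/cvgC_cabs/cvgr0Pnorm_le => e e0.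
have v0 : 0 < norm2 v + 1 by rewrite ltr_wpDl ?norm2_ge0.
(* Tuned for the Cauchy-Schwarz inequality with [v]; adding 1 avoids a division by 0. *)
have [N0 HN] := Hw (e ^+ 2 / (norm2 v + 1)) (divr_gt0 (exprn_gt0 2 e0) v0).
exists N0 => // N /= NN; have ht := sqint_trigp c 0 N.
rewrite ger0_norm ?cabs_ge0// -(@ler_pXn2r _ 2) ?nnegrE ?cabs_ge0 ?(ltW e0)//.
have -> : \sum_(0 <= k < N) ip v (ecirc k) * conjc (c k) = ip v (trigp c 0 N).
  rewrite ipC// ip_trigp_l// rmorph_sum; apply: eq_bigr => k _.
  rewrite -[RHS]/(conjc (c k * ip (ecirc k) v)) conjM mulrC -ipC//; exact: sqint_ecirc.
rewrite cabsB -ipBr// cabs_sqr; apply: le_trans (ip_cauchy _ _) _ => //.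
  exact: sqintB.
apply: le_trans (ler_wpM2l (norm2_ge0 _) (HN _ NN)) _.
by rewrite mulrCA ler_piMr ?sqr_ge0// ler_pdivrMr// mul1r lerDl.
Qed.

Lemma ip_adj w u v :
  ip u (fun t => w t * v t) = ip (fun t => conjc (w t) * u t) v.
Proof.
rewrite !ip.unlock /L2_ip.
have -> // : (fun t => u t * conjc (w t * v t)) = (fun t => conjc (w t) * u t * conjc (v t)).
by apply/funext => t; rewrite conjM mulrA [conjc _ * _]mulrC.
Qed.

Lemma taylor0 : is_taylor (fun=> 0) (0 : disk R -> R[i]).
Proof.
move=> z; apply/ccvgP; have H : ccvg \oo (fun _ : nat => 0 : R[i]) 0 by exact: ccvg_cst.
by apply: eq_ccvg H => N; rewrite /series/= big1// => n _; exact: mul0r.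
Qed.

Lemma sqsum0 : sqsum (fun=> 0 : R[i]).
Proof. by apply/sqsumP; exists 0 => N; rewrite big1// => n _; exact: sqn0. Qed.

Lemma hardy0 : hardy (0 : disk R -> R[i]).
Proof. by apply/hardyE; exists (fun=> 0); [exact: taylor0|exact: sqsum0]. Qed.

Lemma coef0 n : coef (0 : disk R -> R[i]) n = 0.
Proof. exact: (taylor_coef taylor0 sqsum0). Qed.

End HardyHilbert.

(* Hardy functions as a module of their own, with sealed operations: conversion
   between functions with values in [R[i]] is prohibitively slow. *)
Record hfun (R : realType) := HFun { hval : disk R -> R[i]; hvalP : hardy hval }.

Section HfunModule.
Variable R : realType.
Implicit Types f g h : hfun R.

Lemma hval_inj : injective (@hval R).
Proof. by move=> [f hf] [g hg] /= fg; case: _ / fg hg => hg; congr HFun; exact: Prop_irrelevance. Qed.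

(* Choosing each operation as a whole from an opaque existence proof keeps
   unification from unfolding it. *)
Fact hfun0_subproof : {h : hfun R | forall z, hval h z = 0}.
Proof. by exists (HFun (hardy0 R)). Qed.

Fact hfunD_subproof : {op : hfun R -> hfun R -> hfun R |
  forall f g z, hval (op f g) z = hval f z + hval g z}.
Proof. by exists (fun f g => HFun (hardyD (hvalP f) (hvalP g))). Qed.

Fact hfunZ_subproof : {op : R[i] -> hfun R -> hfun R |
  forall k f z, hval (op k f) z = k * hval f z}.
Proof. by exists (fun k f => HFun (hardyZ k (hvalP f))). Qed.

Fact hfunM_subproof : {op : hfun R -> hfun R -> hfun R |
  forall f g, hardy (hval f \* hval g) -> hval (op f g) = hval f \* hval g}.
Proof.
have H (fg : hfun R * hfun R) : exists h,
    hardy (hval fg.1 \* hval fg.2) -> hval h = hval fg.1 \* hval fg.2.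
  have [K|K] := pselect (hardy (hval fg.1 \* hval fg.2)); first by exists (HFun K).
  by exists fg.1.
by have [op Hop] := choice H; exists (fun f g => op (f, g)) => f g; exact: (Hop (f, g)).
Qed.

Definition hfun0 := sval hfun0_subproof.
Definition hfunD := sval hfunD_subproof.
Definition hfunZ := sval hfunZ_subproof.

(* The junk value when the product is not a Hardy function is irrelevant. *)
Definition hmul := sval hfunM_subproof.

Lemma hfun_ext f g : (forall z, hval f z = hval g z) -> f = g.
Proof. by move=> fg; apply: hval_inj; apply/funext. Qed.

Fact hfunDE f g z : hval (hfunD f g) z = hval f z + hval g z.
Proof. exact: (svalP hfunD_subproof). Qed.

Fact hfunZE k f z : hval (hfunZ k f) z = k * hval f z.
Proof. exact: (svalP hfunZ_subproof). Qed.

Fact hfun0E z : hval hfun0 z = 0.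
Proof. exact: (svalP hfun0_subproof). Qed.

Fact hfunDA : associative hfunD.
Proof. by move=> f g h; apply: hfun_ext => z; rewrite !hfunDE addrA. Qed.

Fact hfunDC : commutative hfunD.
Proof. by move=> f g; apply: hfun_ext => z; rewrite !hfunDE addrC. Qed.

Fact hfun0D : left_id hfun0 hfunD.
Proof. by move=> f; apply: hfun_ext => z; rewrite hfunDE hfun0E add0r. Qed.

Fact hfunND : left_inverse hfun0 (hfunZ (-1)) hfunD.
Proof.
by move=> f; apply: hfun_ext => z; rewrite hfunDE hfun0E hfunZE mulN1r addNr.
Qed.

HB.instance Definition _ := gen_eqMixin (hfun R).
HB.instance Definition _ := gen_choiceMixin (hfun R).
HB.instance Definition _ := GRing.isZmodule.Build (hfun R) hfunDA hfunDC hfun0D hfunND.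

Lemma hvalD f g z : hval (f + g) z = hval f z + hval g z.
Proof. exact: hfunDE. Qed.

Lemma hval0 z : hval (0 : hfun R) z = 0.
Proof. exact: hfun0E. Qed.

Fact hfunZA a b f : hfunZ a (hfunZ b f) = hfunZ (a * b) f.
Proof. by apply: hfun_ext => z; rewrite !hfunZE mulrA. Qed.

Fact hfun1Z : left_id 1 hfunZ.
Proof. by move=> f; apply: hfun_ext => z; rewrite hfunZE mul1r. Qed.

Fact hfunZDr : right_distributive hfunZ +%R.
Proof.
by move=> a f g; apply: hfun_ext => z; rewrite hvalD !hfunZE hvalD mulrDr.
Qed.

Fact hfunZDl f : {morph hfunZ^~ f : a b / a + b}.
Proof. by move=> a b; apply: hfun_ext => z; rewrite hvalD !hfunZE mulrDl. Qed.

HB.instance Definition _ := GRing.Zmodule_isLmodule.Build R[i] (hfun R)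
  hfunZA hfun1Z hfunZDr hfunZDl.

Lemma hvalZ (k : R[i]) f z : hval (k *: f) z = k * hval f z.
Proof. exact: hfunZE. Qed.

Lemma hvalN f z : hval (- f) z = - hval f z.
Proof. by rewrite -scaleN1r hvalZ mulN1r. Qed.

Lemma hvalB f g z : hval (f - g) z = hval f z - hval g z.
Proof. by rewrite hvalD hvalN. Qed.

Lemma hval_sum (I : Type) (s : seq I) (P : pred I) (F : I -> hfun R) z :
  hval (\sum_(i <- s | P i) F i) z = \sum_(i <- s | P i) hval (F i) z.
Proof. by elim/big_rec2 : _ => [|i x y _ <-]; [exact: hval0|exact: hvalD]. Qed.

End HfunModule.

Section HfunHilbert.
Variable R : realType.
Implicit Types (v : R -> R[i]) (f g h : hfun R) (k : R[i]).

Definition bd f := boundary (hval f).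
Definition cf f (n : nat) : R[i] := ip (bd f) (ecirc n).
Definition hip f g : R[i] := ip (bd f) (bd g).
Definition hnorm f : R := norm2 (bd f).

Lemma bd_sqint f : sqint (bd f). Proof. exact: hardy_sqint (hvalP f). Qed.
Hint Resolve bd_sqint : core.

Lemma bd_expands f : expands (bd f) (cf f).
Proof. exact: hardy_expands (hvalP f). Qed.

Lemma cf_taylor f : is_taylor (cf f) (hval f).
Proof. exact: hardy_taylor (hvalP f). Qed.

Lemma cf_sqsum f : sqsum (cf f).
Proof. exact: hardy_sqsum (hvalP f). Qed.

Lemma cf_inj f g : cf f =1 cf g -> f = g.
Proof. by move=> fg; apply: hval_inj; exact: coef_eq (hvalP f) (hvalP g) fg. Qed.

Lemma hfun_of_taylor a F : is_taylor a F -> sqsum a ->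
  exists2 f, hval f = F & cf f =1 a.
Proof.
move=> aF a2; have hF : hardy F by apply/hardyE; exists a.
by exists (HFun hF) => //; exact: taylor_coef.
Qed.

Lemma hfun_of_coef a : sqsum a -> exists f, cf f =1 a.
Proof.
move=> a2; have [f _ fa] := hfun_of_taylor (power_sum_taylor (l2_abs_summable a2)) a2.
by exists f.
Qed.

Lemma bdD f g : aeq (bd (f + g)) (fun t => bd f t + bd g t).
Proof.
rewrite /bd (_ : hval (f + g) = hval f \+ hval g); first exact: boundaryD (hvalP f) (hvalP g).
by apply/funext => z; rewrite hvalD.
Qed.

Lemma bdZ k f : aeq (bd (k *: f)) (fun t => k * bd f t).
Proof.
rewrite /bd (_ : hval (k *: f) = fun z => k * hval f z); first exact: boundaryZ (hvalP f).
by apply/funext => z; rewrite hvalZ.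
Qed.

Lemma hipC f g : hip g f = conjc (hip f g).
Proof. by rewrite /hip ipC. Qed.

Lemma hipDl f g h : hip (f + g) h = hip f h + hip g h.
Proof. by rewrite /hip (ip_aeq (bdD f g) (aeq_refl _)) ipDl. Qed.

Lemma hipZl k f h : hip (k *: f) h = k * hip f h.
Proof. by rewrite /hip (ip_aeq (bdZ k f) (aeq_refl _)) ipZl. Qed.

Lemma hipNl f h : hip (- f) h = - hip f h.
Proof. by rewrite -scaleN1r hipZl mulN1r. Qed.

Lemma hipBl f g h : hip (f - g) h = hip f h - hip g h.
Proof. by rewrite hipDl hipNl. Qed.

Lemma hipDr f g h : hip h (f + g) = hip h f + hip h g.
Proof. by rewrite hipC hipDl conjD -!hipC. Qed.

Lemma hipZr k f h : hip h (k *: f) = conjc k * hip h f.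
Proof. by rewrite hipC hipZl conjM -hipC. Qed.

Lemma hipNr f h : hip h (- f) = - hip h f.
Proof. by rewrite hipC hipNl conjN -hipC. Qed.

Lemma hipBr f g h : hip h (f - g) = hip h f - hip h g.
Proof. by rewrite hipDr hipNr. Qed.

Lemma hip0l h : hip 0 h = 0. Proof. by rewrite -(scale0r 0) hipZl mul0r. Qed.

Lemma hip0r h : hip h 0 = 0. Proof. by rewrite hipC hip0l conjc0. Qed.

Lemma hip_suml (I : Type) (s : seq I) (P : pred I) (F : I -> hfun R) h :
  hip (\sum_(i <- s | P i) F i) h = \sum_(i <- s | P i) hip (F i) h.
Proof. by elim/big_rec2 : _ => [|i x y _ <-]; [exact: hip0l|exact: hipDl]. Qed.

Lemma hip_norm f : hip f f = (hnorm f)%:C. Proof. exact: ip_norm2. Qed.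

Lemma hnorm_ge0 f : 0 <= hnorm f. Proof. exact: norm2_ge0. Qed.

Lemma cf0 n : cf 0 n = 0.
Proof.
rewrite /cf /bd (_ : hval (0 : hfun R) = fun=> 0); first exact: coef0.
by apply/funext => z; rewrite hval0.
Qed.

Lemma hnorm_eq0 f : hnorm f = 0 -> f = 0.
Proof.
move=> f0; apply: cf_inj => n; rewrite cf0 /cf ip_eq0l//; exact: norm2_eq0.
Qed.

Lemma hip_eq0 f : hip f f = 0 -> f = 0.
Proof. by rewrite hip_norm => /complexI; exact: hnorm_eq0. Qed.

Lemma hip_inj f g : (forall h, hip f h = hip g h) -> f = g.
Proof.
move=> fg; apply/eqP; rewrite -subr_eq0; apply/eqP; apply: hip_eq0.
by rewrite hipBl fg subrr.
Qed.

Lemma hip_cauchy f g : sqn (hip f g) <= hnorm f * hnorm g.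
Proof. exact: ip_cauchy. Qed.

Lemma hip_parseval f g :
  ccvg \oo (fun N => \sum_(0 <= k < N) cf f k * conjc (cf g k)) (hip f g).
Proof. exact: ip_expands (bd_sqint f) (bd_expands g). Qed.

Lemma hnorm_parseval f : \sum_(0 <= k < N) sqn (cf f k) @[N --> \oo] --> hnorm f.
Proof. exact: expands_norm2 (bd_expands f). Qed.

Fact pplus_subproof : {op : (R -> R[i]) -> hfun R |
  forall v, sqint v -> forall n, cf (op v) n = ip v (ecirc n)}.
Proof.
have H v : exists h, sqint v -> forall n, cf h n = ip v (ecirc n).
  have [hv|nv] := pselect (sqint v); last by exists 0.
  have v2 : sqsum (fun n => ip v (ecirc n)).
    by apply/sqsumP; exists (norm2 v) => N; exact: bessel.
  by have [f fv] := hfun_of_coef v2; exists f.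
by have [op Hop] := choice H; exists op.
Qed.

(* The orthogonal projection of [L2] onto the Hardy space. *)
Definition pplus := sval pplus_subproof.

Lemma cf_pplus v n : sqint v -> cf (pplus v) n = ip v (ecirc n).
Proof. by move=> hv; exact: (svalP pplus_subproof). Qed.

Lemma ip_pplus v g : sqint v -> hip (pplus v) g = ip v (bd g).
Proof.
move=> hv; have /ccvgP H1 := hip_parseval (pplus v) g.
have /ccvgP H2 := ip_expands hv (bd_expands g).
apply: cvgC_unique H1 _; apply: eq_cvg_to H2 => N.
by apply: eq_bigr => n _; rewrite cf_pplus.
Qed.

End HfunHilbert.
#[global] Hint Resolve bd_sqint : core.

Section Monomials.
Variable R : realType.
Implicit Types (f g h : hfun R).

Lemma sqsum_delta n : sqsum (fun k => (k == n)%:R : R[i]).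
Proof.
apply/sqsumP; exists 1 => N; elim: N => [|N IH]; first by rewrite big_geq.
rewrite big_nat_recr//=; have [->|_] := eqVneq N n; last first.
  by rewrite -[sqn _]/(sqn 0) sqn0 addr0.
rewrite big_nat big1 ?add0r => [|k /andP[_ kn]].
  by rewrite /sqn/= expr1n expr0n addr0.
by rewrite ltn_eqF//; exact: sqn0.
Qed.

Fact mono_subproof : {op : nat -> hfun R |
  (forall n z, hval (op n) z = val z ^+ n) & forall n k, cf (op n) k = (k == n)%:R}.
Proof.
have H n : exists f, (forall z, hval f z = val z ^+ n) /\ forall k, cf f k = (k == n)%:R.
  have [f fE fc] := hfun_of_taylor (@taylorX R n) (@sqsum_delta n).
  by exists f; split=> // z; rewrite fE.
by have [op Hop] := choice H; exists op => n; case: (Hop n).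
Qed.

Definition mono : nat -> hfun R := s2val mono_subproof.

Lemma monoE n z : hval (mono n) z = val z ^+ n.
Proof. exact: (s2valP mono_subproof). Qed.

Lemma cf_mono n k : cf (mono n) k = (k == n)%:R.
Proof. exact: (s2valP' mono_subproof). Qed.

Lemma bd_mono n : aeq (bd (mono n)) (ecirc n).
Proof.
apply: (@expands_aeq _ _ _ (fun k => (k == n)%:R)).
  by have := bd_expands (mono n); have /funext -> := cf_mono n.
split; first exact: sqint_ecirc.
move=> e e0; exists n.+1 => N nN; rewrite (_ : (fun t => ecirc n t - trigp _ 0 N t) = (fun=> 0)).
  have H : norm2 (fun=> 0 : R[i]) = 0 :> R.
    by apply: complexI; rewrite -ip_norm2 ip_eq0l//; exact: aeq_refl.
  by rewrite H ltW.
apply/funext => t; rewrite /trigp (bigD1_seq n) ?mem_index_iota ?iota_uniq//=.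
rewrite eqxx mul1r big1 ?addr0 ?subrr// => k /negPf ->; exact: mul0r.
Qed.

Lemma cfE f n : cf f n = hip f (mono n).
Proof. exact: ip_aeq (aeq_refl _) (aeq_sym (bd_mono n)). Qed.

Lemma cfD f g n : cf (f + g) n = cf f n + cf g n.
Proof. by rewrite !cfE hipDl. Qed.

Lemma cfZ (k : R[i]) f n : cf (k *: f) n = k * cf f n.
Proof. by rewrite !cfE hipZl. Qed.

Lemma cfB f g n : cf (f - g) n = cf f n - cf g n.
Proof. by rewrite !cfE hipBl. Qed.

Lemma cf_sum (I : Type) (s : seq I) (P : pred I) (F : I -> hfun R) n :
  cf (\sum_(i <- s | P i) F i) n = \sum_(i <- s | P i) cf (F i) n.
Proof. by rewrite cfE hip_suml; apply: eq_bigr => i _; rewrite cfE. Qed.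

Definition trunc f N : hfun R := \sum_(0 <= n < N) cf f n *: mono n.

Lemma hnormB_trunc f N : hnorm (f - trunc f N) = hnorm f - \sum_(0 <= n < N) sqn (cf f n).
Proof.
apply: complexI; rewrite -hip_norm rmorphB/= -hip_norm rmorph_sum/=.
have H n : (n < N)%N -> cf (trunc f N) n = cf f n.
  move=> nN; rewrite cf_sum (bigD1_seq n) ?mem_index_iota ?iota_uniq//=.
  rewrite cfZ cf_mono eqxx mulr1 big1 ?addr0// => i ni.
  by rewrite cfZ cf_mono eq_sym (negPf ni) mulr0.
have E g : (forall n, (n < N)%N -> cf g n = cf f n) ->
    hip (trunc f N) g = \sum_(0 <= n < N) ((sqn (cf f n))%:C).
  move=> gf; rewrite hip_suml; apply: eq_big_nat => n /andP[_ nN].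
  by rewrite hipZl hipC -cfE gf// mulcJ.
rewrite hipBl !hipBr (E f)// (E _ H) subrr subr0 (hipC (trunc f N) f) (E f)//.
rewrite rmorph_sum; congr (_ - _); apply: eq_bigr => n _; exact: conj_real.
Qed.

Lemma trunc_cvg f e : 0 < e -> exists N, hnorm (f - trunc f N) <= e.
Proof.
move=> e0; have /cvgrPdist_le/(_ e e0)[N _ /(_ N (leqnn _))] := @hnorm_parseval R f.
by move=> H; exists N; rewrite hnormB_trunc; apply: le_trans H; exact: ler_norm.
Qed.

End Monomials.

(** * Inner functions *)

Notation "f ** g" := (hmul f g) (at level 40, left associativity).

Section InnerMultiplication.
Variable R : realType.
Local Notation mu := (@lebesgue_measure R).
Local Notation circle := (`[0, 2 * pi]%classic : set R).
Implicit Types (f g h theta chi : hfun R) (u v w : R -> R[i]).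

Definition bddf f := bounded (hval f).
Definition inn f := inner (hval f).

Lemma hmulE f g z : bddf f -> hval (f ** g) z = hval f z * hval g z.
Proof.
move=> bf; have H := hardyM_bounded (hvalP f) bf (hvalP g).
by rewrite (svalP (hfunM_subproof R) f g H).
Qed.

Lemma bdM f g : bddf f -> aeq (bd (f ** g)) (fun t => bd f t * bd g t).
Proof.
move=> bf; rewrite /bd (_ : hval (f ** g) = hval f \* hval g).
  exact: boundaryM (hvalP f) (hvalP g).
by apply/funext => z; rewrite (hmulE _ _ bf).
Qed.

Lemma bddfD f g : bddf f -> bddf g -> bddf (f + g).
Proof.
move=> [M HM] [N HN]; exists (M + N) => z; rewrite hvalD -cabs_le.
by apply: le_trans (cabsD _ _) (lerD _ _); rewrite cabs_le.
Qed.

Lemma bddfZ (k : R[i]) f : bddf f -> bddf (k *: f).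
Proof.
move=> [M HM]; exists (cabs k * M) => z; rewrite hvalZ -cabs_le cabsM.
by rewrite ler_wpM2l ?cabs_ge0// cabs_le.
Qed.

Lemma bddfM f g : bddf f -> bddf g -> bddf (f ** g).
Proof.
move=> bf [N HN]; have [M HM] := bf; exists (M * N) => z; rewrite (hmulE _ _ bf) -cabs_le cabsM.
by rewrite ler_pM ?cabs_ge0 ?cabs_le.
Qed.

Lemma bddf_mono n : bddf (mono R n).
Proof.
exists 1 => z; rewrite monoE -cabs_le cabsX exprn_ile1 ?cabs_ge0//.
exact: ltW (cabs_disk z).
Qed.
Hint Resolve bddf_mono : core.

Lemma hmulC f g : bddf f -> bddf g -> f ** g = g ** f.
Proof. by move=> bf bg; apply: hfun_ext => z; rewrite (hmulE _ _ bf) (hmulE _ _ bg) mulrC. Qed.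

Lemma hmulA f g h : bddf f -> bddf g -> f ** g ** h = f ** (g ** h).
Proof.
move=> bf bg; apply: hfun_ext => z; have bfg := bddfM bf bg.
by rewrite (hmulE _ _ bfg) !(hmulE _ _ bf) (hmulE _ _ bg) mulrA.
Qed.

Lemma hmulDr f g h : bddf f -> f ** (g + h) = f ** g + f ** h.
Proof. by move=> bf; apply: hfun_ext => z; rewrite hvalD !(hmulE _ _ bf) hvalD mulrDr. Qed.

Lemma hmulZr (k : R[i]) f g : bddf f -> f ** (k *: g) = k *: (f ** g).
Proof. by move=> bf; apply: hfun_ext => z; rewrite hvalZ !(hmulE _ _ bf) hvalZ mulrCA. Qed.

Lemma hmulBr f g h : bddf f -> f ** (g - h) = f ** g - f ** h.
Proof. by move=> bf; apply: hfun_ext => z; rewrite hvalB !(hmulE _ _ bf) hvalB mulrBr. Qed.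

Lemma hmul0r f : bddf f -> f ** 0 = 0.
Proof. by move=> bf; have := hmulZr 0 0 bf; rewrite !scale0r. Qed.

Lemma hmul_sumr (I : Type) (s : seq I) (P : pred I) (F : I -> hfun R) f : bddf f ->
  f ** (\sum_(i <- s | P i) F i) = \sum_(i <- s | P i) f ** F i.
Proof. by move=> bf; elim/big_rec2 : _ => [|i x y _ <-]; [exact: hmul0r|exact: hmulDr]. Qed.

Lemma hmul1l f : mono R 0 ** f = f.
Proof. by apply: hfun_ext => z; rewrite (hmulE _ _ (bddf_mono 0)) monoE expr0 mul1r. Qed.

Lemma hmul1r f : bddf f -> f ** mono R 0 = f.
Proof. by move=> bf; rewrite hmulC// hmul1l. Qed.

Lemma hmul_mono m n : mono R m ** mono R n = mono R (m + n).
Proof. by apply: hfun_ext => z; rewrite (hmulE _ _ (bddf_mono m)) !monoE exprD. Qed.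

Lemma unimod_aeq u v : aeq u v -> unimod u -> unimod v.
Proof.
move=> uv [w ww uw]; exists w => //.
by move: uv uw; apply: ae_circleS2 => t <-.
Qed.

(** An [L2] representative is replaced by 0 where its modulus exceeds 1, a null set. *)
Lemma sqint_clamp v : sqint v -> ae_circle (fun t => sqn (v t) <= 1) ->
  exists w, [/\ measC w, forall t, sqn (w t) <= 1 & aeq v w].
Proof.
move=> [w w2 vw] v1; have /L2P[mw _] := w2; have ms := measC_sqn mw; have [mr mi] := mw.
have mle : measurable_fun circle (fun t => sqn (w t) <= 1).
  by apply: measurable_fun_ler => //; exact: measurable_cst.
have mif (F : R -> R) : measurable_fun circle F ->
    measurable_fun circle (fun t => if sqn (w t) <= 1 then F t else 0).
  move=> mF; apply: (@measurable_fun_if _ _ _ _ _ _ circle (@measurable_circle R) _ mle).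
    exact: (measurable_funS (@measurable_circle R) _ mF).
  exact: measurable_cst.
exists (fun t => if sqn (w t) <= 1 then w t else 0); split.
- by split; [move: (mif _ mr)|move: (mif _ mi)]; apply: eq_measurable_fun => t _; case: ifP.
- by move=> t; case: ifP => // _; rewrite sqn0.
- by move: vw v1; apply: ae_circleS2 => t -> ->.
Qed.

Lemma sqint_unimod v : sqint v -> ae_circle (fun t => sqn (v t) = 1) -> unimod v.
Proof.
move=> hv v1; have [|w [mw w1 vw]] := sqint_clamp hv.
  by move: v1; apply: ae_circleS => t ->.
by exists w => //; move: vw v1; apply: ae_circleS2 => t -> ->.
Qed.

(** The function [1 - sqn v] is nonnegative almost everywhere and its integral is 0. *)
Lemma norm2_max_sqn1 v : sqint v -> ae_circle (fun t => sqn (v t) <= 1) ->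
  norm2 v = 1 -> ae_circle (fun t => sqn (v t) = 1).
Proof.
move=> hv v1; have [w [mw w1 vw]] := sqint_clamp hv v1.
rewrite (norm2_aeq vw) norm2.unlock => n1.
have mc := @measurable_circle R; have ms := measC_sqn mw.
have /L2P[_ iw] : L2 w by exact: (L2_bounded mw w1).
have i1 : mu.-integrable circle (EFin \o (fun=> 1 : R)).
  by apply: continuous_integrable; exact: continuous_cst_fun.
pose g t := 1 - sqn (w t).
have H0 : Rintegral mu circle g = 0.
  rewrite /g (@RintegralB _ _ _ mu circle _ _ mc i1 iw) Rintegral_cst_itv ?(ltW (twopi_gt0 R))//.
  rewrite subr0 mul1r; apply/eqP; rewrite subr_eq0; apply/eqP.
  have : 2 * pi * ((2 * pi)^-1 * Rintegral mu circle (fun t => sqn (w t))) = 2 * pi by rewrite n1 mulr1.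
  by rewrite mulVKf ?gt_eqF ?twopi_gt0// => ->.
have if_ : mu.-integrable circle (EFin \o g).
  by have := @integrableB _ _ _ mu circle mc _ _ i1 iw; exact: eq_integrable.
have := @ae_eq_integral_abs _ _ _ mu circle mc
  (EFin \o g) (measurable_int _ if_).
have -> : (\int[mu]_(t in circle) `|(EFin \o g) t| = 0)%E.
  have -> : (\int[mu]_(t in circle) `|(EFin \o g) t| =
      \int[mu]_(t in circle) (EFin \o g) t)%E.
    by apply: eq_integral => t _; rewrite /= ger0_norm// /g subr_ge0.
  by rewrite -[LHS]fineK ?[fine _]H0//; apply: integrable_fin_num.
move=> [/(_ erefl) H _]; apply: (ae_circleS2 _ vw H) => t -> /eqP.
by rewrite /= eqe /g subr_eq0 => /eqP <-.
Qed.

Lemma inn_bddf theta : inn theta -> bddf theta.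
Proof. by case. Qed.

Lemma inn_unimod theta : inn theta -> unimod (bd theta).
Proof.
move=> [_ _ H]; apply: sqint_unimod => //; move: H; apply: ae_circleS => t [_].
by move/norm_eq1.
Qed.

Lemma bddf_unimod_inn f : bddf f -> unimod (bd f) -> inn f.
Proof.
move=> bf [v _ fv]; split=> //; first by exists (cf f); exact: cf_taylor.
have := fatou_radial (@cf_taylor R f) (@cf_sqsum R f); move: fv; apply: ae_circleS2 => t [_ f1] c.
by split=> //; apply/norm_eq1.
Qed.

Lemma inn_mono n : inn (mono R n).
Proof.
by apply: bddf_unimod_inn => //; apply: unimod_aeq (@ecirc_unimod R n); exact/aeq_sym/bd_mono.
Qed.
Hint Resolve inn_mono : core.

Lemma innM theta chi : inn theta -> inn chi -> inn (theta ** chi).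
Proof.
move=> it ic; have bt := inn_bddf it; apply: bddf_unimod_inn; first exact: bddfM (inn_bddf ic).
apply: unimod_aeq (aeq_sym (bdM _ bt)) _.
by apply: unimodM; exact: inn_unimod.
Qed.

Lemma hip_inn theta f g : inn theta -> hip (theta ** f) (theta ** g) = hip f g.
Proof.
move=> it; have bt := inn_bddf it.
by rewrite /hip (ip_aeq (bdM _ bt) (bdM _ bt)) ip_unimod//; exact: inn_unimod.
Qed.

Lemma hmulI theta f g : inn theta -> theta ** f = theta ** g -> f = g.
Proof.
move=> it fg; apply/eqP; rewrite -subr_eq0; apply/eqP; apply: hip_eq0.
by rewrite -(hip_inn _ _ it) hmulBr ?fg ?subrr ?hip0l//; exact: inn_bddf.
Qed.

(** The Toeplitz operator whose symbol is the conjugate of [theta], that is the adjoint of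
    multiplication by [theta]. *)
Definition adj theta f : hfun R := pplus (fun t => conjc (bd theta t) * bd f t).

Lemma adjP theta f g : inn theta -> hip (adj theta f) g = hip f (theta ** g).
Proof.
move=> it; have ut := inn_unimod it; rewrite ip_pplus; last first.
  by apply: sqint_unimodM => //; exact: unimodJ.
by rewrite /hip (ip_aeq (aeq_refl _) (bdM g (inn_bddf it))) ip_adj.
Qed.

Lemma cf_adj theta f n : inn theta -> cf (adj theta f) n = hip f (theta ** mono R n).
Proof. by move=> it; rewrite cfE adjP. Qed.

Lemma adjD theta f g : inn theta -> adj theta (f + g) = adj theta f + adj theta g.
Proof. by move=> it; apply: hip_inj => h; rewrite hipDl !adjP// hipDl. Qed.

Lemma adj_scale (k : R[i]) theta f : inn theta -> adj theta (k *: f) = k *: adj theta f.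
Proof. by move=> it; apply: hip_inj => h; rewrite hipZl !adjP// hipZl. Qed.

Lemma adjB theta f g : inn theta -> adj theta (f - g) = adj theta f - adj theta g.
Proof. by move=> it; apply: hip_inj => h; rewrite hipBl !adjP// hipBl. Qed.

Lemma adj0 theta : inn theta -> adj theta 0 = 0.
Proof. by move=> it; have := adj_scale 0 0 it; rewrite !scale0r. Qed.

Lemma adjK theta f : inn theta -> adj theta (theta ** f) = f.
Proof. by move=> it; apply: hip_inj => h; rewrite adjP// hip_inn. Qed.

Lemma adjM theta chi f : inn theta -> inn chi ->
  adj (theta ** chi) f = adj chi (adj theta f).
Proof.
move=> it ic; apply: hip_inj => h; rewrite adjP; last exact: innM.
by rewrite !adjP// hmulA//; exact: inn_bddf.
Qed.

End InnerMultiplication.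
#[global] Hint Resolve bddf_mono inn_mono : core.

(** * Reproducing kernels *)

Section Evaluation.
Variable R : realType.
Implicit Types (f g h theta : hfun R) (z : disk R).

(** The Szego kernel at [z], introduced through its coefficients; its closed form is [hval_kz]. *)
Fact kz_subproof : {op : disk R -> hfun R |
  forall z n, cf (op z) n = conjc (val z) ^+ n}.
Proof.
have H z : exists f, forall n, cf f n = conjc (val z) ^+ n.
  apply: hfun_of_coef; apply/sqsumP; exists (1 - sqn (val z))^-1 => N.
  rewrite (eq_bigr (fun n => sqn (val z) ^+ n)) => [|n _].
    apply: sum_geometric_le; rewrite sqn_ge0/= -cabs_sqr.
    by rewrite exprn_ilt1 ?cabs_ge0 ?cabs_disk.
  by rewrite -!cabs_sqr cabsX cabsJ -!exprM mulnC.
by have [op Hop] := choice H; exists op.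
Qed.

Definition kz : disk R -> hfun R := sval kz_subproof.

Lemma cf_kz z n : cf (kz z) n = conjc (val z) ^+ n.
Proof. exact: (svalP kz_subproof). Qed.

Lemma hip_kz f z : hip f (kz z) = hval f z.
Proof.
have /ccvgP H := hip_parseval f (kz z); apply: cvgC_unique H _.
have := @cf_taylor R f z; apply: eq_cvg_to => N; apply: eq_bigr => n _.
by rewrite cf_kz -[in RHS]rmorphXn conjcK.
Qed.

Lemma hnorm_kz_gt0 z : 0 < hnorm (kz z).
Proof.
have : sqn (cf (kz z) 0) <= hnorm (kz z).
  have := @bessel _ (bd (kz z)) 1 (bd_sqint _); by rewrite big_nat1.
by rewrite cf_kz expr0 /sqn/= expr1n expr0n addr0; exact: lt_le_trans.
Qed.

Lemma hval_bound f z : sqn (hval f z) <= hnorm f * hnorm (kz z).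
Proof. by rewrite -hip_kz hip_cauchy. Qed.

End Evaluation.

(** * A characterization of inner functions by orthonormality *)

Section InnerCriterion.
Variable R : realType.
Implicit Types (f g h theta : hfun R) (z : disk R).

(** Multiplication by a power of the variable is isometric, so that only the difference of the
    exponents matters. *)
Lemma mono_orthonormal theta :
  (forall n, hip (mono R n ** theta) theta = (n == 0%N)%:R) ->
  forall m n, hip (mono R m ** theta) (mono R n ** theta) = (m == n)%:R.
Proof.
move=> H; have key m n : (m <= n)%N ->
    hip (mono R n ** theta) (mono R m ** theta) = (m == n)%:R.
  move=> mn; rewrite -{1}(subnKC mn) -hmul_mono hmulA// hip_inn// H.
  by rewrite subn_eq0 [in RHS]eqn_leq mn.
move=> m n; have [mn|/ltnW nm] := leqP m n; last by rewrite key// eq_sym.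
by rewrite hipC key//; case: (m == n); rewrite ?conjc1 ?conjc0.
Qed.

(* Evaluate [theta * q] at [z], for the truncations [q] of the kernel function of [z];
   [theta * q] and [q] have the same norm. *)
Lemma inner_criterion_bound theta z :
  (forall n, hip (mono R n ** theta) theta = (n == 0%N)%:R) -> sqn (hval theta z) <= 1.
Proof.
move=> /mono_orthonormal H; set K := hnorm (kz z).
pose s N := \sum_(0 <= n < N) sqn (val z) ^+ n.
pose F N := \sum_(0 <= n < N) conjc (val z) ^+ n *: (mono R n ** theta).
have zz n : conjc (val z) ^+ n * val z ^+ n = (sqn (val z) ^+ n)%:C.
  by rewrite -exprMn [_ * val z]mulrC mulcJ rmorphXn.
have conjz n : conjc (conjc (val z) ^+ n) = val z ^+ n by rewrite -rmorphXn conjcK.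
have FE N : hval (F N) z = (s N)%:C * hval theta z.
  rewrite hval_sum /s rmorph_sum mulr_suml; apply: eq_bigr => n _.
  by rewrite hvalZ (hmulE _ _ (@bddf_mono R n)) monoE mulrA zz.
have FF N : hnorm (F N) = s N.
  apply: complexI; rewrite -hip_norm hip_suml /s rmorph_sum; apply: eq_big_nat => n /andP[_ nN].
  rewrite hipZl hipC hip_suml (bigD1_seq n) ?mem_index_iota ?iota_uniq//=.
  rewrite hipZl H eqxx mulr1 big1 ?addr0 => [|m mn]; last first.
    by rewrite hipZl H (negPf mn) mulr0.
  by rewrite conjz zz.
have sK : s N @[N --> \oo] --> K.
  apply: eq_cvg_to (@hnorm_parseval R (kz z)) => N; apply: eq_bigr => n _.
  by rewrite cf_kz -!cabs_sqr cabsX cabsJ -!exprM mulnC.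
have sle N : s N.+1 * sqn (hval theta z) <= K.
  have s1 : 0 < s N.+1.
    rewrite /s big_nat_recl//= expr0 ltr_pwDl// sumr_ge0// => n _.
    by rewrite exprn_ge0 ?sqn_ge0.
  have := hval_bound (F N.+1) z; rewrite FE FF sqnM sqn_real expr2 -mulrA.
  by rewrite ler_pM2l.
have K0 : 0 < K := hnorm_kz_gt0 z.
have sK1 : s N.+1 * sqn (hval theta z) @[N --> \oo] --> K * sqn (hval theta z).
  by apply: cvgMr_tmp; move: sK; rewrite -(cvg_shiftS s).
have : K * sqn (hval theta z) <= K by apply: (cvgr_to_le sK1); apply: nearW.
by rewrite ger_pMr.
Qed.

(** The modulus is at most 1 on the disc, hence on the boundary, while the norm is 1: it must be 1
    almost everywhere. This applies to functions known through inner products only, such as the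
    generator in [beurling] and the quotients in [inn_factor]. *)
Lemma inner_criterion theta :
  (forall n, hip (mono R n ** theta) theta = (n == 0%N)%:R) -> inn theta.
Proof.
move=> H; have b z := inner_criterion_bound z H.
apply: bddf_unimod_inn.
  by exists 1 => z; rewrite -cabs_le -(@ler_pXn2r _ 2) ?nnegrE ?cabs_ge0// cabs_sqr expr1n.
apply: sqint_unimod => //; apply: norm2_max_sqn1 => //; last first.
  by apply: complexI; have := H 0%N; rewrite hmul1l hip_norm.
have := fatou_radial (@cf_taylor R theta) (@cf_sqsum R theta); apply: ae_circleS => t c.
have /ccvgP[cr ci] := boundary_cvg c.
have cs : (Re (radial (hval theta) t r) * Re (radial (hval theta) t r) +
    Im (radial (hval theta) t r) * Im (radial (hval theta) t r)) @[r --> 1^'-] -->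
    Re (bd theta t) * Re (bd theta t) + Im (bd theta t) * Im (bd theta t).
  by apply: cvgD; apply: cvgM.
rewrite /sqn !expr2; apply: (cvgr_to_le cs); apply: nearW => r.
by rewrite -!expr2; exact: b.
Qed.

(** Unimodular boundary values make the products of [theta] with the monomials orthonormal, and the
    criterion then supplies the bound inside the disc. *)
Lemma unimod_inn theta : unimod (bd theta) -> inn theta.
Proof.
move=> ut; apply: inner_criterion => n.
have b : aeq (bd (mono R n ** theta)) (fun t => bd theta t * bd (mono R n) t).
  apply: aeq_trans (bdM theta (@bddf_mono R n)) _.
  by apply: ae_circleT => t; rewrite mulrC.
have b' : aeq (bd theta) (fun t => bd theta t * bd (mono R 0) t).
  apply: aeq_sym; apply: (ae_circleS _ (@bd_mono R 0)) => t ->.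
  by rewrite ecirc0 mulr1.
rewrite /hip (ip_aeq b b') ip_unimod// -/(hip _ _) -cfE cf_mono eq_sym.
by [].
Qed.

End InnerCriterion.

(** * Coburn's lemma and Beurling's theorem *)

Section Coburn.
Variable R : realType.
Implicit Types (f g h k psi : hfun R) (v : R -> R[i]).

Lemma conjB (x y : R[i]) : conjc (x - y) = conjc x - conjc y.
Proof. by rewrite conjD conjN. Qed.

Lemma kz0 : kz (disk0 R) = mono R 0.
Proof.
apply: cf_inj => n; rewrite cf_kz cf_mono -[val _]/(0 : R[i]) conjc0 expr0n.
by [].
Qed.

Lemma cf_at0 f : cf f 0 = hval f (disk0 R).
Proof. by rewrite -hip_kz kz0 cfE. Qed.

Lemma cf_monoM j f n : cf (mono R j ** f) n = if (j <= n)%N then cf f (n - j) else 0.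
Proof.
have [jn|nj] := leqP j n.
  by rewrite !cfE -[in LHS](subnKC jn) -hmul_mono hip_inn.
(* Cancelling [z^n] leaves the value at 0 of [z^(j - n) f], where [n < j]. *)
rewrite cfE -[n]addn0 -hmul_mono -(subnKC (ltnW nj)) -hmul_mono hmulA// hip_inn//.
rewrite -cfE cf_at0 (hmulE _ _ (@bddf_mono R _)) monoE -[val _]/(0 : R[i]) expr0n.
by rewrite subn_eq0 leqNgt nj mul0r.
Qed.

Lemma cf_adj_mono j f n : cf (adj (mono R j) f) n = cf f (j + n).
Proof. by rewrite cf_adj// hmul_mono cfE. Qed.

Lemma bd0 : aeq (bd (0 : hfun R)) (fun=> 0).
Proof.
apply: norm2_eq0 => //; apply: complexI; by rewrite -/(hnorm _) -hip_norm hip0l.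
Qed.

Lemma bd_poly (c : nat -> R[i]) N :
  aeq (bd (\sum_(0 <= i < N) c i *: mono R i)) (trigp c 0 N).
Proof.
elim: N => [|N IH].
  rewrite big_geq//; apply: aeq_trans bd0 _.
  by apply: ae_circleT => t; rewrite /trigp big_geq.
rewrite big_nat_recr//=; apply: aeq_trans (bdD _ _) _.
apply: (ae_circleS3 _ IH (bdZ (c N) (mono R N)) (@bd_mono R N)) => t -> -> ->.
by rewrite /trigp big_nat_recr.
Qed.

(** The Hardy space is closed: [v - P v] is orthogonal to [P v - g], so by Pythagoras it is no
    longer than [v - g] for any [g]. *)
Lemma pplus_approx v : sqint v ->
  (forall e : R, 0 < e -> exists g : hfun R, norm2 (fun t => v t - bd g t) <= e) ->
  aeq v (bd (pplus v)).
Proof.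
move=> hv H; set P := pplus v.
have hvP : sqint (fun t => v t - bd P t) by exact: sqintB.
suff : aeq (fun t => v t - bd P t) (fun=> 0).
  by apply: ae_circleS => t /eqP; rewrite subr_eq0 => /eqP.
apply: norm2_eq0 => //; apply/eqP; rewrite eq_le norm2_ge0 andbT.
apply/ler_addgt0Pr => e e0; rewrite add0r; have [g] := H e e0; apply: le_trans.
have bPg : aeq (bd (P - g)) (fun t => bd P t - bd g t).
  apply: aeq_trans (bdD _ _) _; rewrite -scaleN1r.
  by apply: (ae_circleS _ (bdZ (-1) g)) => t ->; rewrite mulN1r.
have -> : norm2 (fun t => v t - bd g t) = norm2 (fun t => (v t - bd P t) + bd (P - g) t).
  apply: norm2_aeq; apply: (ae_circleS _ bPg) => t ->.
  by rewrite addrA subrK.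
rewrite [leRHS]norm2D// ipBl// -ip_pplus// -/(hip _ _) subrr mulr0 addr0.
by rewrite lerDl norm2_ge0.
Qed.

(* [C_psi f = e_1^* psi f^*] on the circle: the conjugation of the model space. *)
Definition conjW psi f (t : R) : R[i] := conjc (ecirc 1 t) * bd psi t * conjc (bd f t).

Lemma unimod_conjW psi : inn psi -> unimod (fun t => conjc (ecirc 1 t) * bd psi t).
Proof.
move=> ip_; apply: unimodM; last exact: inn_unimod.
exact/unimodJ/ecirc_unimod.
Qed.

Lemma sqint_conjW psi f : inn psi -> sqint (conjW psi f).
Proof.
by move=> ip_; apply: sqint_unimodM (sqintJ (bd_sqint f)); exact: unimod_conjW.
Qed.

Lemma norm2_conjW psi f : inn psi -> norm2 (conjW psi f) = hnorm f.
Proof.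
move=> ip_; apply: complexI; rewrite -ip_norm2 ip_unimod; last exact: unimod_conjW.
rewrite ip_norm2 /hnorm; congr (_ %:C); rewrite !norm2.unlock; congr (_ * Rintegral _ _ _).
by apply/funext => t; rewrite sqnJ.
Qed.

Lemma conjWD psi f g :
  aeq (conjW psi (f + g)) (fun t => conjW psi f t + conjW psi g t).
Proof. by apply: (ae_circleS _ (bdD f g)) => t; rewrite /conjW => ->; rewrite conjD mulrDr. Qed.

Lemma conjWZ (c : R[i]) psi f : aeq (conjW psi (c *: f)) (fun t => conjc c * conjW psi f t).
Proof. by apply: (ae_circleS _ (bdZ c f)) => t; rewrite /conjW => ->; rewrite conjM mulrCA. Qed.

Definition conj_analytic psi f := exists g, aeq (conjW psi f) (bd g).

Lemma conj_analyticD psi f g :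
  conj_analytic psi f -> conj_analytic psi g -> conj_analytic psi (f + g).
Proof.
move=> [f' ff'] [g' gg']; exists (f' + g'); apply: aeq_trans (conjWD _ _ _) _.
apply: (ae_circleS3 _ ff' gg' (bdD f' g')) => t -> -> ->.
by [].
Qed.

Lemma conj_analyticZ (c : R[i]) psi f : conj_analytic psi f -> conj_analytic psi (c *: f).
Proof.
move=> [f' ff']; exists (conjc c *: f'); apply: aeq_trans (conjWZ _ _ _) _.
by apply: (ae_circleS2 _ ff' (bdZ (conjc c) f')) => t -> ->.
Qed.

Lemma adj_inn_mono psi n : inn psi ->
  adj psi (mono R n) = \sum_(0 <= j < n.+1) conjc (cf psi (n - j)) *: mono R j.
Proof.
move=> ip_; apply: cf_inj => m.
rewrite cf_adj// cf_sum hipC -cfE hmulC//; last exact: inn_bddf.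
rewrite cf_monoM; have [mn|nm] := leqP m n.
  rewrite (bigD1_seq m) ?mem_index_iota ?iota_uniq//= cfZ cf_mono eqxx mulr1.
  by rewrite big1 ?addr0// => j jm; rewrite cfZ cf_mono eq_sym (negPf jm) mulr0.
rewrite conjc0 big_nat big1// => j /andP[_ jn]; rewrite cfZ cf_mono gtn_eqF ?mulr0//.
exact: leq_trans jn nm.
Qed.

Lemma trunc_adj_mono f n : f = mono R n ** adj (mono R n) f + trunc f n.
Proof.
apply: cf_inj => m; rewrite cfD cf_monoM cf_sum; have [nm|mn] := leqP n m.
  rewrite cf_adj_mono subnKC// big_nat big1 ?addr0// => j /andP[_ jn].
  by rewrite cfZ cf_mono gtn_eqF ?mulr0//; exact: leq_trans jn nm.
rewrite add0r (bigD1_seq m) ?mem_index_iota ?iota_uniq//= cfZ cf_mono eqxx mulr1.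
by rewrite big1 ?addr0// => j jm; rewrite cfZ cf_mono eq_sym (negPf jm) mulr0.
Qed.

Lemma ecirc_mulJ_sub i n (t : R) : (i <= n)%N ->
  ecirc i t * conjc (ecirc n t) = conjc (ecirc (n - i) t).
Proof.
move=> le_in; rewrite -{1}(subnKC le_in) -ecircM conjM mulrA ecirc_mulJ.
by rewrite mul1r.
Qed.

(** On the circle, with [q = adj psi z^n], the conjugate is [conj(e_1)] times
    [psi conj(e_n) - conj(q)]. Here [e_n conj(q)] is the Taylor polynomial of degree [n] of [psi],
    so the difference is [conj(e_n) e_(n+1) g] and the exponentials cancel. *)
Lemma conj_analytic_mono psi n : inn psi ->
  conj_analytic psi (mono R n - psi ** adj psi (mono R n)).
Proof.
move=> ip_; exists (adj (mono R n.+1) psi); set g := adj _ psi; set q := adj psi _.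
have bpsi := inn_bddf ip_.
have H1 : aeq (bd psi) (fun t => ecirc n.+1 t * bd g t + trigp (cf psi) 0 n.+1 t).
  rewrite {1}(trunc_adj_mono psi n.+1); apply: aeq_trans (bdD _ _) _.
  apply: (ae_circleS3 _ (bdM g (@bddf_mono R n.+1)) (@bd_mono R n.+1) (bd_poly (cf psi) n.+1)).
  by move=> t -> -> ->.
have H2 : aeq (bd q) (trigp (fun j => conjc (cf psi (n - j))) 0 n.+1).
  by rewrite /q adj_inn_mono//; exact: bd_poly.
have H3 : aeq (bd (mono R n - psi ** q)) (fun t => ecirc n t - bd psi t * bd q t).
  apply: aeq_trans (bdD _ _) _; rewrite -scaleN1r.
  apply: (ae_circleS3 _ (bdZ (-1) (psi ** q)) (@bd_mono R n) (bdM q bpsi)) => t -> -> ->.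
  by rewrite mulN1r.
have [w _ u1] := inn_unimod ip_.
have H4 : aeq (conjW psi (mono R n - psi ** q))
    (fun t => conjc (ecirc 1 t) * (bd psi t * conjc (ecirc n t) - conjc (bd q t))).
  apply: (ae_circleS2 _ H3 u1) => t; rewrite /conjW => -> [_ s1].
  rewrite conjB conjM -mulrA mulrBr mulrA mulcJ s1.
  by rewrite mul1r.
apply: aeq_trans H4 _; apply: (ae_circleS2 _ H1 H2) => t -> ->.
have E : trigp (cf psi) 0 n.+1 t * conjc (ecirc n t) =
    conjc (trigp (fun j => conjc (cf psi (n - j))) 0 n.+1 t).
  rewrite /trigp mulr_suml rmorph_sum big_nat_rev/= add0n.
  apply: eq_big_nat => i /andP[_ lin]; rewrite subSS -mulrA ecirc_mulJ_sub ?leq_subr//.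
  rewrite subKn// -[RHS]/(conjc (conjc (cf psi (n - i)) * ecirc i t)) conjM conjcK.
  by [].
have K (a b c d x : R[i]) : b * a = 1 -> c * d = 1 -> a * (b * c * x * d) = x.
  move=> ba cd; transitivity (b * a * (c * d) * x); last by rewrite ba cd !mul1r.
  by ring.
rewrite mulrDl E addrK -(add1n n) -ecircM; apply: K; exact: ecirc_mulJ.
Qed.

Lemma hnorm_adj psi f : inn psi ->
  hnorm f = hnorm (f - psi ** adj psi f) + hnorm (adj psi f).
Proof.
move=> ip_; apply: complexI; rewrite rmorphD/= -!hip_norm hipBl !hipBr hip_inn//.
have E : hip f (psi ** adj psi f) = (hnorm (adj psi f))%:C by rewrite -adjP// hip_norm.
rewrite (hipC f (psi ** _)) E conj_real (hip_norm (adj _ _)).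
by rewrite subrr subr0 subrK.
Qed.

(* On the projections of the monomials the conjugates are iterated backward shifts of
   [psi], and these projections span a dense subspace of the model space. *)
Lemma inn_conj_analytic psi f : inn psi -> adj psi f = 0 -> conj_analytic psi f.
Proof.
move=> ip_ f0; exists (pplus (conjW psi f)).
apply: pplus_approx => [|e e0]; first exact: sqint_conjW.
have [N HN] := trunc_cvg f e0.
pose G n := mono R n - psi ** adj psi (mono R n).
pose F := \sum_(0 <= n < N) cf f n *: G n.
have [g Fg] : conj_analytic psi F.
  rewrite /F; elim: N {HN F} => [|N IH].
    rewrite big_geq//; exists 0; apply: (ae_circleS _ bd0) => t e_.
    by rewrite /conjW e_ conjc0 mulr0.
  rewrite big_nat_recr//=; apply: conj_analyticD => //; apply: conj_analyticZ.
  exact: conj_analytic_mono.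
have bpsi := inn_bddf ip_.
(* Since [f] is in the model space, [f - F] is the projection onto it of the remainder of [f], hence
   no longer than that remainder. *)
have FE : f - F = (f - trunc f N) - psi ** adj psi (f - trunc f N).
  have -> : F = trunc f N - psi ** adj psi (trunc f N).
    rewrite /F /trunc; elim: (N) => [|M IH]; first by rewrite !big_geq// adj0// hmul0r// subr0.
    rewrite !big_nat_recr//= IH adjD// adj_scale// hmulDr// hmulZr// /G scalerBr.
    by rewrite opprD !addrA; congr (_ - _); rewrite addrAC.
  rewrite adjB// f0 sub0r -scaleN1r hmulZr// scaleN1r opprK opprB.
  by rewrite addrA addrAC.
exists g; apply: le_trans HN.
have -> : norm2 (fun t => conjW psi f t - bd g t) = hnorm (f - F).
  rewrite -(norm2_conjW (f - F) ip_); apply: norm2_aeq.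
  rewrite -[f - F]/(f + - F) -scaleN1r.
  apply: (ae_circleS3 _ Fg (conjWD psi f (-1 *: F)) (conjWZ (-1) psi F)) => t <- -> ->.
  by rewrite conjN conjc1 mulN1r.
by rewrite FE [leRHS](hnorm_adj _ ip_) lerDl hnorm_ge0.
Qed.

(** The left side is the Fourier coefficient of order [m] of [f k], written as an inner product
    because [f k] need not be square-integrable. The coefficients of the second factor vanish beyond
    [m], which makes Parseval's series a finite sum. *)
Lemma ip_mulJ f k m :
  ip (bd f) (fun t => conjc (bd k t) * ecirc m t) = convol (cf f) (cf k) m.
Proof.
set v := fun t => _; have hv : sqint v.
  have -> : v = fun t => ecirc m t * conjc (bd k t) by apply/funext => t; rewrite /v mulrC.
  by apply: sqint_unimodM; [exact: ecirc_unimod|exact: sqintJ].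
have vE i : ip v (ecirc i) = conjc (if (i <= m)%N then cf k (m - i) else 0).
  rewrite -cf_monoM cfE hipC conjcK /hip.
  rewrite (ip_aeq (@bd_mono R m) (bdM k (@bddf_mono R i))).
  rewrite !ip.unlock /L2_ip; congr (_ * _); apply: Cintegral_aeq.
  apply: (ae_circleS _ (@bd_mono R i)) => t ->.
  by rewrite /v conjM [conjc (ecirc i t) * _]mulrC mulrA [_ * conjc (bd k t)]mulrC.
rewrite ipC// -[RHS]conjcK; congr conjc.
have /ccvgP H := ip_expands hv (bd_expands f); apply: cvgC_unique H _.
apply/ccvgP; apply/ccvgP/cvgC_cabs; apply: cvg_near_cst; near=> N.
have mN : (m.+1 <= N)%N by near: N; exact: nbhs_infty_gt.
apply/eqP; rewrite cabs_eq0 subr_eq0; apply/eqP.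
rewrite (big_cat_nat (n := m.+1))//=.
have -> : \sum_(m.+1 <= i < N) ip v (ecirc i) * conjc (cf f i) = 0.
  by rewrite big_nat big1// => i /andP[mi _]; rewrite vE leqNgt mi conjc0 mul0r.
rewrite addr0 /convol rmorph_sum; apply: eq_big_nat => i /andP[_ im].
rewrite vE -ltnS im -conjM mulrC.
by [].
Unshelve. all: by end_near. Qed.

Lemma hfun_mul_eq0 f k : (forall m, convol (cf f) (cf k) m = 0) -> f = 0 \/ k = 0.
Proof.
by move=> /convol_eq0[H|H]; [left|right]; apply: cf_inj => n; rewrite H cf0.
Qed.

(* [psi1 psi2^* h^* = e_1 g] for some [g] in the Hardy space, and the coefficients of
   [g k] are inner products of [psi1 k] with elements of [psi2 H^2]. *)
Lemma coburn psi1 psi2 h k : inn psi1 -> inn psi2 ->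
  adj psi1 (psi2 ** h) = 0 -> adj psi2 (psi1 ** k) = 0 -> h = 0 \/ k = 0.
Proof.
move=> i1 i2 h0 k0; have [g hg] := inn_conj_analytic i1 h0.
have [b1 b2] := (inn_bddf i1, inn_bddf i2).
have [] := @hfun_mul_eq0 g k; [|move=> g0|by right].
  move=> m; rewrite -ip_mulJ -(ip_aeq hg (aeq_refl _)).
  transitivity (hip (psi1 ** k) (psi2 ** (mono R m.+1 ** h))).
    rewrite /hip (ip_aeq (bdM k b1) (bdM _ b2)) !ip.unlock /L2_ip; congr (_ * _).
    apply: Cintegral_aeq; apply: (ae_circleS3 _ (bdM h b2) (bdM h (@bddf_mono R m.+1)) (@bd_mono R m.+1)).
    move=> t E1 E2 E3; rewrite /conjW E1 E2 E3 -(ecircM 1 m t) !conjM !conjcK.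
    by ring.
  by rewrite -adjP// k0 hip0l.
(* With [g = 0] the conjugate of [psi2 ** h] vanishes; conjugation and multiplication by [psi2] both
   preserve the norm. *)
left; apply: hnorm_eq0; apply: complexI; rewrite -hip_norm -(hip_inn h h i2) hip_norm.
rewrite -(norm2_conjW _ i1) (norm2_aeq hg) g0 -/(hnorm _) -hip_norm hip0l.
by [].
Qed.

End Coburn.

(** * Completeness and projection onto an orthogonal complement *)

Section Projection.
Variable R : realType.
Implicit Types (f g h x y : hfun R).

Lemma harmonic_le0 (x C : R) : (forall k : nat, x <= C * k.+1%:R^-1) -> x <= 0.
Proof.
move=> H; have cv : (C * k.+1%:R^-1) @[k --> \oo] --> (C * 0 : R).
  by apply: cvgM; [exact: cvg_cst|exact: cvg_harmonic].
by rewrite mulr0 in cv; apply: (cvgr_to_ge cv); exact: nearW.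
Qed.

Lemma real_seq_complete (w : nat -> R) :
  (forall k l, (w k - w l) ^+ 2 <= k.+1%:R^-1 + l.+1%:R^-1) -> cvgn w.
Proof.
move=> H; apply: cauchy_cvg; apply: cauchy_exP => e e0.
have e2 : 0 < e ^+ 2 / 2 by rewrite divr_gt0// exprn_gt0.
have /cvgrPdist_lt/(_ _ e2)[k _ /(_ k (leqnn k))] := @cvg_harmonic R.
rewrite /= sub0r normrN ger0_norm ?invr_ge0// => Hk.
exists (w k); exists k => // l /= kl.
rewrite /ball/= -(@ltr_pXn2r _ 2) ?nnegrE ?(ltW e0)// real_normK ?num_real//.
apply: le_lt_trans (H k l) _; apply: (@le_lt_trans _ _ (k.+1%:R^-1 + k.+1%:R^-1)).
  by rewrite lerD2l lef_pV2 ?posrE// ler_nat ltnS.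
by rewrite [ltRHS]splitr ltrD.
Qed.

(** Limits are taken coefficient by coefficient, then the bound on finite sums of squares passes to
    the limit. The rate is the one met by minimizing sequences. *)
Lemma hfun_complete (u : nat -> hfun R) :
  (forall k l, hnorm (u k - u l) <= k.+1%:R^-1 + l.+1%:R^-1) ->
  exists y, forall k, hnorm (u k - y) <= k.+1%:R^-1.
Proof.
move=> H.
have bnd k l n : sqn (cf (u k) n - cf (u l) n) <= k.+1%:R^-1 + l.+1%:R^-1.
  apply: le_trans (H k l); rewrite -cfB.
  apply: le_trans (bessel n.+1 (bd_sqint (u k - u l))).
  by rewrite big_nat_recr//= lerDr sumr_ge0// => i _; exact: sqn_ge0.
have /choice[c Hc] n : exists l, ccvg \oo (fun k => cf (u k) n) l.
  have cr : cvgn (fun k => Re (cf (u k) n)).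
    apply: real_seq_complete => k l; apply: le_trans (bnd k l n).
    by rewrite /sqn ReD ReN lerDl sqr_ge0.
  have ci : cvgn (fun k => Im (cf (u k) n)).
    apply: real_seq_complete => k l; apply: le_trans (bnd k l n).
    by rewrite /sqn ImD ImN lerDr sqr_ge0.
  by exists (limn (fun k => Re (cf (u k) n)) +i* limn (fun k => Im (cf (u k) n))); split.
have lim k N : \sum_(0 <= n < N) sqn (cf (u k) n - c n) <= k.+1%:R^-1.
  have H1 : (\sum_(0 <= n < N) sqn (cf (u k) n - cf (u l) n)) @[l --> \oo] -->
      \sum_(0 <= n < N) sqn (cf (u k) n - c n).
    apply: (@cvg_big _ _ +%R) => [|n _]; first exact: add_continuous.
    have [cr ci] := Hc n; rewrite /sqn !ReD !ImD !ReN !ImN.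
    under eq_fun do rewrite !ReD !ImD !ReN !ImN !expr2.
    rewrite !expr2; apply: cvgD; apply: cvgM; apply: cvgB => //; exact: cvg_cst.
  have H2 : (k.+1%:R^-1 + l.+1%:R^-1) @[l --> \oo] --> (k.+1%:R^-1 + 0 : R).
    by apply: cvgD; [exact: cvg_cst|exact: cvg_harmonic].
  rewrite addr0 in H2; apply: (ler_cvg_to H1 H2); apply: nearW => l.
  apply: le_trans (H k l); apply: le_trans (bessel N (bd_sqint (u k - u l))).
  by apply: ler_sum => n _; rewrite -/(cf _ _) cfB.
(* The limit is reached through its difference with [u 0], whose coefficients are square-summable by
   the case [k = 0] of [lim]. *)
have [h hE] : exists h, cf h =1 (fun n => cf (u 0%N) n - c n).
  by apply: hfun_of_coef; apply/sqsumP; exists 1^-1; exact: (lim 0%N).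
exists (u 0%N - h) => k; apply: (cvgr_to_le (@hnorm_parseval R (u k - (u 0%N - h)))).
apply: nearW => N; apply: le_trans (lim k N); apply: ler_sum => n _.
by rewrite cfB (cfB (u 0%N)) hE subKr.
Qed.

Variable N : hfun R -> Prop.
(** As an orthogonal complement, [M] is a subspace that is closed by the Cauchy-Schwarz
    inequality. *)
Let M g := forall f, N f -> hip g f = 0.

Lemma perpD g h : M g -> M h -> M (g + h).
Proof. by move=> Mg Mh f Nf; rewrite hipDl Mg// Mh// addr0. Qed.

Lemma perpZ (c : R[i]) g : M g -> M (c *: g).
Proof. by move=> Mg f Nf; rewrite hipZl Mg// mulr0. Qed.

Lemma hnormD f g : hnorm (f + g) = hnorm f + hnorm g + 2 * Re (hip f g).
Proof.
have -> : hnorm (f + g) = norm2 (fun t => bd f t + bd g t) by apply: norm2_aeq; exact: bdD.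
by rewrite norm2D// addrAC.
Qed.

Lemma hnormZ (c : R[i]) f : hnorm (c *: f) = sqn c * hnorm f.
Proof. by rewrite /hnorm (norm2_aeq (bdZ c f)) norm2Z. Qed.

Lemma hnormN f : hnorm (- f) = hnorm f.
Proof.
rewrite -scaleN1r hnormZ /sqn/= oppr0 expr0n addr0 sqrrN expr1n.
by rewrite mul1r.
Qed.

(** The parallelogram law makes a minimizing sequence of the distance from [x] to [M] converge;
    orthogonality is obtained along the sequence by a variation in the direction [g]. *)
Lemma perp_projection x : exists2 y, M y & forall g, M g -> hip (x - y) g = 0.
Proof.
pose E : set R := [set hnorm (x - m) | m in [set m | M m]].
have E0 : has_inf E.
  split; last by exists 0 => _ [m _ <-]; exact: hnorm_ge0.
  by exists (hnorm (x - 0)), 0 => //= f _; exact: hip0l.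
pose d := inf E.
have dle m : M m -> d <= hnorm (x - m).
  by move=> Mm; apply: ge_inf; [case: E0|exists m].
(* Excesses [s] and [t] over the infimum give a squared distance at most [2 s + 2 t], which is
   within the rate asked by [hfun_complete]. *)
have /choice[m Hm] (k : nat) : exists m, M m /\ hnorm (x - m) <= d + (4 * k.+1%:R)^-1.
  have e0 : (0 : R) < (4 * k.+1%:R)^-1 by rewrite invr_gt0 mulr_gt0.
  by have [_ [m Mm <-] /ltW] := inf_adherent e0 E0; exists m.
have Cm k l : hnorm (m k - m l) <= k.+1%:R^-1 + l.+1%:R^-1.
  have [[Mk Hk] [Ml Hl]] := (Hm k, Hm l).
  have := dle _ (perpZ (2^-1)%:C (perpD Mk Ml)).
  pose p := x - m k; pose q := x - m l.
  have -> : x - (2^-1)%:C *: (m k + m l) = (2^-1)%:C *: (p + q).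
    rewrite /p /q addrACA -opprD scalerBr; congr (_ - _).
    rewrite scalerDr -scalerDl -rmorphD/= (_ : 2^-1 + 2^-1 = 1) ?scale1r//; lra.
  have -> : m k - m l = q - p by rewrite /p /q opprB [RHS]addrC addrA subrK.
  move: Hk Hl; rewrite -/p -/q; clearbody p q.
  rewrite hnormZ sqn_real !hnormD hnormN hipNr ReN (hipC p q) ReJ !invfM expr2.
  have k0 : (0 : R) <= k.+1%:R^-1 by rewrite invr_ge0.
  have l0 : (0 : R) <= l.+1%:R^-1 by rewrite invr_ge0.
  move: (k.+1%:R^-1) (l.+1%:R^-1) k0 l0 => kk ll k0 l0; lra.
have [y Hy] := hfun_complete Cm; exists y.
  move=> f Nf; apply/eqP; rewrite -sqn_eq0 eq_le sqn_ge0 andbT.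
  apply: (@harmonic_le0 _ (hnorm f)) => k.
  have -> : hip y f = - hip (m k - y) f by rewrite hipBl (proj1 (Hm k))// sub0r opprK.
  rewrite -mulN1r sqnM -[sqn (-1)]/(sqn (- 1%:C)) /sqn/= oppr0 expr0n addr0 sqrrN expr1n mul1r.
  apply: le_trans (hip_cauchy _ _) _; rewrite mulrC ler_wpM2l ?hnorm_ge0//; exact: Hy.
move=> g Mg; apply/eqP; rewrite -sqn_eq0 eq_le sqn_ge0 andbT.
apply: (@harmonic_le0 _ (4 * hnorm g)) => k.
have -> : hip (x - y) g = hip (x - m k) g + hip (m k - y) g.
  by rewrite -hipDl addrA subrK.
apply: le_trans (sqnD_le _ _) _.
have H1 : sqn (hip (m k - y) g) <= k.+1%:R^-1 * hnorm g.
  by apply: le_trans (hip_cauchy _ _) _; rewrite ler_wpM2r ?hnorm_ge0//; exact: Hy.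
suff H2 : sqn (hip (x - m k) g) <= k.+1%:R^-1 * hnorm g.
  move: (k.+1%:R^-1) H1 H2 => kk H1 H2; rewrite -mulrA [hnorm g * _]mulrC.
  by move: (kk * hnorm g) H1 H2 => z H1 H2; lra.
have [g0|g0] := eqVneq (hnorm g) 0.
  by apply: le_trans (hip_cauchy _ _) _; rewrite g0 !mulr0.
have gp : 0 < hnorm g by rewrite lt_def g0 hnorm_ge0.
have [Mk Hk] := Hm k; set r := x - m k; set a := hip r g.
(* Adding to [m k] the component of [r] along [g] lowers the squared distance by [sqn a / hnorm g],
   which cannot exceed the excess of [m k]. *)
have := dle _ (perpD Mk (perpZ (a * (hnorm g)^-1%:C) Mg)).
rewrite opprD addrA -/r -scaleNr hnormD hnormZ hipZr -/a.
have -> : conjc (- (a * (hnorm g)^-1%:C)) * a = - (sqn a * (hnorm g)^-1)%:C.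
  by rewrite conjN conjM conj_real mulNr mulrAC [conjc a * a]mulrC mulcJ rmorphM.
rewrite ReN /= -mulN1r !sqnM sqn_real.
have -> : sqn (-1) = 1 :> R by rewrite /sqn/= oppr0 expr0n addr0 sqrrN expr1n.
have -> : 1 * (sqn a * (hnorm g)^-1 ^+ 2) * hnorm g = sqn a * (hnorm g)^-1 by field.
have kk : (4 * k.+1%:R)^-1 <= k.+1%:R^-1 :> R.
  by rewrite invfM ler_piMl// invf_le1// ler1n.
rewrite -ler_pdivrMr//; move: Hk kk; rewrite -/r.
move: (sqn a / hnorm g) (k.+1%:R^-1) ((4 * k.+1%:R)^-1) => s u v Hk kk H3; lra.
Qed.

End Projection.

Section Beurling.
Variable R : realType.
Implicit Types (f g h x y psi chi : hfun R).

(** Adjoints of commuting multiplications commute; hence model spaces are invariant under the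
    backward shift. *)
Lemma adj_mono_adj psi n f : inn psi ->
  adj psi (adj (mono R n) f) = adj (mono R n) (adj psi f).
Proof.
by move=> ip_; rewrite -!adjM// hmulC//; exact: inn_bddf.
Qed.

Lemma inn_hnorm psi : inn psi -> hnorm psi = 1.
Proof.
move=> ip_; apply: complexI; rewrite -hip_norm -[psi in X in X = _]hmul1r; last exact: inn_bddf.
rewrite hip_inn// -cfE cf_mono.
by [].
Qed.

(** Multiplication by [chi] is isometric, so the inner products [inner_criterion] asks about are the
    same for [eta] as for [psi]. *)
Lemma inn_factor psi chi eta : inn psi -> inn chi -> psi = chi ** eta -> inn eta.
Proof.
move=> ip_ ic pE; apply: inner_criterion => n.
rewrite -(hip_inn _ _ ic) -hmulA; [|exact: inn_bddf|exact: bddf_mono].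
rewrite [chi ** mono R n]hmulC; [|exact: inn_bddf|exact: bddf_mono].
rewrite hmulA; [|exact: bddf_mono|exact: inn_bddf].
rewrite -pE hmulC; [|exact: bddf_mono|exact: inn_bddf].
transitivity (hip (psi ** mono R n) (psi ** mono R 0)).
  by rewrite hmul1r//; exact: inn_bddf.
by rewrite hip_inn// -cfE cf_mono eq_sym.
Qed.

Variables psi1 psi2 : hfun R.
Hypotheses (i1 : inn psi1) (i2 : inn psi2).
(** The intersection of the two model spaces. Its orthogonal complement [M], the closure of
    [psi1 H^2 + psi2 H^2], is the invariant subspace to which Beurling's argument applies. *)
Let N f := adj psi1 f = 0 /\ adj psi2 f = 0.
Let M g := forall f, N f -> hip g f = 0.

Let M_mono n g : M g -> M (mono R n ** g).
Proof.
move=> Mg f [f1 f2]; rewrite hipC -adjP// hipC conjcK Mg//.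
by split; rewrite adj_mono_adj// ?f1 ?f2 adj0.
Qed.

Let M1 g : M (psi1 ** g).
Proof. by move=> f [f1 _]; rewrite hipC -adjP// f1 hip0l conjc0. Qed.

Let M2 g : M (psi2 ** g).
Proof. by move=> f [_ f2]; rewrite hipC -adjP// f2 hip0l conjc0. Qed.

(* [chi] is the normalized projection onto [M] of [z^j], where [j] is the least order at
   [0] of the elements of [M]. If [r] in [M] is orthogonal to [chi H^2], then so is
   [z^m r] for all [m], so that the conjugate of [r] vanishes. *)
Lemma beurling : exists2 chi, inn chi &
  (forall g, M g -> g = chi ** adj chi g) /\ (forall f, N f -> adj chi f = 0).
Proof.
have exj : exists j, `[< exists2 g, M g & cf g j != 0 >].
  apply: contrapT => /forallNP H.
  have : psi1 = 0.
    apply: cf_inj => n; rewrite cf0; apply: contrapT => /eqP cn; apply: (H n).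
    apply/asboolP; exists psi1 => //; rewrite -[psi1]hmul1r; last exact: inn_bddf.
    exact: M1.
  move=> p0; have := inn_hnorm i1; rewrite p0 => /esym/eqP; apply/negP.
  have -> : hnorm (0 : hfun R) = 0 by apply: complexI; rewrite -hip_norm hip0l.
  exact: oner_neq0.
case: (ex_minnP exj) => j /asboolP[g0 Mg0 g0j] minj.
have low g n : M g -> (n < j)%N -> cf g n = 0.
  move=> Mg nj; apply: contrapT => /eqP gn.
  have : (j <= n)%N by apply: minj; apply/asboolP; exists g.
  by rewrite leqNgt nj.
have [x Mx Hx] := perp_projection N (mono R j).
have hx g : M g -> hip g x = cf g j.
  move=> Mg; have := Hx g Mg; rewrite hipBl => /eqP; rewrite subr_eq0 => /eqP H.
  by rewrite hipC -H -hipC cfE.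
(* Pairing with [x] reads off the coefficient of order [j], which for [z^n g] is 0 or a coefficient
   of [g] of order below [j]. *)
have shift g n : M g -> (0 < n)%N -> hip (mono R n ** g) x = 0.
  move=> Mg n0; rewrite hx; last exact: M_mono.
  rewrite cf_monoM; case: ifP => // nj; apply: low => //.
  by rewrite -[X in (_ < X)%N]subn0 ltn_sub2l// (leq_trans n0).
have xp : 0 < hnorm x.
  rewrite lt_def hnorm_ge0 andbT; apply/eqP => x0.
  by move: g0j; rewrite -hx// (hnorm_eq0 x0) hip0r eqxx.
pose c : R := (Num.sqrt (hnorm x))^-1; pose chi := c%:C *: x.
have c0 : c%:C != 0.
  by rewrite -[0]/(0%:C) (inj_eq (@complexI R)) invr_eq0 gt_eqF// sqrtr_gt0.
have Mchi : M chi by exact: perpZ.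
have shiftc g n : M g -> (0 < n)%N -> hip (mono R n ** g) chi = 0.
  by move=> Mg n0; rewrite hipZr shift// mulr0.
have ichi : inn chi.
  apply: inner_criterion => -[|n].
    have n1 : hnorm chi = 1.
      by rewrite hnormZ sqn_real /c exprVn sqr_sqrtr ?hnorm_ge0// mulVf// gt_eqF.
    by rewrite hmul1l hip_norm n1.
  by rewrite shiftc.
(* The coefficients of [adj chi f] are the inner products of [f] with the shifts of [chi], which lie
   in [M]. *)
have Mcm g : M (chi ** g).
  move=> f Nf; rewrite hipC -adjP//.
  suff -> : adj chi f = 0 by rewrite hip0l conjc0.
  apply: cf_inj => n; rewrite cf_adj// cf0 hmulC//; last exact: inn_bddf.
  by rewrite hipC (M_mono n Mchi) ?conjc0.
exists chi => //; split=> [g Mg|f Nf]; last first.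
  by apply: hip_inj => h; rewrite adjP// hipC (Mcm h f Nf) conjc0 hip0l.
have bchi := inn_bddf ichi.
set r := g - chi ** adj chi g.
have Mr : M r by move=> f Nf; rewrite hipBl (Mg f Nf) (Mcm _ f Nf) subrr.
have r0 : adj chi r = 0 by rewrite adjB// adjK// subrr.
have [k kE] := inn_conj_analytic ichi r0.
have k0 : k = 0.
  apply: cf_inj => m; rewrite cf0 /cf -(ip_aeq kE (aeq_refl _)).
  transitivity (conjc (hip (mono R m.+1 ** r) chi)); last by rewrite shiftc// conjc0.
  rewrite -hipC /hip (ip_aeq (aeq_refl _) (bdM r (@bddf_mono R m.+1))).
  rewrite !ip.unlock /L2_ip; congr (_ * _); apply: Cintegral_aeq.
  apply: (ae_circleS _ (@bd_mono R m.+1)) => t E1; rewrite /conjW E1 -(ecircM 1 m t) !conjM.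
  by ring.
have : r = 0.
  apply: hnorm_eq0; apply: complexI; rewrite -(norm2_conjW _ ichi) (norm2_aeq kE) k0.
  by rewrite -/(hnorm _) -hip_norm hip0l.
by move=> /eqP; rewrite subr_eq0 => /eqP.
Qed.

(** Both [psi1] and [psi2] lie in [M], so the generator [chi] divides them and is constant. Since
    [adj chi f = 0], [f] is 0. *)
Lemma coprime_inner_model f :
  (forall chi eta1 eta2, inn chi -> inn eta1 -> inn eta2 ->
     psi1 = chi ** eta1 -> psi2 = chi ** eta2 -> exists c : R[i], chi = c *: mono R 0) ->
  adj psi1 f = 0 -> adj psi2 f = 0 -> f = 0.
Proof.
move=> cop f1 f2; have [chi ic [Hg Hf]] := beurling.
have E1 : psi1 = chi ** adj chi psi1.
  by apply: Hg; rewrite -[psi1]hmul1r; [exact: M1|exact: inn_bddf].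
have E2 : psi2 = chi ** adj chi psi2.
  by apply: Hg; rewrite -[psi2]hmul1r; [exact: M2|exact: inn_bddf].
have [c cE] := cop chi _ _ ic (inn_factor i1 ic E1) (inn_factor i2 ic E2) E1 E2.
have f0 : adj chi f = 0 by exact: Hf.
have c0 : c != 0.
  apply/eqP => c0; have := inn_hnorm ic; rewrite cE c0 scale0r => /esym/eqP; apply/negP.
  have -> : hnorm (0 : hfun R) = 0 by apply: complexI; rewrite -hip_norm hip0l.
  exact: oner_neq0.
apply: hip_inj => h; have := adjP f (c^-1 *: h) ic.
rewrite f0 !hip0l hmulZr; last exact: inn_bddf.
have -> : chi ** h = c *: h.
  apply: hfun_ext => z; rewrite (hmulE _ _ (inn_bddf ic)) cE !hvalZ monoE expr0 mulr1.
  by [].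
by rewrite scalerA mulVf// scale1r => <-.
Qed.

End Beurling.

(** * Rank of the commutator *)

Lemma lift_max_widen n (k : 'I_n) : lift ord_max k = widen_ord (leqnSn n) k.
Proof. by apply: val_inj; rewrite /= /bump leqNgt ltn_ord. Qed.

Lemma unlift_max_widen n (k : 'I_n) : unlift ord_max (widen_ord (leqnSn n) k) = Some k.
Proof. by rewrite -lift_max_widen liftK. Qed.

Section Dimension.
Variables (R : realType) (V : lmodType R[i]).
Implicit Types (N A : set V) (n : nat).

Definition free_family N A n : Prop :=
  exists2 e : 'I_n -> V, (forall i, A (e i)) & @free_mod R V N n e.

Definition spanned A n : Prop := exists e : 'I_n -> V,
  forall x, A x -> exists c : 'I_n -> R[i], x = \sum_(i < n) c i *: e i.

(** With more vectors than generators, the coefficient matrix has a nonzero left kernel, which gives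
    a linear relation. *)
Lemma free_le_span A n m : free_family [set 0] A n -> spanned A m -> (n <= m)%N.
Proof.
move=> [e Ae fe] [s Hs]; rewrite leqNgt; apply/negP => mn.
have /choice[a Ha] : forall i, exists c : 'I_m -> R[i], e i = \sum_(j < m) c j *: s j.
  by move=> i; exact: Hs.
pose M : 'M[R[i]]_(n, m) := \matrix_(i, j) a i j.
have kM : kermx M != 0.
  rewrite kermx_eq0 /row_free neq_ltn; apply/orP; left.
  exact: leq_ltn_trans (rank_leq_col M) mn.
have [i /eqP ki] : exists i, row i (kermx M) <> 0.
  apply: contrapT => /forallNP H; move/eqP: kM; apply; apply/row_matrixP => i.
  by rewrite row0; exact: contrapT (H i).
pose u := row i (kermx M).
have uM : u *m M = 0 by rewrite /u -row_mul mulmx_ker row0.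
move/eqP: ki; apply; apply/rowP => j; rewrite [RHS]mxE.
apply: (fe (fun j => u 0 j)) => /=.
rewrite (eq_bigr (fun k => \sum_(l < m) (u 0 k * a k l) *: s l)) => [|k _]; last first.
  by rewrite Ha scaler_sumr; apply: eq_bigr => l _; rewrite scalerA.
rewrite exchange_big big1// => l _; rewrite -scaler_suml.
have -> : \sum_(k < n) u 0 k * a k l = (u *m M) 0 l.
  by rewrite [RHS]mxE; apply: eq_bigr => k _; rewrite [M _ _]mxE.
by rewrite uM mxE scale0r.
Qed.

Lemma free_family0 N A : free_family N A 0.
Proof. by exists (fun=> 0) => [[]//|c _ []]. Qed.

Lemma free_familyS N A n : free_family N A n.+1 -> free_family N A n.
Proof.
move=> [e Ae fe]; exists (fun i => e (widen_ord (leqnSn n) i)) => // c H i.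
have := fe (fun j => if unlift ord_max j is Some k then c k else 0).
rewrite big_ord_recr/= unlift_none scale0r addr0 => /(_ _ (widen_ord (leqnSn n) i)).
rewrite unlift_max_widen; apply; under eq_bigr do rewrite unlift_max_widen; exact: H.
Qed.

Lemma free_spans A n (e : 'I_n -> V) : (forall i, A (e i)) -> @free_mod R V [set 0] n e ->
  ~ free_family [set 0] A n.+1 ->
  forall x, A x -> exists c : 'I_n -> R[i], x = \sum_(i < n) c i *: e i.
Proof.
move=> Ae fe nf x Ax; apply: contrapT => nx.
apply: nf; exists (fun i : 'I_n.+1 => if unlift ord_max i is Some k then e k else x).
  by move=> i; case: unliftP => [k _|_].
move=> c; rewrite big_ord_recr/= unlift_none; under eq_bigr do rewrite unlift_max_widen.
move=> H; have cm : c ord_max = 0.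
  apply: contrapT => /eqP cm; apply: nx.
  exists (fun i => - (c ord_max)^-1 * c (widen_ord (leqnSn n) i)).
  rewrite -(eq_bigr _ (fun i _ => scalerA _ _ _)) -scaler_sumr.
  move/eqP: H; rewrite addr_eq0 => /eqP ->.
  by rewrite scalerN scaleNr opprK scalerA mulVf// scale1r.
have ci := fe (fun i => c (widen_ord (leqnSn n) i)) _.
move=> i; case: (unliftP ord_max i) => [k ->|->//].
rewrite lift_max_widen.
by apply: ci; move: H; rewrite cm scale0r addr0.
Qed.

(** The least size at which free families cease to exist is the successor of the dimension. Ranks in
    the extended reals are computed separately in the two cases. *)
Lemma dim_dichotomy A :
  (exists2 n, free_family [set 0] A n & spanned A n) \/ (forall n, free_family [set 0] A n).
Proof.
have [H|/existsNP[n0 Hn0]] := pselect (forall n, free_family [set 0] A n); [by right|left].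
have ex : exists n, `[< ~ free_family [set 0] A n >] by exists n0; apply/asboolP.
case: (ex_minnP ex) => -[|n] /asboolP nf minn; first by have := nf (free_family0 _ _).
have fn : free_family [set 0] A n.
  apply: contrapT => fn; have := minn n; rewrite ltnn => H.
  by have := H (asboolT fn).
by exists n => //; have [e Ae fe] := fn; exists e; exact: free_spans.
Qed.

Lemma dim_modE N A : @dim_mod R V N A =
  ereal_sup [set (n%:R)%:E | n in [set n | free_family N A n]].
Proof. by []. Qed.

Lemma dim_mod_finite A n : free_family [set 0] A n -> spanned A n ->
  @dim_mod R V [set 0] A = (n%:R)%:E.
Proof.
move=> fn sn; rewrite dim_modE; apply/eqP; rewrite eq_le; apply/andP; split.
  by apply: ge_ereal_sup => _ [m fm <-]; rewrite lee_fin ler_nat; exact: free_le_span fm sn.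
by apply: ereal_sup_ubound; exists n.
Qed.

Lemma dim_mod_infinite N A : (forall n, free_family N A n) -> @dim_mod R V N A = +oo%E.
Proof.
move=> H; rewrite dim_modE; apply/eqyP => x x0.
apply: (@le_trans _ _ (Num.bound x)%:R%:E); last first.
  by apply: ereal_sup_ubound; exists (Num.bound x) => //; exact: H.
by rewrite lee_fin ltW// archi_boundP// ltW.
Qed.

End Dimension.

Lemma dim_mod_eq (R : realType) (V W : lmodType R[i]) (N A : set V) (N' A' : set W) :
  (forall n, free_family N A n <-> free_family N' A' n) ->
  @dim_mod R V N A = @dim_mod R W N' A'.
Proof.
move=> H; rewrite !dim_modE; congr ereal_sup; apply/seteqP; split=> _ [n fn <-];
  by exists n => //; apply/H.
Qed.

Section CommutatorRank.
Variable R : realType.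
Implicit Types (f g h e : hfun R).

(** Multiplication by [theta] is isometric, so its composition with its adjoint is the orthogonal
    projection onto [theta H^2]; see [inner_projE]. *)
Definition rproj theta f := theta ** adj theta f.

Definition lin (T : hfun R -> hfun R) :=
  (forall f g, T (f + g) = T f + T g) /\ (forall (k : R[i]) f, T (k *: f) = k *: T f).

Lemma lin_sum T n (c : 'I_n -> R[i]) (e : 'I_n -> hfun R) : lin T ->
  T (\sum_(i < n) c i *: e i) = \sum_(i < n) c i *: T (e i).
Proof.
move=> [TD TZ]; elim/big_rec2 : _ => [|i x y _ <-]; last by rewrite TD TZ.
by have := TZ 0 0; rewrite !scale0r.
Qed.

Lemma lin_proj theta : inn theta -> lin (rproj theta).
Proof.
move=> it; have bt := inn_bddf it; split=> [f g|k f]; rewrite /rproj.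
  by rewrite adjD// hmulDr.
by rewrite adj_scale// hmulZr.
Qed.

Lemma lin_sub T U : lin T -> lin U -> lin (fun f => T f - U f).
Proof.
move=> [TD TZ] [UD UZ]; split=> [f g|k f]; first by rewrite TD UD opprD addrACA.
by rewrite TZ UZ scalerBr.
Qed.

Lemma lin_id : lin id. Proof. by []. Qed.

Definition model theta : set (hfun R) := [set f | adj theta f = 0].

Variables psi1 psi2 : hfun R.
Hypotheses (i1 : inn psi1) (i2 : inn psi2).
Let P1 := rproj psi1.
Let P2 := rproj psi2.
Let C f := P1 (P2 f) - P2 (P1 f).

Lemma proj_self theta f g : inn theta -> hip (rproj theta f) g = hip f (rproj theta g).
Proof.
by move=> it; rewrite hipC -adjP// -hipC adjP//.
Qed.

Lemma proj_idem theta f : inn theta -> rproj theta (rproj theta f) = rproj theta f.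
Proof. by move=> it; rewrite /rproj adjK. Qed.

Lemma proj_model theta f : inn theta -> model theta f -> rproj theta f = 0.
Proof. by move=> it f0; rewrite /rproj f0 hmul0r//; exact: inn_bddf. Qed.

Lemma model_proj theta f : inn theta -> model theta (f - rproj theta f).
Proof. by move=> it; rewrite /model/= adjB// /rproj adjK// subrr. Qed.

Let l1 : lin P1. Proof. exact: lin_proj. Qed.
Let l2 : lin P2. Proof. exact: lin_proj. Qed.
Let P1I f : P1 (P1 f) = P1 f. Proof. exact: proj_idem. Qed.
Let P2I f : P2 (P2 f) = P2 f. Proof. exact: proj_idem. Qed.
Let P1S f g : hip (P1 f) g = hip f (P1 g). Proof. exact: proj_self. Qed.
Let P2S f g : hip (P2 f) g = hip f (P2 g). Proof. exact: proj_self. Qed.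

Let linB T f g : lin T -> T (f - g) = T f - T g.
Proof. by move=> [TD TZ]; rewrite TD -scaleN1r TZ scaleN1r. Qed.

Let lin0 T : lin T -> T 0 = 0.
Proof. by move=> [_ TZ]; have := TZ 0 0; rewrite !scale0r. Qed.

(** By [coburn] this holds for the pair or for the exchanged pair. *)
Hypothesis H1 : forall h, model psi1 (psi2 ** h) -> h = 0.

Section Range.
Hypothesis H12 : forall f, model psi1 f -> model psi2 f -> f = 0.

(** Pairing with [e] gives [P1 (P2 e) = 0], so [P2 e] lies in the first model space and in
    [psi2 H^2]. It is 0 by [H1], and [e] lies in both model spaces. *)
Let inj1 e : model psi1 e -> P2 (P1 (P2 e)) = 0 -> e = 0.
Proof.
move=> Ke H; apply: H12 => //; apply: H1.
apply: (hmulI i1); rewrite hmul0r; last exact: inn_bddf.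
by apply: hip_eq0; rewrite -[psi1 ** _]/(P1 (P2 e)) -P1S P1I -P2S H hip0l.
Qed.

(** Now [P2 e - P1 (P2 e)] is in [psi2 H^2] and in the first model space, so it is 0 by [H1]. Then
    [P2 e] is in [psi1 H^2], to which [e] is orthogonal, so that [P2 e = 0]. *)
Let inj2 e : model psi1 e -> P1 (P2 e) = P2 (P1 (P2 e)) -> e = 0.
Proof.
move=> Ke H.
have E : P2 e - P1 (P2 e) = psi2 ** (adj psi2 e - adj psi2 (P1 (P2 e))).
  by rewrite hmulBr; [rewrite {1}H|exact: inn_bddf].
have K1 : model psi1 (P2 e - P1 (P2 e)) by exact: model_proj.
have Q0 : P2 e = P1 (P2 e).
  apply/eqP; rewrite -subr_eq0 E (H1 (h := adj psi2 e - adj psi2 (P1 (P2 e)))).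
    by rewrite hmul0r//; exact: inn_bddf.
  by rewrite -E.
apply: H12 => //; apply: hip_eq0.
rewrite adjP// -[psi2 ** _]/(P2 e) hipC Q0 P1S.
by rewrite [P1 e]proj_model// hip0r conjc0.
Qed.

(* The commutator maps [(1 - P2) e] to [P2 w] and [P2 e] to [(1 - P2) w], where
   [w = P1 (P2 e)]. *)
Lemma commutator_range_free n :
  free_family [set 0] (model psi1) n -> free_family [set 0] (range C) (n + n).
Proof.
move=> [e Ke fe]; pose w i := P1 (P2 (e i)).
have CQ f : model psi1 f -> C (f - P2 f) = P2 (P1 (P2 f)).
  move=> Kf; rewrite /C (linB _ _ l2) P2I subrr (lin0 l1) sub0r (linB _ _ l1).
  by rewrite [P1 f]proj_model// (linB _ _ l2) (lin0 l2) sub0r opprK.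
have CP f : C (P2 f) = P1 (P2 f) - P2 (P1 (P2 f)) by rewrite /C P2I.
pose v (i : 'I_(n + n)) := match fintype.split i with
  | inl j => P2 (w j) | inr j => w j - P2 (w j) end.
exists v.
  move=> i; rewrite /v; case: (fintype.split i) => j; rewrite /w.
    by exists (e j - P2 (e j)) => //; exact: CQ.
  by exists (P2 (e j)) => //; exact: CP.
have Kspan (d : 'I_n -> R[i]) : model psi1 (\sum_(j < n) d j *: e j).
  rewrite /model/= (@lin_sum (adj psi1)); last by split=> *; rewrite ?adjD ?adj_scale.
  by rewrite big1// => j _; rewrite Ke scaler0.
(* The two halves of the family lie in the range of [P2] and in its complement, so a relation splits
   into one on each half. *)
have key x y : P2 x + (y - P2 y) = 0 -> P2 x = 0 /\ y = P2 y.
  move=> H; have H2 : P2 x = 0.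
    have := congr1 P2 H; rewrite (lin0 l2); have [l2D _] := l2; rewrite l2D (linB _ _ l2) !P2I.
    by rewrite subrr addr0.
  by split=> //; move: H; rewrite H2 add0r => /eqP; rewrite subr_eq0 => /eqP.
move=> c H.
have [Ha Hb] : (P2 (P1 (P2 (\sum_(j < n) c (lshift n j) *: e j))) = 0) /\
    (P1 (P2 (\sum_(j < n) c (rshift n j) *: e j)) =
     P2 (P1 (P2 (\sum_(j < n) c (rshift n j) *: e j)))).
  apply: key; rewrite -[RHS]H big_split_ord/=; congr (_ + _).
    rewrite (lin_sum _ _ l2) (lin_sum _ _ l1) (lin_sum _ _ l2).
    by apply: eq_bigr => j _; rewrite /v (unsplitK (inl j)).
  rewrite (lin_sum _ _ l2) (lin_sum _ _ l1) (lin_sum _ _ l2) -sumrB.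
  by apply: eq_bigr => j _; rewrite -scalerBr /v (unsplitK (inr j)).
have a0 := inj1 (Kspan _) Ha; have b0 := inj2 (Kspan _) Hb.
move=> i; rewrite -(fintype.splitK i); case: (fintype.split i) => j /=.
  exact: (fe _ a0).
exact: (fe _ b0).
Qed.

End Range.

(** A value of [C] is the image by [P2] of an element of the first model space, minus another
    element of that space. *)
Lemma commutator_range_spanned n : spanned (model psi1) n -> spanned (range C) (n + n).
Proof.
move=> [e He]; exists (fun i => match fintype.split i with inl j => P2 (e j) | inr j => e j end).
move=> _ [f _ <-].
have [c Hc] := He _ (model_proj f i1).
have [d Hd] := He _ (model_proj (P2 f) i1).
exists (fun i => match fintype.split i with inl j => c j | inr j => - d j end).
rewrite big_split_ord/=.
have -> : C f = P2 (f - P1 f) - (P2 f - P1 (P2 f)).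
  by rewrite /C (linB _ _ l2) opprB [RHS]addrC addrA subrK.
rewrite Hc Hd (lin_sum _ _ l2) -sumrN; congr (_ + _); apply: eq_bigr => j _.
  by rewrite (unsplitK (inl j)).
by rewrite (unsplitK (inr j)) scaleNr.
Qed.

(** The projection [1 - P2] is injective on the first model space, because its kernel there consists
    of elements of [psi2 H^2]. *)
Lemma free_model_le n :
  free_family [set 0] (model psi1) n -> free_family [set 0] (model psi2) n.
Proof.
move=> [e Ke fe]; exists (fun i => e i - P2 (e i)) => [i|c]; first exact: model_proj.
have lQ : lin (fun f => f - P2 f) by apply: lin_sub; [exact: lin_id|exact: lin_proj].
rewrite -(lin_sum c e lQ) => /eqP; rewrite subr_eq0 => /eqP H; apply: fe.
have K : model psi1 (\sum_(i < n) c i *: e i).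
  rewrite /model/= (@lin_sum (adj psi1)); last by split=> *; rewrite ?adjD ?adj_scale.
  by rewrite big1// => j _; rewrite Ke scaler0.
rewrite /= H /P2 /rproj (H1 (h := adj psi2 (\sum_(i < n) c i *: e i))).
  by rewrite hmul0r//; exact: inn_bddf.
by rewrite -[psi2 ** _]/(P2 _) -H.
Qed.

End CommutatorRank.

(** * Model spaces and the degree of inner functions *)

Section BlaschkeFactor.
Variable R : realType.
Implicit Types (f g h psi : hfun R) (a z : disk R).

Lemma hmulDl f g h : bddf f -> bddf g -> (f + g) ** h = f ** h + g ** h.
Proof.
move=> bf bg; apply: hfun_ext => z.
by rewrite hvalD (hmulE _ _ (bddfD bf bg)) (hmulE _ _ bf) (hmulE _ _ bg) hvalD mulrDl.
Qed.

Lemma hmulZl (k : R[i]) f h : bddf f -> (k *: f) ** h = k *: (f ** h).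
Proof.
move=> bf; apply: hfun_ext => z.
by rewrite hvalZ (hmulE _ _ (bddfZ k bf)) (hmulE _ _ bf) hvalZ mulrA.
Qed.

Lemma hmulBl f g h : bddf f -> bddf g -> (f - g) ** h = f ** h - g ** h.
Proof.
move=> bf bg; have E (x : hfun R) : - x = -1 *: x by rewrite scaleN1r.
by rewrite (E g) (E (g ** h)) hmulDl ?hmulZl//; exact: bddfZ.
Qed.

Definition numer a := mono R 1 - val a *: mono R 0.
Definition denom a := mono R 0 - conjc (val a) *: mono R 1.

Lemma bddf_numer a : bddf (numer a).
Proof. by apply: bddfD => //; rewrite -scaleN1r; do 2 apply: bddfZ. Qed.

Lemma bddf_denom a : bddf (denom a).
Proof. by apply: bddfD => //; rewrite -scaleN1r; do 2 apply: bddfZ. Qed.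

Lemma hval_numer a z : hval (numer a) z = val z - val a.
Proof. by rewrite hvalB hvalZ !monoE expr1 expr0 mulr1. Qed.

Lemma hval_denom a z : hval (denom a) z = 1 - conjc (val a) * val z.
Proof. by rewrite hvalB hvalZ !monoE expr1 expr0. Qed.

Lemma denom_kz a : denom a ** kz a = mono R 0.
Proof.
apply: cf_inj => n; rewrite hmulBl ?hmulZl ?hmul1l//; last exact: bddfZ.
rewrite cfB cfZ cf_monoM cf_kz cf_mono; case: n => [|n] /=.
  by rewrite mulr0 subr0 expr0.
by rewrite cf_kz subSS subn0 exprS subrr.
Qed.

Lemma hval_kz a z : hval (kz a) z = (1 - conjc (val a) * val z)^-1.
Proof.
have := congr1 (fun f => hval f z) (denom_kz a).
rewrite /= (hmulE _ _ (bddf_denom a)) hval_denom monoE expr0 => H.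
have d0 : 1 - conjc (val a) * val z != 0.
  by apply/eqP => d0; move: H; rewrite d0 mul0r => /esym/eqP; rewrite oner_eq0.
by apply: (mulfI d0); rewrite H mulfV.
Qed.

Lemma kz_neq0 a z : hval (kz a) z != 0.
Proof.
have := congr1 (fun f => hval f z) (denom_kz a).
rewrite /= (hmulE _ _ (bddf_denom a)) monoE expr0 => H; apply/eqP => k0.
by move: H; rewrite k0 mulr0 => /esym/eqP; rewrite oner_eq0.
Qed.

(** The kernel [kz a] is the inverse of [denom a], so that no division of Hardy functions is
    involved. *)
Definition blaschke a := numer a ** kz a.

Lemma blaschkeE a z :
  hval (blaschke a) z = (val z - val a) / (1 - conjc (val a) * val z).
Proof. by rewrite (hmulE _ _ (bddf_numer a)) hval_numer hval_kz. Qed.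

Lemma denom_blaschke a : denom a ** blaschke a = numer a.
Proof.
rewrite -hmulA; [|exact: bddf_denom|exact: bddf_numer].
rewrite [denom a ** _]hmulC; [|exact: bddf_denom|exact: bddf_numer].
rewrite hmulA; [|exact: bddf_numer|exact: bddf_denom].
by rewrite denom_kz hmul1r//; exact: bddf_numer.
Qed.

(** By [unimod_inn] only boundary values matter, and on the circle the numerator and the denominator
    have equal moduli. *)
Lemma inn_blaschke a : inn (blaschke a).
Proof.
apply: unimod_inn; apply: sqint_unimod => //.
have bN : aeq (bd (numer a)) (fun t => ecirc 1 t - val a).
  pose c n := if n == 0%N then - val a else 1.
  have -> : numer a = \sum_(0 <= n < 2) c n *: mono R n.
    by rewrite big_nat_recr//= big_nat1 /c/= scaleNr scale1r [RHS]addrC.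
  apply: aeq_trans (bd_poly c 2) _; apply: ae_circleT => t.
  by rewrite /trigp big_nat_recr//= big_nat1 /c/= ecirc0 mulr1 mul1r [LHS]addrC.
have bD : aeq (bd (denom a)) (fun t => 1 - conjc (val a) * ecirc 1 t).
  pose c n := if n == 0%N then 1 else - conjc (val a).
  have -> : denom a = \sum_(0 <= n < 2) c n *: mono R n.
    by rewrite big_nat_recr//= big_nat1 /c/= scaleNr scale1r.
  apply: aeq_trans (bd_poly c 2) _; apply: ae_circleT => t.
  by rewrite /trigp big_nat_recr//= big_nat1 /c/= ecirc0 mulr1 mulNr.
have := bdM (blaschke a) (bddf_denom a); rewrite denom_blaschke => bP.
apply: (ae_circleS3 _ bN bD bP) => t -> ->; set e := ecirc 1 t; set x := bd _ t => H.
have e1 : sqn e = 1 by exact: sqn_ecirc.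
have d0 : 1 - conjc (val a) * e != 0.
  rewrite subr_eq0; apply/eqP => /(congr1 (@cabs R)); rewrite cabs1 cabsM cabsJ.
  have -> : cabs e = 1 by rewrite cabs_sqrt e1 sqrtr1.
  by rewrite mulr1 => H1; have := cabs_disk a; rewrite -H1 ltxx.
have H2 : e - val a = e * conjc (1 - conjc (val a) * e).
  rewrite conjB conjc1 conjM conjcK mulrBr mulr1 mulrCA mulcJ e1.
  by rewrite mulr1.
move: H; rewrite H2 => /(congr1 (@sqn R)); rewrite !sqnM sqnJ e1 mul1r => H.
have s0 : sqn (1 - conjc (val a) * e) != 0 by rewrite sqn_eq0.
by apply: (mulfI s0); rewrite -H mulr1.
Qed.
Hint Resolve inn_blaschke : core.

Lemma model_kz a : model (blaschke a) (kz a).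
Proof.
apply: hip_inj => g; rewrite hip0l adjP// hipC hip_kz (hmulE _ _ (inn_bddf (inn_blaschke a))).
by rewrite blaschkeE subrr !mul0r conjc0.
Qed.

(** Such an [f] is orthogonal to each [(z - a) z^n], a multiple of the Blaschke factor; its
    coefficients are therefore in geometric progression. *)
Lemma model_blaschke a f : model (blaschke a) f -> f = cf f 0 *: kz a.
Proof.
move=> f0; have bb := inn_bddf (inn_blaschke a).
have step n : cf f n.+1 = conjc (val a) * cf f n.
  have : hip f (mono R n.+1 - val a *: mono R n) = 0.
    have -> : mono R n.+1 - val a *: mono R n = blaschke a ** (denom a ** mono R n).
      rewrite -hmulA//; last exact: bddf_denom.
      rewrite [blaschke a ** _]hmulC//; last exact: bddf_denom.
      rewrite denom_blaschke hmulBl//; last exact: bddfZ.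
      by rewrite hmulZl// !hmul_mono add1n add0n.
    by rewrite -adjP// f0 hip0l.
  by rewrite hipBr hipZr -!cfE => /eqP; rewrite subr_eq0 => /eqP.
apply: cf_inj => n; rewrite cfZ cf_kz; elim: n => [|n IH]; first by rewrite expr0 mulr1.
by rewrite step IH exprS mulrCA.
Qed.

(** The part of [psi] in the model space of the factor is a multiple of [kz a] that vanishes at [a],
    where [kz a] does not. *)
Lemma inn_zero_factor psi a : inn psi -> hval psi a = 0 ->
  psi = blaschke a ** adj (blaschke a) psi.
Proof.
move=> ip_ pa; set r := psi - blaschke a ** adj (blaschke a) psi.
have rE : r = cf r 0 *: kz a by apply: model_blaschke; exact: model_proj.
have : cf r 0 * hval (kz a) a = 0.
  rewrite -hvalZ -rE /r hvalB pa (hmulE _ _ (inn_bddf (inn_blaschke a))).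
  by rewrite blaschkeE subrr !mul0r subrr.
move/eqP; rewrite mulf_eq0 (negPf (kz_neq0 a a)) orbF => /eqP r0.
by move: rE; rewrite r0 scale0r => /eqP; rewrite subr_eq0 => /eqP.
Qed.

End BlaschkeFactor.
#[global] Hint Resolve inn_blaschke : core.

Section ModelDimension.
Variable R : realType.
Implicit Types (f g h psi : hfun R) (a z : disk R).

Lemma lin_adj psi : inn psi -> lin (adj psi).
Proof. by move=> ip_; split=> *; rewrite ?adjD ?adj_scale. Qed.

Lemma lin_hmul psi : inn psi -> lin (hmul psi).
Proof. by move=> ip_; have bp := inn_bddf ip_; split=> *; rewrite ?hmulDr ?hmulZr. Qed.

(** The model space of [b psi] is the orthogonal sum of the line of [kz a] and of [b] times the
    model space of [psi]; the next lemma uses the same decomposition. *)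
Lemma free_model_blaschke psi a n : inn psi ->
  free_family [set 0] (model psi) n -> free_family [set 0] (model (blaschke a ** psi)) n.+1.
Proof.
move=> ip_ [e Ke fe].
exists (fun i : 'I_n.+1 => if unlift ord_max i is Some k then blaschke a ** e k else kz a).
  move=> i; rewrite /model/= adjM//; case: unliftP => [k _|_]; first by rewrite adjK// Ke.
  by rewrite model_kz adj0.
move=> c; rewrite big_ord_recr/= unlift_none; under eq_bigr do rewrite unlift_max_widen.
rewrite -(lin_sum _ _ (lin_hmul (inn_blaschke a))) => H.
have ck k : c (widen_ord (leqnSn n) k) = 0.
  apply: (fe (fun k => c (widen_ord (leqnSn n) k))).
  have := congr1 (adj (blaschke a)) H.
  by rewrite adjD// adjK// adj_scale// model_kz scaler0 addr0 adj0.
have cm : c ord_max = 0.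
  have : hval (c ord_max *: kz a) a = 0.
    move: H; rewrite big1 => [|k _]; last by rewrite ck scale0r.
    by rewrite hmul0r ?add0r => [->|]; [exact: hval0|exact: inn_bddf].
  by rewrite hvalZ => /eqP; rewrite mulf_eq0 (negPf (kz_neq0 a a)) orbF => /eqP.
move=> i; case: (unliftP ord_max i) => [k ->|->//].
rewrite lift_max_widen.
exact: ck.
Qed.

Lemma spanned_model_blaschke psi a n : inn psi ->
  spanned (model psi) n -> spanned (model (blaschke a ** psi)) n.+1.
Proof.
move=> ip_ [e He].
exists (fun i : 'I_n.+1 => if unlift ord_max i is Some k then blaschke a ** e k else kz a).
move=> f; rewrite /model/= adjM// => f0; have [c Hc] := He _ f0.
set r := f - blaschke a ** adj (blaschke a) f.
have rE : r = cf r 0 *: kz a by apply: model_blaschke; exact: model_proj.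
exists (fun i => if unlift ord_max i is Some k then c k else cf r 0).
rewrite big_ord_recr/= unlift_none -rE; under eq_bigr do rewrite unlift_max_widen.
by rewrite -(lin_sum _ _ (lin_hmul (inn_blaschke a))) -Hc /r addrC subrK.
Qed.

Lemma spanned_model_constant psi (c : R[i]) : inn psi -> psi = c *: mono R 0 ->
  spanned (model psi) 0.
Proof.
move=> ip_ pE; exists (fun=> 0) => f f0; exists (fun=> 0); rewrite big_ord0.
have c0 : c != 0.
  apply/eqP => c0; have := inn_hnorm ip_; rewrite pE c0 scale0r => /esym/eqP; apply/negP.
  have -> : hnorm (0 : hfun R) = 0 by apply: complexI; rewrite -hip_norm hip0l.
  exact: oner_neq0.
apply: hip_inj => h; rewrite hip0l; have := adjP f h ip_.
rewrite f0 hip0l pE hmulZl// hmul1l hipZr => /esym/eqP.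
by rewrite mulf_eq0 conjc_eq0 (negPf c0) => /eqP.
Qed.

(** The constant 1 then equals its projection onto [psi H^2], which is [psi] times the conjugate of
    its value at 0. *)
Lemma model_trivial_constant psi : inn psi -> (forall f, model psi f -> f = 0) ->
  exists c : R[i], psi = c *: mono R 0.
Proof.
move=> ip_ H; have bp := inn_bddf ip_; have := H _ (model_proj (mono R 0) ip_).
rewrite /rproj adj_inn_mono// big_nat1 subnn hmulZr// hmul1r// => /eqP.
rewrite subr_eq0 => /eqP E; exists (conjc (cf psi 0))^-1; rewrite E scalerA mulVf ?scale1r//.
apply/eqP => c0; move: E; rewrite c0 scale0r => m0.
have := cf_mono R 0 0; rewrite m0 cf0 eqxx => /esym/eqP.
by rewrite oner_eq0.
Qed.

(** The coefficients of [f] are geometric of ratio [l]. Square-summability forces [cabs l < 1], so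
    [f] is a multiple of the kernel at the conjugate of [l], and its orthogonality to [psi] says
    that [psi] vanishes there. *)
Lemma coshift_eigenvector_zero psi (l : R[i]) f : inn psi -> model psi f -> f <> 0 ->
  adj (mono R 1) f = l *: f -> exists a, hval psi a = 0.
Proof.
move=> ip_ Kf f0 fE.
have step k : cf f k.+1 = l * cf f k by rewrite -(cfZ l) -fE cf_adj_mono add1n.
have pw k : cf f k = l ^+ k * cf f 0.
  by elim: k => [|k IH]; rewrite ?expr0 ?mul1r// step IH exprS mulrA.
have c0 : cf f 0 != 0.
  by apply/eqP => c0; apply: f0; apply: cf_inj => k; rewrite pw c0 mulr0 cf0.
have s0 : 0 < sqn (cf f 0) by rewrite lt_def sqn_eq0 c0 sqn_ge0.
have l1 : cabs l < 1.
  rewrite ltNge; apply/negP => l1; have /sqsumP[M HM] := @cf_sqsum R f.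
  have H N : N%:R * sqn (cf f 0) <= M.
    apply: le_trans (HM N); rewrite mulr_natl -[in X in X <= _](subn0 N) -sumr_const_nat.
    apply: ler_sum => k _; rewrite [cf f k]pw sqnM ler_peMl ?sqn_ge0// -cabs_sqr cabsX -exprM.
    exact: exprn_ege1.
  have M0 : 0 <= M / sqn (cf f 0) by rewrite divr_ge0 ?sqn_ge0// (le_trans _ (H 0%N))// mul0r.
  have := archi_boundP M0; rewrite ltr_pdivrMr// ltNge => /negP; apply; exact: H.
have Hl : `|conjc l| < 1 by rewrite -cabs_lt cabsJ.
pose a : disk R := exist _ (conjc l) Hl; exists a.
have fa : f = cf f 0 *: kz a.
  by apply: cf_inj => k; rewrite cfZ cf_kz /= conjcK pw mulrC.
have : hip f psi = 0.
  rewrite -[psi]hmul1r; last exact: inn_bddf.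
  by rewrite -adjP// Kf hip0l.
rewrite {1}fa hipZl hipC hip_kz => /eqP; rewrite mulf_eq0 (negPf c0) conjc_eq0.
by move/eqP.
Qed.

Lemma model_has_zero psi n : inn psi -> free_family [set 0] (model psi) n.+1 ->
  spanned (model psi) n.+1 -> exists a, hval psi a = 0.
Proof.
move=> ip_ [e Ke fe] sp.
have He : forall x, model psi x -> exists c : 'I_n.+1 -> R[i], x = \sum_(i < n.+1) c i *: e i.
  apply: free_spans => // fS; by have := free_le_span fS sp; rewrite ltnn.
pose S := adj (mono R 1); have lS : lin S by exact: lin_adj.
have KS i : model psi (S (e i)) by rewrite /model/= adj_mono_adj// Ke adj0.
have /choice[a Ha] : forall i, exists c : 'I_n.+1 -> R[i], S (e i) = \sum_(j < n.+1) c j *: e j.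
  by move=> i; exact: He.
pose A : 'M[R[i]]_n.+1 := \matrix_(i, j) a i j.
(* Row [i] of [A] holds the coordinates of [S (e i)], so a left eigenvector gives the coordinates of
   an eigenvector of [S]. *)
have [l /eigenvalueP[v vA v0]] := eigenvalue_closed A (ltn0Sn n).
pose f := \sum_(i < n.+1) v 0 i *: e i.
apply: (@coshift_eigenvector_zero psi l f) => //.
- rewrite /model/= /f (lin_sum _ _ (lin_adj ip_)) big1// => i _.
  by rewrite Ke scaler0.
- by move=> f0; move/eqP: v0; apply; apply/rowP => i; rewrite [RHS]mxE; exact: (fe (v 0) f0).
rewrite -/(S f) /f (lin_sum _ _ lS).
rewrite (eq_bigr (fun k => \sum_(j < n.+1) (v 0 k * a k j) *: e j)) => [|k _]; last first.
  by rewrite Ha scaler_sumr; apply: eq_bigr => j _; rewrite scalerA.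
rewrite exchange_big scaler_sumr; apply: eq_bigr => j _; rewrite -scaler_suml scalerA.
congr (_ *: _); have := congr1 (fun M : 'rV[R[i]]_n.+1 => M 0 j) vA; rewrite !mxE => <-.
by apply: eq_bigr => k _; rewrite mxE.
Qed.

Definition blaschke_prod (s : seq (disk R)) : hfun R :=
  foldr (fun a f => blaschke a ** f) (mono R 0) s.

Lemma inn_blaschke_prod s : inn (blaschke_prod s).
Proof. by elim: s => //= a s IH; exact: innM. Qed.

Lemma inn_scale (c : R[i]) psi : sqn c = 1 -> inn psi -> inn (c *: psi).
Proof.
move=> c1 ip_; apply: unimod_inn; apply: sqint_unimod => //.
have [w _ pw] := inn_unimod ip_; apply: (ae_circleS2 _ pw (bdZ c psi)) => t [_ p1] ->.
by rewrite sqnM c1 p1 mulr1.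
Qed.

Lemma inn_scaleE (c : R[i]) psi : inn (c *: psi) -> inn psi -> sqn c = 1.
Proof.
move=> ic ip_; have := inn_hnorm ic; rewrite hnormZ inn_hnorm// mulr1.
by [].
Qed.

Lemma model_dim_blaschke (c : R[i]) s : sqn c = 1 ->
  free_family [set 0] (model (c *: blaschke_prod s)) (size s) /\
  spanned (model (c *: blaschke_prod s)) (size s).
Proof.
move=> c1; elim: s => [|a s [fs ss]] /=.
  split; first exact: free_family0.
  by apply: spanned_model_constant => //; exact: inn_scale.
have ip_ : inn (c *: blaschke_prod s) by apply: inn_scale => //; exact: inn_blaschke_prod.
have -> : c *: (blaschke a ** blaschke_prod s) = blaschke a ** (c *: blaschke_prod s).
  by rewrite hmulZr//; exact: inn_bddf.
by split; [exact: free_model_blaschke|exact: spanned_model_blaschke].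
Qed.

(** Induction on the dimension: a zero of [psi] provides a Blaschke factor, and dividing it out
    lowers the dimension by exactly 1. *)
Lemma finite_model_blaschke n psi : inn psi ->
  free_family [set 0] (model psi) n -> spanned (model psi) n ->
  exists (c : R[i]) s, psi = c *: blaschke_prod s.
Proof.
elim: n psi => [|n IH] psi ip_ fp sp.
  have [c cE] := @model_trivial_constant psi ip_ (fun f Kf =>
    let: ex_intro e He := sp in let: ex_intro c Hc := He f Kf in etrans Hc (big_ord0 _ _ _ _)).
  by exists c, [::].
have [a pa] := model_has_zero ip_ fp sp.
have pE := inn_zero_factor ip_ pa; set psi' := adj (blaschke a) psi in pE.
have ip' : inn psi' by exact: inn_factor ip_ (inn_blaschke a) pE.
have lem m : free_family [set 0] (model psi') m -> (m.+1 <= n.+1)%N.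
  by move=> fm; apply: free_le_span sp; rewrite pE; exact: free_model_blaschke.
have [[m fm sm]|all] := dim_dichotomy (model psi'); last by have := lem _ (all n.+1); rewrite ltnn.
have mn : m = n.
  apply/eqP; rewrite eqn_leq -ltnS lem//= -ltnS; apply: free_le_span fp _.
  by rewrite pE; exact: spanned_model_blaschke.
move: fm sm; rewrite mn => fm sm; have [c [s cE]] := IH _ ip' fm sm.
exists c, (a :: s); rewrite pE cE /= hmulZr//; exact: inn_bddf.
Qed.

Lemma blaschke_prodE s z : hval (blaschke_prod s) z =
  \prod_(a <- s) ((val z - val a) / (1 - conjc (val a) * val z)).
Proof.
elim: s => [|a s IH]; first by rewrite big_nil /= monoE expr0.
by rewrite big_cons /= (hmulE _ _ (inn_bddf (inn_blaschke a))) blaschkeE IH.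
Qed.

Lemma finite_blaschkeP psi : inn psi -> finite_blaschke (hval psi) <->
  exists (c : R[i]) s, psi = c *: blaschke_prod s.
Proof.
move=> ip_; split=> [[c [s [c1 H]]]|[c [s pE]]]; exists c, s.
  by apply: hfun_ext => z; rewrite H hvalZ blaschke_prodE.
split; last by move=> z; rewrite pE hvalZ blaschke_prodE.
apply/norm_eq1; apply: (@inn_scaleE _ (blaschke_prod s)); last exact: inn_blaschke_prod.
by rewrite -pE.
Qed.

End ModelDimension.

(** * Orders of zeros and the degree *)

Section ZeroCount.
Variable R : realType.
Implicit Types (f g h : disk R -> R[i]) (a b z : disk R) (s : seq (disk R)).

Lemma analyticM f g : analytic f -> analytic g -> analytic (fun z => f z * g z).
Proof. by move=> [c cf_] [d dg]; exists (convol c d); exact: taylorM. Qed.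

Lemma analytic_hval (f : hfun R) : analytic (hval f).
Proof. by exists (cf f); exact: cf_taylor. Qed.

Lemma analytic_mul_eq0 f g : analytic f -> analytic g -> (forall z, f z * g z = 0) ->
  (forall z, f z = 0) \/ (forall z, g z = 0).
Proof.
move=> [c cf_] [d dg] fg0.
have t0 : is_taylor (convol c d) (fun=> 0).
  by have := taylorM cf_ dg; rewrite (_ : f \* g = fun=> 0)//; apply/funext.
have z0 : is_taylor (fun=> 0) (fun=> 0 : R[i]) by exact: taylor0.
have zero k u : is_taylor k u -> (forall n, k n = 0) -> forall z, u z = 0.
  by move=> ku k0 z; rewrite (taylor_eq ku z0 k0).
have [H|H] := convol_eq0 (taylor_unique t0 z0); [left|right]; exact: zero H.
Qed.

Lemma analytic_factor a m : analytic (fun z => (val z - val a) ^+ m).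
Proof.
elim: m => [|m IH].
  have := analytic_hval (mono R 0); congr analytic.
  by apply/funext => z; rewrite monoE !expr0.
have := analyticM (analytic_hval (numer a)) IH; congr analytic.
by apply/funext => z; rewrite hval_numer exprS.
Qed.

Lemma disk_neq a : exists z : disk R, val z != val a.
Proof.
have H : `|(2^-1)%:C : R[i]| < 1.
  by rewrite -cabs_lt cabs_real ger0_norm ?invr_ge0// invf_lt1// ltr1n.
have [a0|a0] := eqVneq (val a) 0; last by exists (disk0 R); rewrite eq_sym.
exists (exist _ (2^-1)%:C H); rewrite a0 /= -[X in _ != X]/(0%:C).
by rewrite (inj_eq (@complexI R)) invr_eq0.
Qed.

(** Analytic functions have no zero divisors, so the lower power of [z - a] cancels between the two
    factorizations; evaluation at [a] then gives a contradiction. *)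
Lemma zero_order_unique f a m n : zero_order f a m -> zero_order f a n -> m = n.
Proof.
suff lem k l : zero_order f a k -> zero_order f a l -> ~ (k < l)%N.
  by move=> fm fn; case: (ltngtP m n) => // H; [have := lem _ _ fm fn|have := lem _ _ fn fm].
move=> [g [ag ga fg]] [h [ah ha fh]] kl.
pose q z := (val z - val a) ^+ (l - k) * h z.
have aq : analytic q by exact: (analyticM (analytic_factor a (l - k)) ah).
have agq : analytic (fun z => g z - q z).
  have [c gc] := ag; have [d qd] := aq; exists (fun n => c n + (-1) * d n).
  have H := taylorD gc (@taylorZ R (-1) d q qd).
  rewrite (_ : (fun z => g z - q z) = g \+ (fun z => -1 * q z)); first exact: H.
  by apply/funext => z; rewrite -[RHS]/(g z + -1 * q z) mulN1r.
have z0 z : (val z - val a) ^+ k * (g z - q z) = 0.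
  by rewrite mulrBr -fg /q mulrA -exprD subnKC ?(ltnW kl)// -fh subrr.
have [H|H] := analytic_mul_eq0 (analytic_factor a k) agq z0.
  have [z /negP za] := disk_neq a; apply: za; have /eqP := H z.
  by rewrite expf_eq0 subr_eq0 => /andP[].
have := H a; rewrite /q subrr expr0n subn_eq0 leqNgt kl mul0r subr0 => /eqP.
by rewrite (negPf ga).
Qed.

Lemma zero_order_blaschke (c : R[i]) s a : c != 0 ->
  zero_order (hval (c *: blaschke_prod s)) a (count_mem a s).
Proof.
move=> c0; elim: s => [|b s [g [ag ga fg]]] /=.
  exists (hval (c *: mono R 0)); split; first exact: analytic_hval.
    by rewrite hvalZ monoE expr0 mulr1.
  by move=> z; rewrite expr0 mul1r.
have E z : hval (c *: (blaschke b ** blaschke_prod s)) z =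
    hval (blaschke b) z * ((val z - val a) ^+ count_mem a s * g z).
  by rewrite -fg !hvalZ (hmulE _ _ (inn_bddf (inn_blaschke b))) mulrCA.
have [ba|nba] := eqVneq b a.
  exists (fun z => hval (kz b) z * g z); split.
  - exact: (analyticM (analytic_hval (kz b)) ag).
  - by rewrite mulf_neq0 ?kz_neq0.
  - move=> z; rewrite E (hmulE _ _ (bddf_numer b)) hval_numer ba add1n exprS.
    by rewrite -!mulrA [hval (kz a) z * (_ * _)]mulrCA.
exists (fun z => hval (blaschke b) z * g z); split.
- exact: (analyticM (analytic_hval (blaschke b)) ag).
- rewrite mulf_neq0// (hmulE _ _ (bddf_numer b)) hval_numer mulf_neq0 ?kz_neq0//.
  by rewrite subr_eq0; apply: contraNneq nba => /val_inj ->.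
- by move=> z; rewrite E add0n mulrCA.
Qed.

(** Two lists of zeros have the same multiplicities, hence are permutations of each other. *)
Lemma zero_count_blaschke (c : R[i]) s n : c != 0 ->
  zero_count (hval (c *: blaschke_prod s)) n <-> n = size s.
Proof.
move=> c0; split=> [[s' <- H]|->]; last first.
  by exists s => // a; exact: zero_order_blaschke.
apply: perm_size; rewrite /perm_eq; apply/allP => a _; apply/eqP.
exact: zero_order_unique (H a) (zero_order_blaschke s a c0).
Qed.

Lemma degree_blaschke (c : R[i]) s : sqn c = 1 ->
  degree (hval (c *: blaschke_prod s)) = (size s)%:R%:E.
Proof.
move=> c1; have c0 : c != 0 by rewrite -sqn_eq0 c1 oner_eq0.
have ip_ : inn (c *: blaschke_prod s) by apply: inn_scale => //; exact: inn_blaschke_prod.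
rewrite /degree; case: asboolP => [_|]; last first.
  by case; apply/(finite_blaschkeP ip_); exists c, s.
congr (_ %:R%:E); apply/(zero_count_blaschke s _ c0).
by apply: xgetPex; exists (size s); apply/zero_count_blaschke.
Qed.

Lemma dim_model (psi : hfun R) : inn psi ->
  @dim_mod R (hfun R) [set 0] (model psi) = degree (hval psi).
Proof.
move=> ip_; have [[n fn sn]|all] := dim_dichotomy (model psi).
  have [c [s pE]] := finite_model_blaschke ip_ fn sn.
  have c1 : sqn c = 1.
    by apply: (@inn_scaleE _ c (blaschke_prod s)); [rewrite -pE|exact: inn_blaschke_prod].
  have [fs ss] := model_dim_blaschke s c1.
  by rewrite pE degree_blaschke//; exact: dim_mod_finite.
rewrite dim_mod_infinite// /degree; case: asboolP => // /(finite_blaschkeP ip_)[c [s pE]].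
have c1 : sqn c = 1.
  by apply: (@inn_scaleE _ c (blaschke_prod s)); [rewrite -pE|exact: inn_blaschke_prod].
have [_ ss] := model_dim_blaschke s c1.
have := free_le_span (all (size s).+1) _ => /(_ (size s)); rewrite pE => /(_ ss).
by rewrite ltnn.
Qed.

Lemma degree_lty (psi : hfun R) : inn psi ->
  (degree (hval psi) < +oo)%E <-> finite_blaschke (hval psi).
Proof.
by move=> _; rewrite /degree; case: asboolP => H; split=> //; rewrite ltry.
Qed.

End ZeroCount.

(** * Hankel operators *)

Section HankelRank.
Variable R : realType.
Implicit Types (f g h q : hfun R) (u v w : R -> R[i]).

Variable psi : hfun R.
Hypothesis ip_ : inn psi.
Let u t : R[i] := conjc (bd psi t).
Let J q t : R[i] := u t * bd q t.

Let uJ : unimod u. Proof. by apply: unimodJ; exact: inn_unimod. Qed.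

Let sqintJ_ q : sqint (J q). Proof. exact: sqint_unimodM. Qed.

Let ipJ q g : ip (J q) (bd g) = hip (adj psi q) g.
Proof. by rewrite adjP// /hip (ip_aeq (aeq_refl _) (bdM g (inn_bddf ip_))) ip_adj. Qed.

(** This splits [conj(psi) f] into its analytic part and a part that is orthogonal to the Hardy
    space. *)
Let bd_adj f : aeq (fun t => J f t - J (f - rproj psi f) t) (bd (adj psi f)).
Proof.
have [w _ p1] := inn_unimod ip_; have bp := inn_bddf ip_.
have bB : aeq (bd (f - rproj psi f)) (fun t => bd f t - bd psi t * bd (adj psi f) t).
  apply: aeq_trans (bdD _ _) _; rewrite -scaleN1r.
  apply: (ae_circleS2 _ (bdZ (-1) (rproj psi f)) (bdM (adj psi f) bp)) => t -> ->.
  by rewrite mulN1r.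
apply: (ae_circleS2 _ p1 bB) => t [_ s1]; rewrite /J /u => ->.
rewrite mulrBr opprB addrCA subrr addr0 mulrA [conjc _ * _]mulrC mulcJ s1.
by rewrite mul1r.
Qed.

(** The operator picks one of several functions that agree almost everywhere. Its choice is compared
    with an explicit projection: their difference belongs to [hardy_perp] and is orthogonal to
    itself. *)
Lemma hankelE f : aeq (hankel u (hval f)) (J (f - rproj psi f)).
Proof.
set q := f - _; have Kq : adj psi q = 0 by exact: model_proj.
pose S := [set g : R -> R[i] | hardy_perp g /\
  forall h : R -> R[i], hardy_perp h -> L2_ip ((u \* boundary (hval f)) - g) h = 0].
(* Elements of [hardy_perp] must be in [L2] on the nose, hence a measurable representative of
   [J q]. *)
have [v v2 Jv] := sqintJ_ q.
have Sv : S v.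
  split.
    split=> // g hg; have := ipJ q (HFun hg); rewrite (ip_aeq Jv (aeq_refl _)) Kq hip0l.
    by rewrite ip.unlock.
  move=> h [h2 hp]; have E : aeq ((u \* boundary (hval f)) - v) (bd (adj psi f)).
    by apply: (ae_circleS2 _ Jv (bd_adj f)) => t E1 E2; rewrite -[LHS]/(J f t - v t) -E1.
  have := ip_aeq E (aeq_refl h); rewrite [in X in X -> _]ip.unlock => ->.
  have hs : sqint h by exact: L2_sqint.
  have := hp _ (hvalP (adj psi f)); rewrite -/(bd _) => h0.
  have := ipC hs (bd_sqint (adj psi f)); rewrite ip.unlock h0 conjc0.
  by [].
have [[w2 wp] wS] : S (hankel u (hval f)).
  rewrite /hankel /orthproj; apply: (@xgetPex _ 0 S); by exists v.
have [[_ vp] vS] := Sv; set w := hankel u (hval f) in w2 wp wS *.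
have [sw sv] : sqint w /\ sqint v by split; exact: L2_sqint.
pose d t : R[i] := w t - v t.
have d2 : L2 d.
  have := L2D w2 (L2Z (-1) v2); congr L2; apply/funext => t.
  by rewrite /d mulN1r.
have pd : hardy_perp d.
  split=> // g hg; have := wp g hg; have := vp g hg.
  have sg : sqint (boundary g) by exact: hardy_sqint.
  have := ipBl sw sv sg; rewrite ip.unlock => -> -> ->.
  by rewrite subrr.
have sJ : sqint (J f) by [].
have Ew : (u \* boundary (hval f)) - w = (fun t => J f t - w t) by [].
have Ev : (u \* boundary (hval f)) - v = (fun t => J f t - v t) by [].
have sd : sqint d by exact: L2_sqint.
have := wS d pd; have := vS d pd; rewrite Ew Ev => hv hw.
have d0 : ip d d = 0.
  have dE : d = (fun t => (J f t - v t) - (J f t - w t)).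
    by apply/funext => t; rewrite /d opprB [RHS]addrC addrA subrK.
  have sJv : sqint (fun t => J f t - v t) by exact: sqintB.
  have sJw : sqint (fun t => J f t - w t) by exact: sqintB.
  have := ipBl sJv sJw sd; rewrite -dE ip.unlock hv hw subrr.
  by [].
have dn : aeq d (fun=> 0).
  by apply: norm2_eq0 => //; apply: complexI; rewrite -ip_norm2.
apply: (ae_circleS2 _ dn Jv) => t /eqP; rewrite /d subr_eq0 => /eqP -> ->.
by [].
Qed.

(** Multiplication by the unimodular [u] is injective modulo null functions, so it transports linear
    relations in both directions. *)
Let null_lincomb n (e : 'I_n -> R -> R[i]) (q : 'I_n -> hfun R) (c : 'I_n -> R[i])
    (S : R -> R[i]) : S = \sum_(i < n) c i *: e i -> (forall i, aeq (e i) (J (q i))) ->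
  Defs.null_fun S <-> \sum_(i < n) c i *: q i = 0.
Proof.
move=> SE eq_; have E : aeq S (J (\sum_(i < n) c i *: q i)).
  rewrite {}SE; elim: (index_enum _) => [|i s IH].
    rewrite !big_nil; apply: (ae_circleS _ (@bd0 R)) => t; rewrite /J => ->.
    by rewrite mulr0.
  rewrite !big_cons.
  have H := bdD (c i *: q i) (\sum_(j <- s) c j *: q j).
  have H' : aeq (c i *: e i) (J (c i *: q i)).
    apply: (ae_circleS2 _ (bdZ (c i) (q i)) (eq_ i)) => t; rewrite /J => -> e_.
    by rewrite -[LHS]/(c i * e i t) e_ /J mulrCA.
  apply: (ae_circleS3 _ H H' IH) => t; rewrite /J => -> h1 h2.
  by rewrite -[LHS]/((c i *: e i) t + (\sum_(j <- s) c j *: e j) t) h1 h2 mulrDr.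
split=> [N0|q0].
  apply: hnorm_eq0; have [w _ p1] := uJ.
  have z : aeq (bd (\sum_(i < n) c i *: q i)) (fun=> 0).
    apply: (ae_circleS3 _ E (N0 : aeq S (fun=> 0)) p1) => t -> /eqP + [_ s1].
    by rewrite mulf_eq0 -sqn_eq0 s1 oner_eq0 => /eqP.
  by apply: complexI; rewrite -hip_norm /hip ip_eq0l.
have z : aeq S (fun=> 0).
  apply: aeq_trans E _; rewrite q0; apply: (ae_circleS _ (@bd0 R)) => t; rewrite /J => ->.
  by rewrite mulr0.
exact: z.
Qed.

(** By [hankelE] the operator factors through the projection onto the model space, on which it is
    injective modulo null functions. *)
Lemma rank_hankel_model :
  rank_hankel u = @dim_mod R (hfun R) [set 0] (model psi).
Proof.
apply: dim_mod_eq => n; split=> [[e He fe]|[q Kq fq]].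
  have /choice[F HF] : forall i, exists f : hfun R, hankel u (hval f) = e i.
    by move=> i; have [f hf <-] := He i; exists (HFun hf).
  exists (fun i => F i - rproj psi (F i)) => [i|c H]; first exact: model_proj.
  apply: fe; apply/(@null_lincomb n e (fun i => F i - rproj psi (F i)) c _ erefl) => [i|]; last exact: H.
  by rewrite -HF; exact: hankelE.
exists (fun i => hankel u (hval (q i))) => [i|c H]; first by exists (hval (q i)); [exact: hvalP|].
apply: fq; apply/(@null_lincomb n (fun i => hankel u (hval (q i))) q c _ erefl) => [i|]; last exact: H.
by have := hankelE (q i); rewrite proj_model ?subr0//; exact: Kq.
Qed.

End HankelRank.

(** * The rank formula and its transfer to the original functions *)

Section RankFormula.
Variable R : realType.
Implicit Types (f g h psi chi : hfun R).

Definition commut psi1 psi2 f := rproj psi1 (rproj psi2 f) - rproj psi2 (rproj psi1 f).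

Lemma le_dim_mod (V W : lmodType R[i]) (A : set V) (B : set W) :
  (forall n, free_family [set 0] A n -> free_family [set 0] B n) ->
  (@dim_mod R V [set 0%R] A <= @dim_mod R W [set 0%R] B)%E.
Proof.
move=> H; rewrite !dim_modE; apply: le_ereal_sup => _ [n fn <-]; exists n => //.
exact: H.
Qed.

Lemma dim_commut_case psi1 psi2 : inn psi1 -> inn psi2 ->
  (forall h, model psi1 (psi2 ** h) -> h = 0) ->
  (forall f, model psi1 f -> model psi2 f -> f = 0) ->
  @dim_mod R (hfun R) [set 0] (range (commut psi1 psi2)) =
  (2%:E * Order.min (degree (hval psi1)) (degree (hval psi2)))%E.
Proof.
move=> i1 i2 H1 H12; rewrite -!dim_model//.
have le12 := @le_dim_mod _ _ (model psi1) (model psi2) (@free_model_le _ _ _ i1 i2 H1).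
rewrite (min_idPl le12).
have [[n fn sn]|all] := dim_dichotomy (model psi1).
  rewrite (dim_mod_finite fn sn) (@dim_mod_finite _ _ _ (n + n)).
  - by rewrite -EFinM mulr_natl addnn -mul2n natrM mulr_natl.
  - exact: commutator_range_free.
  - exact: commutator_range_spanned.
rewrite (dim_mod_infinite all) dim_mod_infinite; first by rewrite gt0_muley// lte_fin.
move=> n; have := commutator_range_free i1 i2 H1 H12 (all n).
(* The free family of size [n + n] is shortened to size [n]. *)
by elim: {1}n => // m IH; rewrite addSn => /free_familyS.
Qed.

(** If the first alternative fails, [coburn] gives the second; exchanging the two functions changes
    the sign of the commutator, which keeps its range. *)
Lemma dim_commut psi1 psi2 : inn psi1 -> inn psi2 ->
  (forall f, model psi1 f -> model psi2 f -> f = 0) ->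
  @dim_mod R (hfun R) [set 0] (range (commut psi1 psi2)) =
  (2%:E * Order.min (degree (hval psi1)) (degree (hval psi2)))%E.
Proof.
move=> i1 i2 H12.
have [H1|/existsNP[h /not_implyP[Kh h0]]] := pselect (forall h, model psi1 (psi2 ** h) -> h = 0).
  exact: dim_commut_case.
have H2 k : model psi2 (psi1 ** k) -> k = 0 by move=> Kk; have [] := coburn i1 i2 Kh Kk.
have swap chi1 chi2 f : inn chi1 -> inn chi2 -> commut chi1 chi2 f = commut chi2 chi1 (- f).
  move=> j1 j2; have N theta g : inn theta -> rproj theta (- g) = - rproj theta g.
    by move=> it; have [_ TZ] := lin_proj it; rewrite -scaleN1r TZ scaleN1r.
  by rewrite /commut !N// opprK addrC.
have -> : range (commut psi1 psi2) = range (commut psi2 psi1).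
  apply/seteqP; split=> _ [f _ <-].
    by exists (- f); [|exact/esym/swap].
  by exists (- f); [|exact/esym/swap].
rewrite minC; apply: (dim_commut_case i2 i1 H2) => f K2 K1; exact: H12.
Qed.

(** The values at 0 have modulus at most 1 and product 1, so the constant coefficient of [psi]
    carries its whole norm. *)
Lemma inn_mul_one psi chi : inn psi -> inn chi -> psi ** chi = mono R 0 ->
  exists c : R[i], psi = c *: mono R 0.
Proof.
move=> ip_ ic E; exists (cf psi 0).
have le1 theta : inn theta -> sqn (cf theta 0) <= 1.
  move=> it; rewrite -(inn_hnorm it).
  by have := @bessel _ (bd theta) 1 (bd_sqint _); rewrite big_nat1.
have c1 : cf psi 0 * cf chi 0 = 1.
  rewrite !cf_at0 -(hmulE _ _ (inn_bddf ip_)) E -cf_at0 cf_mono.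
  by [].
have s1 : sqn (cf psi 0) = 1.
  apply/eqP; rewrite eq_le le1//=; have := congr1 (@sqn R) c1.
  rewrite sqnM (_ : sqn 1 = 1); last by rewrite /sqn/= expr1n expr0n addr0.
  move=> <-; rewrite ler_piMr ?sqn_ge0//; exact: le1.
have : hnorm (psi - trunc psi 1) = 0.
  by rewrite hnormB_trunc big_nat1 s1 inn_hnorm// subrr.
by move/hnorm_eq0/eqP; rewrite subr_eq0 /trunc big_nat1 => /eqP.
Qed.

Lemma inner_hardy (theta : disk R -> R[i]) : inner theta -> hardy theta.
Proof. by case=> [[a at_] b _]; exact: taylor_bounded_hardy at_ b. Qed.

(** If [chi] divides both quotients, [phi chi] divides both products and hence [phi]; cancelling
    [phi] makes [chi] invertible among inner functions, so constant. *)
Lemma gcd_model_trivial (phi psi1 psi2 : hfun R) : inn phi -> inn psi1 -> inn psi2 ->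
  inner_gcd (hval phi \* hval psi1) (hval phi \* hval psi2) (hval phi) ->
  forall f, model psi1 f -> model psi2 f -> f = 0.
Proof.
move=> ip_ i1 i2 [_ _ _ H] f f1 f2; have bp := inn_bddf ip_.
apply: (coprime_inner_model i1 i2 _ f1 f2) => chi eta1 eta2 ic j1 j2 E1 E2.
have iq : inn (phi ** chi) by exact: innM.
have hv g k : bddf g -> hval (g ** k) = hval g \* hval k.
  by move=> bg; apply/funext => z; rewrite (hmulE _ _ bg).
have dvd psi eta : inn eta -> psi = chi ** eta ->
    inner_dvd (hval (phi ** chi)) (hval phi \* hval psi).
  move=> ie pE; exists (hval eta) => //.
  rewrite -!hv//; last exact: inn_bddf.
  by rewrite pE hmulA//; exact: inn_bddf.
have [eta ie pE] := H _ iq (dvd _ _ j1 E1) (dvd _ _ j2 E2).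
have he := inner_hardy ie.
have : phi ** (chi ** HFun he) = phi ** mono R 0.
  rewrite hmul1r// -hmulA//; last exact: inn_bddf.
  by apply: hval_inj; rewrite hv//; exact: inn_bddf.
by move/(hmulI ip_); exact: inn_mul_one.
Qed.

Lemma inner_projE (theta f : hfun R) : inn theta ->
  inner_proj (hval theta) (hval f) = hval (rproj theta f).
Proof.
move=> it; have bt := inn_bddf it.
have hv k : hval (theta ** k) = hval theta \* hval k.
  by apply/funext => z; rewrite (hmulE _ _ bt).
have hB g k : hval g - hval k = hval (g - k) by apply/funext => z; rewrite hvalB.
have ipE g k : hardy_ip (hval g) (hval k) = hip g k by rewrite /hip ip.unlock.
pose S := [set g | [set hval theta \* k | k in @hardy R] g /\
  forall h : disk R -> R[i], [set hval theta \* k | k in @hardy R] h -> hardy_ip (hval f - g) h = 0].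
have : S (inner_proj (hval theta) (hval f)).
  rewrite /inner_proj /orthproj; apply: (@xgetPex _ 0 S); exists (hval (rproj theta f)).
  split; first by exists (hval (adj theta f)); [exact: hvalP|rewrite -hv].
  move=> _ [k hk <-]; rewrite hB -[k]/(hval (HFun hk)) -hv ipE -adjP//.
  by rewrite [adj _ _]model_proj// hip0l.
move=> [[k hk kE] H]; pose K := HFun hk.
have gE : inner_proj (hval theta) (hval f) = hval (theta ** K) by rewrite -kE hv.
rewrite gE; congr hval; congr (theta ** _).
apply: hip_inj => g; apply/eqP; rewrite eq_sym -subr_eq0 -hipBl; apply/eqP.
rewrite -{1}(adjK K it) -adjB// adjP// -ipE -hB -gE.
by apply: H; exists (hval g); [exact: hvalP|rewrite hv].
Qed.

(** Each projection for [phi psi] is the one for [psi] between multiplication by [phi] and its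
    adjoint. In the product of two of them the inner [phi] cancels against its adjoint. *)
Lemma rank_hardy_commutator (phi psi1 psi2 : hfun R) : inn phi -> inn psi1 -> inn psi2 ->
  rank_hardy (commutator (inner_proj (hval (phi ** psi1))) (inner_proj (hval (phi ** psi2)))) =
  @dim_mod R (hfun R) [set 0] (range (commut psi1 psi2)).
Proof.
move=> ip_ i1 i2; have bp := inn_bddf ip_.
have P psi f : inn psi -> rproj (phi ** psi) f = phi ** rproj psi (adj phi f).
  by move=> ipsi; rewrite /rproj adjM// hmulA//; exact: inn_bddf.
have CE f : commutator (inner_proj (hval (phi ** psi1))) (inner_proj (hval (phi ** psi2)))
    (hval f) = hval (phi ** commut psi1 psi2 (adj phi f)).
  have [j1 j2] := (innM ip_ i1, innM ip_ i2).
  rewrite /commutator !inner_projE// !P// !adjK// /commut hmulBr//.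
  by apply/funext => z; rewrite hvalB.
have lincomb n (c : 'I_n -> R[i]) (x : 'I_n -> hfun R) (e : 'I_n -> disk R -> R[i])
    (S : disk R -> R[i]) : S = \sum_(i < n) c i *: e i ->
    (forall i, e i = hval (phi ** x i)) -> S = 0 <-> \sum_(i < n) c i *: x i = 0.
  move=> SE ex; have -> : S = hval (phi ** (\sum_(i < n) c i *: x i)).
    rewrite hmul_sumr// SE; apply/funext => z; rewrite hval_sum fct_sumE.
    by apply: eq_bigr => i _; rewrite hmulZr// hvalZ ex.
  split=> [S0|->]; last by rewrite hmul0r//; apply/funext => z; exact: hval0.
  apply: (hmulI ip_); rewrite hmul0r//; apply: hfun_ext => z.
  by rewrite S0 hval0.
apply: dim_mod_eq => n; split=> [[e He fe]|[x Hx fx]].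
  have /choice[F HF] : forall i, exists f : hfun R,
      e i = hval (phi ** commut psi1 psi2 (adj phi f)).
    by move=> i; have [f hf <-] := He i; exists (HFun hf); rewrite -CE.
  exists (fun i => commut psi1 psi2 (adj phi (F i))) => [i|c H]; first by exists (adj phi (F i)).
  by apply: fe; apply/(lincomb n c _ e _ erefl HF).
have /choice[F HF] : forall i, exists f : hfun R, commut psi1 psi2 f = x i.
  by move=> i; have [f _ <-] := Hx i; exists f.
exists (fun i => hval (phi ** x i)) => [i|c H].
  by exists (hval (phi ** F i)); [exact: hvalP|rewrite CE adjK// HF].
by apply: fx; apply/(lincomb n c x _ _ erefl (fun=> erefl)).
Qed.

End RankFormula.

Theorem corollary3p4 (R : realType)
    (phi1 phi2 phi psi1 psi2 : disk R -> R[i])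
    (inner_phi1 : inner phi1) (inner_phi2 : inner phi2)
    (phi12_neq : phi1 <> phi2)
    (phi_gcd : inner_gcd phi1 phi2 phi)
    (inner_psi1 : inner psi1) (phi1E : phi1 = phi \* psi1)
    (inner_psi2 : inner psi2) (phi2E : phi2 = phi \* psi2) :
  let rank_comm :=
    rank_hardy (commutator (inner_proj phi1) (inner_proj phi2)) in
  let rank_conj_hankel psi := rank_hankel (fun t => conjc (boundary psi t)) in
  [/\ (rank_comm < +oo)%E <-> finite_blaschke psi1 \/ finite_blaschke psi2,
      finite_blaschke psi1 \/ finite_blaschke psi2 <->
        (rank_conj_hankel psi1 < +oo)%E \/ (rank_conj_hankel psi2 < +oo)%E
    & (rank_comm < +oo)%E ->
        rank_comm = (2%:E * Order.min (degree psi1) (degree psi2))%E].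
Proof.
move=> rank_comm rank_conj_hankel.
have [inner_phi _ _ _] := phi_gcd.
have [h h1 h2] : [/\ hardy phi, hardy psi1 & hardy psi2] by split; exact: inner_hardy.
pose p := HFun h; pose p1 := HFun h1; pose p2 := HFun h2.
have [ip_ i1 i2] : [/\ inn p, inn p1 & inn p2] by [].
have pE q : hval (p ** q) = hval p \* hval q.
  by apply/funext => z; rewrite (hmulE _ _ (inn_bddf ip_)).
have H12 : forall f, model p1 f -> model p2 f -> f = 0.
  apply: (gcd_model_trivial ip_ i1 i2); move: phi_gcd; rewrite phi1E phi2E.
  exact.
(* The formula is proved in the extended reals, and the equivalences are read off from it. *)
have rcE : rank_comm = (2%:E * Order.min (degree psi1) (degree psi2))%E.
  rewrite /rank_comm phi1E phi2E -[phi \* psi1](pE p1) -[phi \* psi2](pE p2).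
  rewrite rank_hardy_commutator//; exact: dim_commut.
have rhE (q : hfun R) : inn q -> rank_conj_hankel (hval q) = degree (hval q).
  by move=> iq; rewrite -dim_model//; exact: rank_hankel_model.
have mE : (rank_comm < +oo)%E <-> finite_blaschke psi1 \/ finite_blaschke psi2.
  have d1 := degree_lty i1; have d2 := degree_lty i2.
  have dge0 psi : (0 <= degree psi :> \bar R)%E.
    by rewrite /degree; case: ifP => _; rewrite ?lee_fin ?leey.
  rewrite rcE; split.
    have fin2 x : (0 <= x :> \bar R)%E -> (2%:E * x < +oo)%E -> (x < +oo)%E.
      by case: x => [x||]//; rewrite ?ltry// => _; rewrite gt0_muley// lte_fin.
    case: (leP (degree psi1) (degree psi2)) => _ /fin2 H; [left|right].
      by apply/d1/H; exact: dge0.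
    by apply/d2/H; exact: dge0.
  have fin x : (0 <= x :> \bar R)%E -> (x < +oo)%E -> (2%:E * x < +oo)%E.
    by case: x => // x _ _; rewrite -EFinM ltry.
  move=> H; apply: fin; first by rewrite le_min !dge0.
  by rewrite gt_min; apply/orP; case: H => H; [left; exact/d1|right; exact/d2].
split=> //.
rewrite (rhE p1 i1) (rhE p2 i2); split=> -[H|H].
- by left; exact/(degree_lty i1).
- by right; exact/(degree_lty i2).
- by left; exact/(degree_lty i1).
- by right; exact/(degree_lty i2).
Qed.
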